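(* Let $n\in\{2,3\}$ and $\gamma\in\{-1,1\}$. Let $f_0\in L^1\cap L^\infty(\mathbb{R}^n\times \mathbb{R}^n)$ be nonnegative and such that $$\iint_{\mathbb{R}^n\times \mathbb{R}^n} |v|^m f_0(x,v)\,dx\,dv<+\infty\quad\text{for some } m>n^2-n.$$ Let $T>0$ and let $f\in L^\infty([0,T],L^1\cap L^\infty(\mathbb{R}^n\times \mathbb{R}^n))$ be a Lions-Perthame weak solution of the Vlasov-Poisson system on $[0,T]$ with initial datum $f_0$, as described in the context (in particular $\sup_{t\in[0,T]}\iint |v|^m f(t,x,v)\,dx\,dv<+\infty$). If there is a constant $C_0$ such that $$\forall k\geq 1,\quad \iint_{\mathbb{R}^n\times \mathbb{R}^n} |v|^k f_0(x,v)\,dx\,dv\leq (C_0 k)^{\frac{k}{n}},$$ then the macroscopic density $\rho(t,x)=\int_{\mathbb{R}^n} f(t,x,v)\,dv$ satisfies $$\sup_{t\in[0,T]}\ \sup_{1\le p<\infty} \frac{\|\rho(t)\|_{L^p(\mathbb{R}^n)}}{p}<+\infty .$$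
   Context: The Vlasov-Poisson system in dimension $n=2$ or $n=3$ is $$\partial_t f+v\cdot \nabla_x f+E\cdot \nabla_v f=0,\qquad E(t,x)=\gamma \int_{\mathbb{R}^n} \frac{x-y}{|x-y|^n}\, \rho(t,y)\,dy,\qquad \rho(t,x)=\int_{\mathbb{R}^n} f(t,x,v)\,dv,$$ for $(t,x,v)\in[0,T]\times\mathbb{R}^n\times\mathbb{R}^n$, where $\gamma=\pm1$ and the unknown is $f=f(t,x,v)\ge 0$. A weak solution on $[0,T]$ with initial datum $f_0$ is a nonnegative $f\in L^\infty([0,T],L^1\cap L^\infty(\mathbb{R}^n\times\mathbb{R}^n))$ satisfying the system in the sense of distributions, i.e. for every $\psi\in C_c^\infty([0,T)\times\mathbb{R}^n\times\mathbb{R}^n)$, $$\int_0^T\!\!\iint f\,(\partial_t\psi+v\cdot\nabla_x\psi+E\cdot\nabla_v\psi)\,dx\,dv\,dt+\iint f_0\,\psi(0,\cdot,\cdot)\,dx\,dv=0.$$ Suprema in $t$ are understood up to null sets of times. Lions-Perthame weak solution: for $f_0$ nonnegative in $L^1\cap L^\infty$ with $\iint|v|^m f_0<\infty$ for some $m>n^2-n$, Lions and Perthame constructed (for $n=3$; the case $n=2$ is a straightforward adaptation) a weak solution $f\in L^\infty(\mathbb{R}_+,L^1\cap L^\infty)$ which propagates this moment: for every $T>0$, $\sup_{t\in[0,T]}\iint |v|^m f(t,x,v)\,dx\,dv<+\infty$. Here ''Lions-Perthame weak solution on $[0,T]$'' means a weak solution on $[0,T]$ with initial datum $f_0$ having this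 property for the given $m$. *)

(* Defs.v *)
From HB Require Import structures.
From mathcomp Require Import all_boot all_order all_algebra.
From mathcomp Require Import all_classical all_reals all_analysis.
From mathcomp Require Import ess_sup_inf.

Set Implicit Arguments.
Unset Strict Implicit.
Unset Printing Implicit Defensive.

Import Order.TTheory GRing.Theory Num.Theory.
Import numFieldNormedType.Exports.

Local Open Scope classical_set_scope.
Local Open Scope ring_scope.

(* The canonical sigma-finite structure that the library attaches to m1 \x m2 is
   the one of a product of subprobabilities, hence this lemma. *)
Lemma sigma_finite_product_measure1 d1 d2 (T1 : measurableType d1)
    (T2 : measurableType d2) (R : realType)
    (m1 : {sigma_finite_measure set T1 -> \bar R})
    (m2 : {sigma_finite_measure set T2 -> \bar R}) :
  sigma_finite setT (m1 \x m2)%E.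
Proof.
have /sigma_finiteP[F [TF ndF Foo]] := sigma_finiteT m1.
have /sigma_finiteP[G [TG ndG Goo]] := sigma_finiteT m2.
exists (fun n => F n `*` G n).
 rewrite -setXTT TF TG predeqE => -[x y]; split.
    move=> [/= [n _ Fnx] [k _ Gky]]; exists (maxn n k) => //; split.
    - by move: x Fnx; exact/subsetPset/ndF/leq_maxl.
    - by move: y Gky; exact/subsetPset/ndG/leq_maxr.
  by move=> [n _ []/= ? ?]; split; exists n.
move=> k; have [? ?] := Foo k; have [? ?] := Goo k.
split; first exact: measurableX.
by rewrite product_measure1E// lte_mul_pinfty// ge0_fin_numE.
Qed.

(* 'rV[R]_n carries the product sigma-algebra of the Borel sets of R, in the
   same way as n.-tuple R does in measurable_structure. *)
Section measurable_rV.
Context {R : realType} {n : nat}.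

Let coor (i : 'I_n) (x : 'rV[R]_n) : R := x ord0 i.

Let rV_set0 : g_sigma_preimage coor set0.
Proof. exact: sigma_algebra0. Qed.

Let rV_setC A : g_sigma_preimage coor A -> g_sigma_preimage coor (~` A).
Proof. exact: sigma_algebraC. Qed.

Let rV_bigcup (F : _^nat) : (forall i, g_sigma_preimage coor (F i)) ->
  g_sigma_preimage coor (\bigcup_i (F i)).
Proof. exact: sigma_algebra_bigcup. Qed.

HB.instance Definition _ :=
  @isMeasurable.Build (measure_tuple_display default_measure_display)
    'rV[R]_n (g_sigma_preimage coor) rV_set0 rV_setC rV_bigcup.

Lemma measurable_coor (i : 'I_n) :
  measurable_fun [set: 'rV[R]_n] (fun x => x ord0 i).
Proof.
move=> _ Y mY; rewrite setTI; apply: sub_sigma_algebra => /=.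
rewrite -bigcup_seq/=; exists i => /=; first by rewrite mem_index_enum.
by exists Y => //; rewrite setTI.
Qed.

Lemma measurable_fun_rVP d (T : measurableType d) (f : T -> 'rV[R]_n) :
  (forall i, measurable_fun [set: T] (fun t => f t ord0 i)) ->
  measurable_fun [set: T] f.
Proof.
move=> mf _ A mA; rewrite setTI.
suff : g_sigma_preimage coor `<=` (fun B => measurable (f @^-1` B)) by apply.
apply: smallest_sub.
  split=> [|B mB|F mF]; first by rewrite preimage_set0.
  - by rewrite setTD preimage_setC; exact: measurableC.
  - by rewrite preimage_bigcup; exact: bigcup_measurable.
rewrite -bigcup_seq/=; apply: bigcup_sub => i _ _ [B mB <-].
by rewrite setTI -[X in measurable X]setTI; exact: mf.
Qed.

End measurable_rV.

(* Lebesgue measure on 'rV[R]_n, by recursion on n: the image of the product of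
   the Lebesgue measures of R and R^n under (a, x) |-> (a, x_1, ..., x_n). *)
Section lebesgue_measure_rV.
Context {R : realType}.
Local Open Scope ereal_scope.

Definition rV_cons n (p : measurableTypeR R * 'rV[R]_n) : 'rV[R]_n.+1 :=
  row_mx (p.1%:M : 'rV[R]_1) p.2.

Definition rV_uncons n (x : 'rV[R]_n.+1) : measurableTypeR R * 'rV[R]_n :=
  (x ord0 ord0, \row_j x ord0 (lift ord0 j)).

Lemma rV_consE0 n (p : measurableTypeR R * 'rV[R]_n) :
  rV_cons p ord0 ord0 = p.1.
Proof.
have -> : (ord0 : 'I_n.+1) = lshift n (ord0 : 'I_1) by exact: val_inj.
by rewrite /rV_cons (row_mxEl (p.1%:M : 'rV_1)) mxE eqxx mulr1n.
Qed.

Lemma rV_consES n (p : measurableTypeR R * 'rV[R]_n) (j : 'I_n) :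
  rV_cons p ord0 (lift ord0 j) = p.2 ord0 j.
Proof.
have -> : lift ord0 j = rshift 1 j by exact: val_inj.
by rewrite /rV_cons (row_mxEr (p.1%:M : 'rV_1)).
Qed.

Lemma rV_consK n : cancel (@rV_cons n) (@rV_uncons n).
Proof.
move=> [a x]; rewrite /rV_uncons rV_consE0; congr pair.
by apply/rowP => j; rewrite mxE rV_consES.
Qed.

Lemma measurable_rV_cons n : measurable_fun setT (@rV_cons n).
Proof.
apply: measurable_fun_rVP => i; have [j ->|->] := unliftP ord0 i.
- under eq_fun do rewrite rV_consES.
  by apply: (measurableT_comp (measurable_coor j)).
- by under eq_fun do rewrite rV_consE0; exact: measurable_fst.
Qed.

Lemma measurable_rV_uncons n : measurable_fun setT (@rV_uncons n).
Proof.
apply: measurable_fun_pair; first exact: measurable_coor.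
apply: measurable_fun_rVP => j; under eq_fun do rewrite mxE.
exact: measurable_coor.
Qed.

Section lebesgue_measure_rVS.
Variables (n : nat) (mu : {sigma_finite_measure set 'rV[R]_n -> \bar R}).

Definition lebesgue_measure_rVS : set 'rV[R]_n.+1 -> \bar R :=
  pushforward (lebesgue_measure \x mu) (@rV_cons n).

Let m : {measure set 'rV[R]_n.+1 -> \bar R} :=
  measure_function_pushforward__canonical__measure_function_Measure
    (lebesgue_measure \x mu) (@measurable_rV_cons n).

Let m0 : lebesgue_measure_rVS set0 = 0.
Proof. exact: (measure0 m). Qed.

Let m_ge0 A : 0 <= lebesgue_measure_rVS A.
Proof. exact: (measure_ge0 m). Qed.

Let m_sigma_additive : semi_sigma_additive lebesgue_measure_rVS.
Proof. exact: (@measure_semi_sigma_additive _ _ _ m). Qed.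

HB.instance Definition _ := isMeasure.Build _ _ _ lebesgue_measure_rVS
  m0 m_ge0 m_sigma_additive.

Let m_sigma_finite : sigma_finite setT lebesgue_measure_rVS.
Proof.
have [F FT Foo] : sigma_finite setT (lebesgue_measure \x mu).
  exact: sigma_finite_product_measure1.
exists (fun k => @rV_uncons n @^-1` F k) => [|k].
  by rewrite -preimage_bigcup -FT preimage_setT.
have [mF Fk] := Foo k; split.
  by rewrite -[X in measurable X]setTI; exact: measurable_rV_uncons.
rewrite /lebesgue_measure_rVS /pushforward -comp_preimage.
rewrite (_ : _ \o _ = idfun)//; apply/funext; exact: rV_consK.
Qed.

HB.instance Definition _ :=
  Measure_isSigmaFinite.Build _ _ _ lebesgue_measure_rVS m_sigma_finite.

End lebesgue_measure_rVS.

Fixpoint lebesgue_measure_rV n : {sigma_finite_measure set 'rV[R]_n -> \bar R} :=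
  match n with
  | 0%N => \d_(0%R : 'rV[R]_0)
  | n'.+1 => lebesgue_measure_rVS (lebesgue_measure_rV n')
  end.

Lemma lebesgue_measure_rV_box n (A : 'I_n -> set (measurableTypeR R)) :
  (forall i, measurable (A i)) ->
  lebesgue_measure_rV n [set x | forall i, A i (x ord0 i)] =
  \prod_(i < n) lebesgue_measure (A i).
Proof.
elim: n A => [|n IHn] A mA.
  by rewrite big_ord0 /= diracE mem_set// => -[].
rewrite big_ord_recl /= /lebesgue_measure_rVS /pushforward.
pose B := [set x : 'rV[R]_n | forall i, A (lift ord0 i) (x ord0 i)].
have mB : measurable B.
  rewrite (_ : B = \bigcap_(i in [set: 'I_n])
      ((fun x : 'rV[R]_n => x ord0 i) @^-1` A (lift ord0 i))).
    apply: fin_bigcap_measurable => [|i _]; first exact: finite_finset.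
    by rewrite -[X in measurable X]setTI; apply: measurable_coor => //; exact: mA.
  by apply/seteqP; split => [x Bx i _|x Bx i]; [exact: Bx|exact: (Bx i)].
rewrite (_ : _ @^-1` _ = A ord0 `*` B); last first.
  apply/seteqP; split => [p Ap|p [Ap0 Bp] i] /=.
  - split; first by have := Ap ord0; rewrite rV_consE0.
    by move=> i; have := Ap (lift ord0 i); rewrite rV_consES.
  - have [j ->|->] := unliftP ord0 i; first by rewrite rV_consES; exact: Bp.
    by rewrite rV_consE0.
by rewrite product_measure1E// (IHn (fun i => A (lift ord0 i))).
Qed.

End lebesgue_measure_rV.
Arguments lebesgue_measure_rV : clear implicits.

(* The norm of the normed module 'rV[R]_n is the sup norm. *)
Definition enorm {R : realType} {n : nat} (x : 'rV[R]_n) : R :=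
  Num.sqrt (\sum_(i < n) x ord0 i ^+ 2).

Section smooth.
Context {R : realType} {V : normedModType R}.

Fixpoint is_Ck (k : nat) (f : V -> R) : Prop :=
  match k with
  | 0%N => continuous f
  | k'.+1 => (forall z, differentiable f z) /\ forall v, is_Ck k' ('D_v f)
  end.

Definition smooth (f : V -> R) : Prop := forall k, is_Ck k f.

Definition tsupport (f : V -> R) : set V := closure [set z | f z != 0].

End smooth.

Section vlasov_poisson.
Context {R : realType} {n : nat}.

Local Notation Rn := 'rV[R]_n.
Local Notation leb := (lebesgue_measure_rV R n).
Local Notation leb2 := (leb \x leb)%E.

Implicit Types (g : Rn * Rn -> R) (f : R -> Rn * Rn -> R)
  (psi : R * (Rn * Rn) -> R).

Definition moment (k : R) g : \bar R :=
  (\int[leb2]_z (enorm z.2 `^ k * g z)%:E)%E.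

Definition density g (x : Rn) : \bar R := (\int[leb]_v (g (x, v))%:E)%E.

(* The density may be infinite on a null set of points y; the kernel is 0 at
   y = x since 0^-1 = 0. When density g is integrable, the integral converges
   absolutely for almost every x. *)
Definition electric_field (gamma : R) g (x : Rn) : Rn :=
  \row_(i < n) (gamma * fine
    (\int[leb]_y (((x - y) ord0 i / enorm (x - y) ^+ n)%:E * density g y))%E).

Definition time_ess_sup (T : R) (u : R -> \bar R) : \bar R :=
  ess_sup (mrestr lebesgue_measure (measurable_itv `[0, T])) u.

(* An element of L^oo([0, T], L^1 /\ L^oo) is represented by a function that is
   jointly Borel measurable in (t, x, v). *)
Definition Linfty_L1_Linfty (T : R) f : Prop :=
  [/\ measurable_fun (`[0, T] `*` setT)
        (fun p : R * (Rn * Rn) => f p.1 p.2),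
      (time_ess_sup T (fun t => 'N[leb2]_1 [EFin \o f t]) < +oo)%E &
      (time_ess_sup T (fun t => 'N[leb2]_+oo [EFin \o f t]) < +oo)%E].

(* A function of C_c^oo([0, T) x R^n x R^n) is represented by a smooth function
   on R x R^n x R^n with compact support in (-oo, T) x R^n x R^n, of which only
   the values for t >= 0 are used. *)
Definition test_function (T : R) psi : Prop :=
  [/\ smooth psi, compact (tsupport psi) &
      tsupport psi `<=` [set z | z.1 < T]].

Definition dt psi (z : R * (Rn * Rn)) : R := 'D_((1, (0, 0)) : R * (Rn * Rn)) psi z.

Definition dx (i : 'I_n) psi (z : R * (Rn * Rn)) : R :=
  'D_((0, (delta_mx ord0 i, 0)) : R * (Rn * Rn)) psi z.

Definition dv (i : 'I_n) psi (z : R * (Rn * Rn)) : R :=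
  'D_((0, (0, delta_mx ord0 i)) : R * (Rn * Rn)) psi z.

Definition vlasov_operator (E : Rn -> Rn) psi (t : R) (z : Rn * Rn) : R :=
  dt psi (t, z) + \sum_(i < n) z.2 ord0 i * dx i psi (t, z)
                + \sum_(i < n) E z.1 ord0 i * dv i psi (t, z).

Definition weak_solution (gamma T : R) g f : Prop :=
  [/\ Linfty_L1_Linfty T f,
      \forall t \ae lebesgue_measure, t \in `[0, T] ->
        \forall z \ae leb2, 0 <= f t z &
      forall psi, test_function T psi ->
        (\int[lebesgue_measure]_(t in `[0, T]) \int[leb2]_z
           (f t z * vlasov_operator (electric_field gamma (f t)) psi t z)) +
        (\int[leb2]_z (g z * psi (0, z))) = 0].

Definition lions_perthame_solution (gamma m T : R) g f : Prop :=
  weak_solution gamma T g f /\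
  (time_ess_sup T (fun t => moment m (f t)) < +oo)%E.

End vlasov_poisson.

(* Main.v *)
Require Import Defs.
From HB Require Import structures.
From mathcomp Require Import all_boot all_order all_algebra.
From mathcomp Require Import all_classical all_reals all_analysis.
From mathcomp Require Import ess_sup_inf measurable_realfun.
From mathcomp Require Import ring lra.

(** The moment of order m keeps the electric field bounded, a bounded field can
only translate the velocity tails of the solution, and interpolation turns the
resulting control of all velocity moments into norms of the density.

The field. Each component of the field is at most the integral of
|x - y|^(1-n) f(t, y, v). Around x the kernel is dominated by 1 plus the sum
over j of 2^((j+1)(n-1)) times the indicator of the cube of half-side 2^-j. On
the j-th cube the velocities are cut at b^j: slow ones are controlled by the sup
bound on f and the volume, fast ones by the moment of order m. This produces two
geometric series, of ratios b^n / 2 and 2^(n-1) / b^m, and some b makes both of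
them converge precisely when n^2 - n < m ([dyadic_base],
[integral_coulomb_bounded]). Hence |E| <= M uniformly in time and space.

The tails. Such a field moves a velocity coordinate at speed at most M, so the
mass of f(t) in { +- v_i > M t + lam } should not exceed the one of f0 in
{ +- v_i > lam }. A weak solution has no trajectories to follow when the field is
merely bounded, but the inequality can be read on the weak formulation: if s is a
smooth nondecreasing step, the transport derivative of s(+- v_i - M t - lam) is
(+- E_i - M) s', which is nonpositive. Cutoffs in (x, v) are sent to infinity by
dominated convergence ([tail_weak]) and a time window shrinks to a Lebesgue point
([lebesgue_pt_window_le]). There are countably many tails with lam integer, so
almost every time is good for all of them ([tail_ae]).

The moments. Summing the tail inequalities over the integer levels lam, weighted
by the increments of N |-> (N + c)^k, bounds the moment of |v_i|^k at time t by
c^k times the mass plus twice the moment of (|v_i| + 1 + c)^k for f0, with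
c = M T + 1 and for all exponents k >= 0 at the same times
([moment_le_of_tails]).

The norms. With k = n (p - 1), splitting the velocity integral at a radius
proportional to rho^(1/n) gives rho^p <= C^(p-1) * int |v|^k f dv up to a
constant ([density_powR_le]). The assumption on f0, used with exponent k + 1
which is at least 1 and at most n p, bounds the integral of rho^p by (D p)^p for
some D that depends neither on p nor on t; the p-th root is linear in p
([Lnorm_density_linear]).

The estimates are carried out on a version of f whose bounds hold at every time
and every point ([regular_representative]). *)

Import Order.TTheory GRing.Theory Num.Theory.
Import numFieldNormedType.Exports.

Local Open Scope classical_set_scope.
Local Open Scope ring_scope.

Set Implicit Arguments.
Unset Strict Implicit.
Unset Printing Implicit Defensive.

(** * Calculus of smooth functions *)

Section smooth_algebra.
Context {R : realType} {V : normedModType R}.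
Implicit Types (f g : V -> R).

Lemma is_CkW k f : is_Ck k.+1 f -> is_Ck k f.
Proof.
elim: k f => [|k IH] f [df cf].
  by move=> z; exact: differentiable_continuous.
by split=> // v; exact/IH/cf.
Qed.

Lemma is_Ck_cst k (c : R) : is_Ck k (cst c : V -> R).
Proof.
elim: k c => [|k IH] c; first exact: cst_continuous.
split=> [z|v]; first exact: differentiable_cst.
rewrite (_ : 'D_v (cst c) = cst 0); first exact: IH.
by apply/funext => z; rewrite derive_cst.
Qed.

Lemma is_CkD k f g : is_Ck k f -> is_Ck k g -> is_Ck k (f + g).
Proof.
elim: k f g => [|k IH] f g.
  by move=> cf cg z; apply: continuousD; [exact: cf|exact: cg].
move=> [df cf] [dg cg]; split=> [z|v]; first exact: differentiableD.
rewrite (_ : 'D_v (f + g) = 'D_v f + 'D_v g).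
  by apply: IH; [exact: cf|exact: cg].
by apply/funext => z; rewrite deriveD//; exact: diff_derivable.
Qed.

Lemma is_CkM k f g : is_Ck k f -> is_Ck k g -> is_Ck k (f * g).
Proof.
elim: k f g => [|k IH] f g.
  by move=> cf cg z; apply: continuousM; [exact: cf|exact: cg].
move=> Cf Cg; have [df cf] := Cf; have [dg cg] := Cg.
split=> [z|v]; first exact: differentiableM.
rewrite (_ : 'D_v (f * g) = f * 'D_v g + g * 'D_v f).
  by apply: is_CkD; apply: IH; [exact: is_CkW|exact: cg|exact: is_CkW|exact: cf].
by apply/funext => z; rewrite deriveM//; exact: diff_derivable.
Qed.

Lemma is_CkV k f : (forall z, f z != 0) -> is_Ck k f ->
  is_Ck k (fun z => (f z)^-1).
Proof.
move=> f0; elim: k => [|k IH].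
  by move=> cf z; apply: continuousV; [exact: f0|exact: cf].
move=> Cf; have [df cf] := Cf.
split=> [z|v]; first exact: differentiableV.
have Cv := IH (is_CkW Cf).
rewrite (_ : 'D_v _ = cst (-1) * (fun z => (f z)^-1) * (fun z => (f z)^-1)
   * 'D_v f).
  apply: is_CkM; last exact: cf.
  by apply: is_CkM => //; apply: is_CkM => //; exact: is_Ck_cst.
apply/funext => z; rewrite deriveV//; last exact: diff_derivable.
by rewrite !fctE /= mulN1r expr2 invfM mulNr.
Qed.

Lemma smooth_cst c : smooth (cst c : V -> R).
Proof. by move=> k; exact: is_Ck_cst. Qed.

Lemma smoothM f g : smooth f -> smooth g -> smooth (f * g).
Proof. by move=> sf sg k; exact: is_CkM. Qed.

Lemma smooth_prod (I : Type) (r : seq I) (F : I -> V -> R) :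
  (forall i, smooth (F i)) -> smooth (fun z => \prod_(i <- r) F i z).
Proof.
move=> sF; elim: r => [|i r IH].
  rewrite (_ : (fun _ => _) = cst 1); first exact: smooth_cst.
  by apply/funext => z; rewrite big_nil.
rewrite (_ : (fun _ => _) = F i * (fun z => \prod_(j <- r) F j z)).
  exact: smoothM.
by apply/funext => z; rewrite big_cons.
Qed.

(** [l'] is the linear part of [l]. Keeping it as a parameter makes the derivative
of l along v the constant [l' v], which the induction in [smooth_comp_affine]
needs. *)
Definition affine_fun (l l' : V -> R) :=
  (forall z, differentiable l z) /\ forall v z, 'D_v l z = l' v.

Lemma derive_comp_scalar (g : R -> R) (l : V -> R) z v :
  differentiable l z -> differentiable g (l z) ->
  'D_v (g \o l) z = 'D_v l z * 'D_1 g (l z).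
Proof.
move=> dl dg; rewrite deriveE; last exact: differentiable_comp.
rewrite diff_comp //= -[X in 'd g _ X = _]mulr1 [LHS]linearZ.
by rewrite (deriveE _ dl) (deriveE _ dg).
Qed.

(** Differentiating g o l multiplies by a constant and replaces g by its derivative,
so the induction on the order never leaves the compositions with [l]. *)
Lemma smooth_comp_affine (g : R -> R) (l l' : V -> R) :
  smooth g -> affine_fun l l' -> smooth (g \o l).
Proof.
move=> sg [dl cl] k; have {sg} := sg k; elim: k g => [|k IH] g.
  move=> cg z; apply: continuous_comp; last exact: cg.
  exact/differentiable_continuous/dl.
move=> [dg cg]; split=> [z|v]; first exact: differentiable_comp.
rewrite (_ : 'D_v _ = cst (l' v) * ('D_1 g \o l)).
  by apply: is_CkM; [exact: is_Ck_cst|exact: (IH _ (cg 1))].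
by apply/funext => z; rewrite derive_comp_scalar// cl.
Qed.

Lemma affine_linear (l : V -> R) : continuous l ->
  (forall a u w, l (a *: u + w) = a * l u + l w) -> affine_fun l l.
Proof.
move=> cl ll.
pose L : {linear V -> R^o} := HB.pack l (GRing.isLinear.Build R V R^o _ l ll).
have dL z : differentiable l z by exact: (@linear_differentiable _ _ _ L).
by split=> [//|v z]; rewrite deriveE// (@diff_lin _ _ _ L).
Qed.

Lemma affine_cst c : affine_fun (cst c) (cst 0).
Proof. by split=> [z|v z]; [exact: differentiable_cst|rewrite derive_cst]. Qed.

Lemma affineD f g f' g' : affine_fun f f' -> affine_fun g g' ->
  affine_fun (fun z => f z + g z) (fun z => f' z + g' z).
Proof.
move=> [df Df] [dg Dg]; split=> [z|v z]; first exact: differentiableD.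
by rewrite (deriveD (f := f))//= ?Df ?Dg//; exact: diff_derivable.
Qed.

Lemma affineM c f f' : affine_fun f f' ->
  affine_fun (fun z => c * f z) (fun z => c * f' z).
Proof.
move=> [df Df]; split=> [z|v z].
  by apply: differentiableM => //; exact: differentiable_cst.
rewrite (deriveM (f := cst c))//=; last exact: diff_derivable.
by rewrite derive_cst Df scaler0 addr0.
Qed.

Lemma differentiable_prod (I : Type) (r : seq I) (F : I -> V -> R) z :
  (forall i, differentiable (F i) z) ->
  differentiable (fun z => \prod_(i <- r) F i z) z.
Proof.
move=> dF; elim: r => [|i r IH].
  rewrite (_ : (fun _ => _) = cst 1); first exact: differentiable_cst.
  by apply/funext => y; rewrite big_nil.
rewrite (_ : (fun _ => _) = F i * (fun z => \prod_(j <- r) F j z)).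
  exact: differentiableM.
by apply/funext => y; rewrite big_cons.
Qed.

(** The product rule in this form isolates, for each factor, the product of the
others, which is a bounded weight in the estimates below. *)
Lemma derive_prod (I : eqType) (r : seq I) (F : I -> V -> R) z v : uniq r ->
  (forall i, differentiable (F i) z) ->
  'D_v (fun z => \prod_(i <- r) F i z) z =
  \sum_(i <- r) 'D_v (F i) z * \prod_(j <- r | j != i) F j z.
Proof.
move=> + dF; elim: r => [_|i r IH /= /andP[ir ur]].
  rewrite (_ : (fun _ => _) = cst 1); first by rewrite derive_cst big_nil.
  by apply/funext => y; rewrite big_nil.
rewrite (_ : (fun _ => _) = F i * (fun z => \prod_(j <- r) F j z)); last first.
  by apply/funext => y; rewrite big_cons.
rewrite deriveM//; [|exact: diff_derivable|]; last first.
  exact/diff_derivable/differentiable_prod.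
rewrite IH// big_cons big_cons eqxx /= addrC; congr (_ + _).
  rewrite mulrC; congr (_ * _); rewrite [RHS]big_seq_cond [LHS]big_seq.
  apply: eq_bigl => j; case: (boolP (j \in r)) => //= jr.
  by symmetry; apply: contraNN ir => /eqP <-.
rewrite scaler_sumr [LHS]big_seq [RHS]big_seq; apply: eq_bigr => j jr.
rewrite big_cons ifT; first by rewrite /GRing.scale /= mulrCA.
by apply: contraNN ir => /eqP ->.
Qed.

End smooth_algebra.

Section flat_functions.
Context {R : realType}.
Implicit Types (p : {poly R}) (s : R).

(** The functions p(1/s) exp(-1/s), extended by 0 to s <= 0. The family indexed by
all polynomials is closed under differentiation, unlike exp(-1/s) alone. *)
Definition flat p s : R := if 0 < s then p.[s^-1] * expR (- s^-1) else 0.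

(** Termwise, since u^i / i! is a term of the exponential series. *)
Lemma poly_le_expR p : exists C : R, forall u, 0 <= u -> `|p.[u]| <= C * expR u.
Proof.
exists (\sum_(i < size p) `|p`_i| * i`!%:R) => u u0.
rewrite horner_coef mulr_suml (le_trans (ler_norm_sum _ _ _))//.
apply: ler_sum => i _; rewrite normrM -mulrA ler_wpM2l//.
rewrite ger0_norm ?exprn_ge0// mulrC -ler_pdivrMr ?ltr0n ?fact_gt0//.
case: (i : nat) => [|j].
  by rewrite expr0 fact0 divr1 -expR0 ler_expR.
by apply: le_trans (expR_ge1Dxn j u0); rewrite lerDr.
Qed.

(** The bound of [poly_le_expR], applied to X^2 p, leaves a factor s^2. Having it for
every p gives continuity at 0 for every p, and differentiability at 0 then
follows because flat p s = s * flat (X p) s. *)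
Lemma flat_quadratic p : exists C : R, forall s, `|flat p s| <= C * s ^+ 2.
Proof.
have [C HC] := poly_le_expR ('X^2 * p).
have C0 : 0 <= C by have := HC 0 (lexx _); rewrite expR0 mulr1; apply: le_trans.
exists C => s; rewrite /flat; case: ifPn => s0; last first.
  by rewrite normr0 mulr_ge0// sqr_ge0.
have u0 : 0 < s^-1 by rewrite invr_gt0.
have := HC _ (ltW u0); rewrite hornerM hornerXn normrM.
rewrite (ger0_norm (exprn_ge0 _ (ltW u0))) => H.
rewrite normrM (ger0_norm (expR_ge0 _)) expRN ler_pdivrMr ?expR_gt0//.
rewrite -(ler_pM2l (exprn_gt0 2 u0)) (le_trans H)//.
rewrite (_ : s^-1 ^+ 2 * _ = (s^-1 * s) ^+ 2 * (C * expR s^-1)); last by ring.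
by rewrite mulVf ?gt_eqF// expr1n mul1r.
Qed.

Lemma flat_continuous0 p : {for 0, continuous (flat p)}.
Proof.
have [C HC] := flat_quadratic p.
have f0 : flat p 0 = 0 by rewrite /flat ltxx.
rewrite /prop_for /continuous_at f0.
have bnd0 : (fun s : R => C * s ^+ 2) @ 0 --> (0 : R).
  have : (fun s : R => C * s ^+ 2) @ 0 --> C * (0 : R) ^+ 2.
    by apply: cvgM; [exact: cvg_cst|exact: exprn_continuous].
  by rewrite expr0n mulr0.
apply: norm_cvg0; apply: (squeeze_cvgr _ (cvg_cst 0) bnd0).
by apply: nearW => s; rewrite normr_ge0 HC.
Qed.

(** Away from 0 this is d/ds (p(1/s) exp(-1/s)) = s^-2 (p - p')(1/s) exp(-1/s). *)
Lemma is_derive_flat p s :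
  is_derive s 1 (flat p) (flat ('X^2 * (p - p^`())) s).
Proof.
have [s0|s0|<-] := ltgtP 0 s.
- have nE : \near s, p.[s^-1] * expR (- s^-1) = flat p s.
    by near=> t; rewrite /flat ifT//; near: t; exact: lt_nbhsr.
  apply: (near_eq_is_derive (f := (fun y => p.[y^-1]) * (fun y => expR (- y^-1))) nE).
  have dV : is_derive s 1 (fun y : R => y^-1) (- s ^- 2 *: 1).
    by apply: is_deriveV; rewrite ?gt_eqF.
  have dVN : is_derive s 1 (fun y : R => - y^-1) (- (- s ^- 2 *: 1)).
    exact: is_deriveN.
  have d1 : is_derive s 1 (fun y : R => p.[y^-1]) (p^`().[s^-1] * (- s ^- 2 *: 1)).
    exact: (@is_derive1_comp R (horner p) (fun y => y^-1)).
  have d2 : is_derive s 1 (fun y : R => expR (- y^-1))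
      (expR (- s^-1) * (- (- s ^- 2 *: 1))).
    exact: (@is_derive1_comp R expR (fun y => - y^-1)).
  have d3 : is_derive s 1 ((fun y => p.[y^-1]) * (fun y => expR (- y^-1)))
      (p.[s^-1] *: (expR (- s^-1) * (- (- s ^- 2 *: 1))) +
       expR (- s^-1) *: (p^`().[s^-1] * (- s ^- 2 *: 1))).
    exact: (is_deriveM d1 d2).
  apply: (is_derive_eq d3).
  rewrite /flat s0 hornerM hornerD hornerN hornerXn /GRing.scale /= exprVn.
  by ring.
- have nE : \near s, cst 0 s = flat p s.
    near=> t; rewrite /flat ifF//; apply/negbTE; rewrite -leNgt ltW//.
    by near: t; exact: lt_nbhsl.
  apply: near_eq_is_derive nE _.
  by rewrite /flat ltNge (ltW s0) /=; exact: is_derive_cst.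
- apply/is_derive1_caratheodory; exists (flat ('X * p)); split.
  + move=> z; rewrite /flat ltxx !subr0; case: ifPn => z0; last by rewrite mul0r.
    by rewrite hornerM hornerX [RHS]mulrC -!mulrA mulVKf ?gt_eqF.
  + exact: flat_continuous0.
  + by rewrite /flat ltxx.
Unshelve. all: by end_near. Qed.

Lemma smooth_flat p : smooth (flat p).
Proof.
move=> k; elim: k p => [|k IH] p.
  move=> s; apply/differentiable_continuous/derivable1_diffP.
  by have [] := is_derive_flat p s.
split=> [s|v].
  by apply/derivable1_diffP; have [] := is_derive_flat p s.
rewrite (_ : 'D_v _ = cst v * flat ('X^2 * (p - p^`()))).
  by apply: is_CkM; [exact: is_Ck_cst|exact: IH].
apply/funext => s; have [d dE] := is_derive_flat p s.
have dd : differentiable (flat p) s by apply/derivable1_diffP.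
by rewrite deriveE// -[X in 'd _ _ X = _]mulr1 [LHS]linearZ -deriveE// dE.
Qed.

End flat_functions.

(** * A smooth step function *)

Section smooth_step.
Context {R : realType}.
Implicit Types (s : R).

Lemma flat_ge0 (p : {poly R}) s : (forall u, 0 <= u -> 0 <= p.[u]) -> 0 <= flat p s.
Proof.
move=> p0; rewrite /flat; case: ifPn => // s0.
by rewrite mulr_ge0 ?expR_ge0// p0// invr_ge0 ltW.
Qed.

Lemma flat_le0 (p : {poly R}) s : s <= 0 -> flat p s = 0.
Proof. by rewrite /flat leNgt => /negbTE ->. Qed.

(** Equal to 0 for s <= 0 and to 1 for s >= 1, smooth because the denominator never
vanishes, and nondecreasing: the sign of its derivative is what makes the
transport inequality work. *)
Definition step s : R := flat 1 s / (flat 1 s + flat 1 (1 - s)).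

(** The quotient rule, [flat 'X^2] being the derivative of [flat 1]. *)
Definition dstep s : R :=
  (flat 'X^2 s * flat 1 (1 - s) + flat 1 s * flat 'X^2 (1 - s)) /
  (flat 1 s + flat 1 (1 - s)) ^+ 2.

Let e s : R := flat 1 s.
Let e' s : R := flat 'X^2 s.
Let g s := e s + e (1 - s).

Let e_ge0 s : 0 <= e s.
Proof. by apply: flat_ge0 => u _; rewrite hornerC. Qed.

Let e'_ge0 s : 0 <= e' s.
Proof. by apply: flat_ge0 => u u0; rewrite hornerXn exprn_ge0. Qed.

Let e_gt0 s : 0 < s -> 0 < e s.
Proof. by move=> s0; rewrite /e /flat s0 hornerC mul1r expR_gt0. Qed.

Let g_gt0 s : 0 < g s.
Proof.
have [s0|s0] := ltP 0 s; first by rewrite ltr_pwDl ?e_gt0.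
by rewrite ltr_wpDl ?e_gt0// subr_gt0 (le_lt_trans s0).
Qed.

Lemma step_ge0 s : 0 <= step s.
Proof. by apply: (divr_ge0 (e_ge0 s)); rewrite ltW ?g_gt0. Qed.

Lemma step_le1 s : step s <= 1.
Proof. by rewrite ler_pdivrMr ?g_gt0// mul1r lerDl e_ge0. Qed.

Lemma step_le0E s : s <= 0 -> step s = 0.
Proof. by move=> s0; rewrite /step /e flat_le0// mul0r. Qed.

Lemma step_ge1E s : 1 <= s -> step s = 1.
Proof.
move=> s1; have s0 : 0 < s by rewrite (lt_le_trans _ s1).
by rewrite /step (@flat_le0 _ (1 - s)) ?subr_le0// addr0 divff// gt_eqF//; exact: e_gt0.
Qed.

Lemma dstep_ge0 s : 0 <= dstep s.
Proof. by rewrite divr_ge0 ?sqr_ge0// addr_ge0// mulr_ge0 ?e_ge0 ?e'_ge0. Qed.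

Lemma dstep_le0E s : s <= 0 -> dstep s = 0.
Proof.
by move=> s0; rewrite /dstep !(@flat_le0 _ s)// !mul0r addr0 mul0r.
Qed.

Lemma dstep_ge1E s : 1 <= s -> dstep s = 0.
Proof.
by move=> s1; rewrite /dstep !(@flat_le0 _ (1 - s)) ?subr_le0// !mulr0 addr0 mul0r.
Qed.

Let affine_onem : affine_fun (fun s : R => 1 - s) (fun s => - s).
Proof.
split=> [z|v z].
  by apply: differentiableB; [exact: differentiable_cst|exact/derivable1_diffP/derivable_id].
by rewrite deriveB//= derive_cst derive_id sub0r.
Qed.

Lemma smooth_step : smooth step.
Proof.
have se k : is_Ck k e := @smooth_flat R 1 k.
have sem k : is_Ck k (fun s => e (1 - s)).
  exact: (smooth_comp_affine se affine_onem).
move=> k; apply: (is_CkM (f := e) (g := fun z => (g z)^-1)); first exact: se.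
apply: is_CkV => [z|]; first by rewrite gt_eqF.
exact: (is_CkD (f := e) (g := fun s => e (1 - s))).
Qed.

Lemma is_derive_step s : is_derive s 1 step (dstep s).
Proof.
have de (t : R) : is_derive t 1 e (e' t).
  apply: is_derive_eq; first exact: is_derive_flat.
  by rewrite /e' -polyC1 derivC subr0 mulr1.
have dm : is_derive s 1 (fun t => e (1 - t)) (e' (1 - s) * (- 1)).
  have d1 : is_derive s 1 (fun t : R => 1 - t) (- 1).
    have d2 : is_derive s 1 ((cst 1 : R -> R) - id) (0 - 1) by exact: is_deriveB.
    by rewrite -(sub0r 1); exact: d2.
  exact: (@is_derive1_comp R e (fun t => 1 - t)).
have dg : is_derive s 1 g (e' s + e' (1 - s) * -1).
  exact: (is_deriveD (f := e) (g := fun t => e (1 - t))).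
have dV : is_derive s 1 (fun t => (g t)^-1)
    (- (g s) ^- 2 *: (e' s + e' (1 - s) * -1)).
  by apply: is_deriveV; rewrite ?gt_eqF.
have d3 : is_derive s 1 (e * (fun t => (g t)^-1))
    (e s *: (- (g s) ^- 2 *: (e' s + e' (1 - s) * -1)) + (g s)^-1 *: e' s).
  exact: (is_deriveM (de s) dV).
apply: (is_derive_eq d3).
have g0 : e s + e (1 - s) != 0 by rewrite gt_eqF// g_gt0.
rewrite /dstep -/(e s) -/(e (1 - s)) -/(e' s) -/(e' (1 - s)) /GRing.scale /= /g.
by field.
Qed.

Lemma continuous_dstep : continuous dstep.
Proof.
move=> s; rewrite (_ : dstep = 'D_1 step); last first.
  by apply/funext => t; have [_ ->] := is_derive_step t.
have [_ /(_ 1) c] := smooth_step 1; exact: c.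
Qed.

Lemma dstep_bounded : exists2 K : R, 0 <= K & forall s, dstep s <= K.
Proof.
have [|c _ Hc] := @EVT_max R dstep 0 1 ler01.
  exact/continuous_subspaceT/continuous_dstep.
exists (dstep c) => [|s]; first exact: dstep_ge0.
have [s0|s0] := leP s 0; first by rewrite dstep_le0E ?dstep_ge0.
have [s1|s1] := leP 1 s; first by rewrite dstep_ge1E ?dstep_ge0.
by apply: Hc; rewrite in_itv /= !ltW.
Qed.

Lemma derive_step_comp {V : normedModType R} (l : V -> R) z v :
  differentiable l z -> 'D_v (step \o l) z = 'D_v l z * dstep (l z).
Proof.
move=> dl; have [d1 d2] := is_derive_step (l z).
by rewrite derive_comp_scalar// ?d2//; exact/derivable1_diffP.
Qed.

End smooth_step.

(** * Test functions for velocity tails *)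

Section test_function.
Context {R : realType} {n : nat}.
Local Notation Rn := 'rV[R]_n.
Local Notation V := (R * (Rn * Rn))%type.

Lemma affine_time : affine_fun (fun z : V => z.1) (fun z => z.1).
Proof. by apply: affine_linear => // z; exact: cvg_fst. Qed.

Lemma affine_position j :
  affine_fun (fun z : V => z.2.1 ord0 j) (fun z => z.2.1 ord0 j).
Proof.
apply: affine_linear => [z|a u w]; last by rewrite !mxE.
apply: (@continuous_comp _ _ _ (fun z : V => z.2.1) (fun x : Rn => x ord0 j)).
  apply: (@continuous_comp _ _ _ (fun z : V => z.2) fst); [exact: cvg_snd|exact: cvg_fst].
exact: coord_continuous.
Qed.

Lemma affine_velocity j :
  affine_fun (fun z : V => z.2.2 ord0 j) (fun z => z.2.2 ord0 j).
Proof.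
apply: affine_linear => [z|a u w]; last by rewrite !mxE.
apply: (@continuous_comp _ _ _ (fun z : V => z.2.2) (fun x : Rn => x ord0 j)).
  apply: (@continuous_comp _ _ _ (fun z : V => z.2) snd); exact: cvg_snd.
exact: coord_continuous.
Qed.

(** The operator is one directional derivative, along the phase space velocity
(1, v, E(x)), so it obeys the usual product and chain rules. *)
Lemma vlasov_operatorE (E : Rn -> Rn) (psi : V -> R) t z :
  differentiable psi (t, z) ->
  vlasov_operator E psi t z = 'D_(1, (z.2, E z.1)) psi (t, z).
Proof.
move=> dpsi; rewrite deriveE//.
have -> : ((1, (z.2, E z.1)) : V) = (1, (0, 0)) +
    \sum_(j < n) z.2 ord0 j *: ((0, (delta_mx ord0 j, 0)) : V) +
    \sum_(j < n) E z.1 ord0 j *: ((0, (0, delta_mx ord0 j)) : V).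
  have E1 (u : Rn) : \sum_(j < n) u ord0 j *: ((0, (delta_mx ord0 j, 0)) : V) =
      (0, (u, 0)) :> V.
    have {2}-> := row_sum_delta u.
    apply: (big_ind2 (fun (x : V) (y : Rn) => x = (0, (y, 0)))) => // [x y x' y' -> ->|j _].
      by congr (_, (_, _)); rewrite /= addr0.
    by congr (_, (_, _)); rewrite ?scaler0.
  have E2 (u : Rn) : \sum_(j < n) u ord0 j *: ((0, (0, delta_mx ord0 j)) : V) =
      (0, (0, u)) :> V.
    have {2}-> := row_sum_delta u.
    apply: (big_ind2 (fun (x : V) (y : Rn) => x = (0, (0, y)))) => // [x y x' y' -> ->|j _].
      by congr (_, (_, _)); rewrite /= addr0.
    by congr (_, (_, _)); rewrite ?scaler0.
  by rewrite E1 E2; congr (_, (_, _)); rewrite /= ?addr0 ?add0r.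
rewrite !linearD !linear_sum /=; congr (_ + _ + _).
- by rewrite /dt deriveE.
- by apply: eq_bigr => j _; rewrite linearZ /dx deriveE.
- by apply: eq_bigr => j _; rewrite linearZ /dv deriveE.
Qed.

Variables (i : 'I_n) (sg M lam b eps dl : R).

(** A pair of coordinates is cut at scale 1 / dl: the value is 1 where |dl x| and
|dl v| are at most 1, and 0 where one of them exceeds 2. *)
Definition cutoff (x v : R) : R :=
  step (2 - dl * x) * step (2 + dl * x) * (step (2 - dl * v) * step (2 + dl * v)).

(** The derivative of [cutoff] at (x, v) in the direction (v, a). *)
Definition dcutoff (x v a : R) : R :=
  dl * (v * (step (2 - dl * x) * dstep (2 + dl * x) -
             dstep (2 - dl * x) * step (2 + dl * x)) *
        (step (2 - dl * v) * step (2 + dl * v)) +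
        a * (step (2 - dl * v) * dstep (2 + dl * v) -
             dstep (2 - dl * v) * step (2 + dl * v)) *
        (step (2 - dl * x) * step (2 + dl * x))).

(** Minus the time derivative of step ((b - t) / eps): an approximation of the Dirac
mass at b, carried by [b - eps, b]. *)
Definition window (t : R) : R := dstep ((b - t) / eps) / eps.

(** The main factor is step (sg * v_i - M t - lam): along a trajectory in a field
bounded by M, its argument does not increase when |sg| = 1. The other factors bring the
support to a compact set, the first one for negative times, where it has no
effect on [0, T] since step (t + 2) = 1 for t >= -1. *)
Definition test_fun (z : V) : R :=
  step (z.1 + 2) * step ((b - z.1) / eps) * step (sg * z.2.2 ord0 i - M * z.1 - lam) *
  \prod_(j < n) cutoff (z.2.1 ord0 j) (z.2.2 ord0 j).

Let aff1 : affine_fun (fun z : V => z.1 + 2) (fun z => z.1 + 0).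
Proof. exact: (affineD affine_time (affine_cst 2)). Qed.

Let aff2 : affine_fun (fun z : V => (b - z.1) / eps) (fun z => - z.1 / eps).
Proof.
have := affineM eps^-1 (affineD (affine_cst b) (affineM (-1) affine_time)).
congr affine_fun; apply/funext => z /=; ring.
Qed.

Let aff3 : affine_fun (fun z : V => sg * z.2.2 ord0 i - M * z.1 - lam)
  (fun z => sg * z.2.2 ord0 i - M * z.1).
Proof.
have := affineD (affineD (affineM sg (affine_velocity i)) (affineM (-M) affine_time))
  (affine_cst (-lam)).
congr affine_fun; apply/funext => z /=; ring.
Qed.

Let affx s j : affine_fun (fun z : V => 2 + s * z.2.1 ord0 j)
  (fun z => s * z.2.1 ord0 j).
Proof.
have := affineD (affine_cst 2) (affineM s (affine_position j)).
congr affine_fun; apply/funext => z /=; ring.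
Qed.

Let affv s j : affine_fun (fun z : V => 2 + s * z.2.2 ord0 j)
  (fun z => s * z.2.2 ord0 j).
Proof.
have := affineD (affine_cst 2) (affineM s (affine_velocity j)).
congr affine_fun; apply/funext => z /=; ring.
Qed.

Let F j (z : V) := cutoff (z.2.1 ord0 j) (z.2.2 ord0 j).

Let FE j : F j = (step \o (fun z : V => 2 + (- dl) * z.2.1 ord0 j)) *
   (step \o (fun z : V => 2 + dl * z.2.1 ord0 j)) *
   ((step \o (fun z : V => 2 + (- dl) * z.2.2 ord0 j)) *
   (step \o (fun z : V => 2 + dl * z.2.2 ord0 j))).
Proof. by apply/funext => z; rewrite /F /cutoff !fctE /= !mulNr. Qed.

Let smooth_F j : smooth (F j).
Proof.
have sx s := smooth_comp_affine smooth_step (affx s j).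
have sv s := smooth_comp_affine smooth_step (affv s j).
rewrite FE; exact: (smoothM (smoothM (sx _) (sx _)) (smoothM (sv _) (sv _))).
Qed.

Let Q : V -> R := (step \o (fun z : V => z.1 + 2)) *
  (step \o (fun z : V => (b - z.1) / eps)) *
  (step \o (fun z : V => sg * z.2.2 ord0 i - M * z.1 - lam)).

Let smooth_Q : smooth Q.
Proof.
have s1 := smooth_comp_affine smooth_step aff1.
have s2 := smooth_comp_affine smooth_step aff2.
have s3 := smooth_comp_affine smooth_step aff3.
exact: (smoothM (smoothM s1 s2) s3).
Qed.

Let test_funE : test_fun = Q * (fun z => \prod_(j < n) F j z).
Proof. by []. Qed.

Lemma smooth_test_fun : smooth test_fun.
Proof. by rewrite test_funE; apply: smoothM => //; exact: smooth_prod. Qed.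

Let derivable_step_affine (l : V -> R) l' z w : affine_fun l l' -> derivable (step \o l) z w.
Proof.
move=> al; have [d _] := smooth_comp_affine smooth_step al 1.
exact: diff_derivable.
Qed.

Let derive_step_affine (l : V -> R) l' z w : affine_fun l l' ->
  'D_w (step \o l) z = l' w * dstep (l z).
Proof. by move=> [dl1 dl2]; rewrite derive_step_comp// dl2. Qed.

Let derive_F j t x v a : 'D_(1, (v, a)) (F j) (t, (x, v)) =
  dcutoff (x ord0 j) (v ord0 j) (a ord0 j).
Proof.
have ax s := affx s j; have av s := affv s j.
set z : V := (t, (x, v)); set w : V := (1, (v, a)).
have dx s := @derivable_step_affine _ _ z w (ax s).
have dv s := @derivable_step_affine _ _ z w (av s).
rewrite FE (deriveM (derivableM (dx (- dl)) (dx dl)) (derivableM (dv (- dl)) (dv dl))).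
rewrite (deriveM (dx (- dl)) (dx dl)) (deriveM (dv (- dl)) (dv dl)).
rewrite !(@derive_step_affine _ _ _ _ (ax _)) !(@derive_step_affine _ _ _ _ (av _)).
by rewrite /dcutoff /GRing.scale /= !fctE /= !mulNr; ring.
Qed.

Let derive_Q t x v a : 0 <= t -> 'D_(1, (v, a)) Q (t, (x, v)) =
  step ((b - t) / eps) * ((sg * a ord0 i - M) *
     dstep (sg * v ord0 i - M * t - lam)) -
  window t * step (sg * v ord0 i - M * t - lam).
Proof.
move=> t0.
set z : V := (t, (x, v)); set w : V := (1, (v, a)).
have d1 := @derivable_step_affine _ _ z w aff1; have d2 := @derivable_step_affine _ _ z w aff2.
have d3 := @derivable_step_affine _ _ z w aff3.
rewrite /Q (deriveM (derivableM d1 d2) d3) (deriveM d1 d2).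
rewrite (@derive_step_affine _ _ _ _ aff1) (@derive_step_affine _ _ _ _ aff2).
rewrite (@derive_step_affine _ _ _ _ aff3) !fctE /=.
(* The factor in t + 2 is locally constant at nonnegative times. *)
have t2 : 1 <= t + 2 by lra.
rewrite (dstep_ge1E t2) (step_ge1E t2) /window /GRing.scale /=.
by ring.
Qed.

Lemma vlasov_test_fun (E : Rn -> Rn) t z : 0 <= t ->
  vlasov_operator E test_fun t z =
  (step ((b - t) / eps) * ((sg * E z.1 ord0 i - M) *
     dstep (sg * z.2 ord0 i - M * t - lam)) -
   window t * step (sg * z.2 ord0 i - M * t - lam)) *
  (\prod_(j < n) cutoff (z.1 ord0 j) (z.2 ord0 j)) +
  step ((b - t) / eps) * step (sg * z.2 ord0 i - M * t - lam) *
  \sum_(j < n) dcutoff (z.1 ord0 j) (z.2 ord0 j) (E z.1 ord0 j) *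
    \prod_(k < n | k != j) cutoff (z.1 ord0 k) (z.2 ord0 k).
Proof.
move=> t0; case: z => x v /=.
have dF j w : differentiable (F j) w by have [] := @smooth_F j 1.
rewrite vlasov_operatorE; last by have [] := smooth_test_fun 1.
rewrite test_funE deriveM; last 2 first.
- by apply: diff_derivable; have [] := smooth_Q 1.
- exact/diff_derivable/differentiable_prod.
rewrite derive_Q// derive_prod ?index_enum_uniq// [RHS]addrC.
congr (_ + _); last by rewrite /GRing.scale /= mulrC.
rewrite /GRing.scale /= /Q !fctE /= step_ge1E ?mul1r; last by lra.
by congr (_ * _); apply: eq_bigr => j _; rewrite derive_F.
Qed.

End test_function.

Lemma itv01M {R : numDomainType} (x y : R) :
  0 <= x <= 1 -> 0 <= y <= 1 -> 0 <= x * y <= 1.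
Proof.
by move=> /andP[x0 x1] /andP[y0 y1]; rewrite mulr_ge0//= mulr_ile1.
Qed.

Lemma step01 {R : realType} (s : R) : 0 <= step s <= 1.
Proof. by rewrite step_ge0 step_le1. Qed.

Section test_function_bounds.
Context {R : realType} {n : nat}.
Local Notation Rn := 'rV[R]_n.
Local Notation V := (R * (Rn * Rn))%type.
Variables (i : 'I_n) (sg M lam b eps : R).
Hypotheses (eps0 : 0 < eps) (M0 : 0 <= M) (sg1 : `|sg| = 1).
Variable K : R.
Hypotheses (K0 : 0 <= K) (dK : forall s, dstep s <= K).

(** The indicator of the region where the cutoffs may act. *)
Definition far (dl : R) (z : Rn * Rn) : R :=
  if [forall j, (`|dl * z.1 ord0 j| <= 1) && (`|dl * z.2 ord0 j| <= 1)] then 0 else 1.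

Lemma far_ge0 dl z : 0 <= far dl z.
Proof. by rewrite /far; case: ifP. Qed.

Lemma window_ge0 t : 0 <= window b eps t.
Proof. by rewrite divr_ge0 ?dstep_ge0// ltW. Qed.

Lemma window_le t : window b eps t <= K / eps.
Proof. by rewrite ler_pM2r ?invr_gt0. Qed.

Section fixed_dl.
Variable dl : R.
Hypotheses (dl0 : 0 < dl) (dl1 : dl <= 1).

Local Notation cut := (cutoff dl).
Local Notation dcut := (dcutoff dl).

Lemma cutoff01 x v : 0 <= cut x v <= 1.
Proof. by apply: itv01M; apply: itv01M; exact: step01. Qed.

Lemma cutoff_eq0 x v :
  (2 < `|dl * x|) || (2 < `|dl * v|) -> cut x v = 0.
Proof.
have H y : 2 < `|dl * y| -> step (2 - dl * y) * step (2 + dl * y) = 0.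
  rewrite ltr_normr => /orP[h|h].
    by rewrite (@step_le0E _ (2 - dl * y)) ?mul0r//; lra.
  by rewrite (@step_le0E _ (2 + dl * y)) ?mulr0//; lra.
by rewrite /cutoff => /orP[/H ->|/H ->]; rewrite ?mul0r ?mulr0.
Qed.

Lemma cutoff_eq1 x v :
  (`|dl * x| <= 1) && (`|dl * v| <= 1) -> cut x v = 1.
Proof.
rewrite !ler_norml => /andP[/andP[x1 x2] /andP[v1 v2]].
by rewrite /cutoff !step_ge1E ?mulr1//; lra.
Qed.

Lemma dcutoff_eq0 x v a :
  (`|dl * x| <= 1) && (`|dl * v| <= 1) -> dcut x v a = 0.
Proof.
rewrite !ler_norml => /andP[/andP[x1 x2] /andP[v1 v2]].
by rewrite /dcutoff !dstep_ge1E; [ring|lra..].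
Qed.

(** The bound is uniform in dl: the velocity v in front of the derivative in x comes
with dl, and |dl v| <= 2 on the support of the cutoff in v. *)
Lemma dcutoff_le x v a : `|a| <= M -> `|dcut x v a| <= (2 + M) * K.
Proof.
move=> aM.
have D y : `|step (2 - dl * y) * dstep (2 + dl * y) -
             dstep (2 - dl * y) * step (2 + dl * y)| <= K.
  have h1 : 0 <= step (2 - dl * y) * dstep (2 + dl * y) <= K.
    by rewrite mulr_ge0 ?step_ge0 ?dstep_ge0//= -[leRHS]mul1r ler_pM
      ?step_ge0 ?dstep_ge0 ?step_le1.
  have h2 : 0 <= dstep (2 - dl * y) * step (2 + dl * y) <= K.
    by rewrite mulr_ge0 ?step_ge0 ?dstep_ge0//= -[leRHS]mulr1 ler_pM
      ?step_ge0 ?dstep_ge0 ?step_le1.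
  by rewrite ler_norml; lra.
have S y : 0 <= step (2 - dl * y) * step (2 + dl * y) <= 1.
  by rewrite mulr_ge0 ?step_ge0//= mulr_ile1 ?step_ge0 ?step_le1.
have Sv : `|dl * v| * (step (2 - dl * v) * step (2 + dl * v)) <= 2.
  have [h|h] := leP `|dl * v| 2.
    rewrite -[leRHS]mulr1 ler_pM//; first by have /andP[] := S v.
    by have /andP[] := S v.
  move: h; rewrite ltr_normr => /orP[h|h].
    by rewrite (@step_le0E _ (2 - dl * v)) ?mul0r ?mulr0//; lra.
  by rewrite (@step_le0E _ (2 + dl * v)) ?mulr0//; lra.
move: (D x) (D v) (S x) (S v) Sv.
set Ax := (X in `|X| <= K); set Bx := step (2 - dl * x) * _.
set Av := (X in _ -> `|X| <= K -> _); set Bv := step (2 - dl * v) * _.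
move=> DX DV /andP[Bx0 Bx1] /andP[Bv0 Bv1] Sv.
rewrite (_ : dcut x v a = dl * (v * Ax * Bv + a * Av * Bx))//.
clearbody Ax Av Bx Bv.
rewrite (_ : dl * _ = dl * v * Bv * Ax + dl * a * Bx * Av); last by ring.
rewrite [leRHS]mulrDl (le_trans (ler_normD _ _))// lerD//.
  by rewrite normrM ler_pM// normrM [X in _ * X]ger0_norm.
rewrite normrM ler_pM// !normrM -[leRHS]mulr1 ler_pM ?mulr_ge0//.
  by rewrite -[leRHS]mul1r ler_pM// ger0_norm// ltW.
by rewrite ger0_norm.
Qed.

Let cut_prod P (z : Rn * Rn) :
  0 <= \prod_(k < n | P k) cut (z.1 ord0 k) (z.2 ord0 k) <= 1.
Proof.
apply: (big_ind (fun x => 0 <= x <= 1)) => [|x y|k _].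
- by rewrite ler01 lexx.
- exact: itv01M.
- exact: cutoff01.
Qed.

Let cut_prod_ge0 P (z : Rn * Rn) :
  0 <= \prod_(k < n | P k) cut (z.1 ord0 k) (z.2 ord0 k).
Proof. by have /andP[] := cut_prod P z. Qed.

Let cut_prod_le1 P (z : Rn * Rn) :
  \prod_(k < n | P k) cut (z.1 ord0 k) (z.2 ord0 k) <= 1.
Proof. by have /andP[] := cut_prod P z. Qed.

Let sum_dcut_le (E : Rn) (z : Rn * Rn) : (forall j, `|E ord0 j| <= M) ->
  `|\sum_(j < n) dcut (z.1 ord0 j) (z.2 ord0 j) (E ord0 j) *
    \prod_(k < n | k != j) cut (z.1 ord0 k) (z.2 ord0 k)|
  <= n%:R * ((2 + M) * K) * far dl z.
Proof.
move=> EM; rewrite /far; case: ifPn => [/forallP h|_].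
  by rewrite big1 ?normr0 ?mulr0// => j _; rewrite dcutoff_eq0// mul0r.
rewrite mulr1 (le_trans (ler_norm_sum _ _ _))//.
rewrite mulr_natl -[X in _ *+ X](card_ord n) -sumr_const ler_sum// => j _.
rewrite normrM -[leRHS]mulr1 ler_pM//; first exact: dcutoff_le.
by rewrite ger0_norm ?cut_prod_ge0.
Qed.

(** The field contributes (sg * E_i - M) * dstep, which is nonpositive as
|E_i| <= M. What remains is the derivative of the time cutoff and errors located
where the space and velocity cutoffs act. *)
Lemma vlasov_test_fun_le (E : Rn -> Rn) t z : 0 <= t ->
  (forall x j, `|E x ord0 j| <= M) ->
  vlasov_operator E (test_fun i sg M lam b eps dl) t z <=
  - (window b eps t * step (sg * z.2 ord0 i - M * t - lam)) +
  (K / eps + n%:R * ((2 + M) * K)) * far dl z.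
Proof.
move=> t0 EM; rewrite vlasov_test_fun//.
set P2 := step ((b - t) / eps); set P3 := step (sg * _ - _ - _).
set X := \prod_(j < n) _; set S := \sum_(j < n) _.
set D := (sg * _ - M) * _.
have P2b : 0 <= P2 <= 1 by rewrite step_ge0 step_le1.
have P3b : 0 <= P3 <= 1 by rewrite step_ge0 step_le1.
have Xb : 0 <= X <= 1 by rewrite cut_prod_ge0 cut_prod_le1.
have Sb : P2 * P3 * S <= n%:R * ((2 + M) * K) * far dl z.
  have /andP[P0 P1] := itv01M P2b P3b.
  apply: le_trans (ler_norm _) (le_trans _ (sum_dcut_le z (EM z.1))).
  by rewrite normrM ger0_norm// -[leRHS]mul1r ler_pM.
have Db : D <= 0.
  rewrite mulr_le0_ge0 ?dstep_ge0// subr_le0 (le_trans (ler_norm _))//.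
  by rewrite normrM sg1 mul1r.
have PDX : P2 * D * X <= 0.
  move: P2b Xb => /andP[P20 _] /andP[X0 _].
  by rewrite mulr_le0_ge0// mulr_ge0_le0.
have X1 : 0 <= 1 - X by lra.
have W0 := window_ge0 t; have Wle := window_le t.
have WX : window b eps t * P3 * (1 - X) <= K / eps * far dl z.
  move: P3b => /andP[P30 P31]; apply: ler_pM => //; first exact: mulr_ge0.
    by rewrite -[leRHS]mulr1; apply: ler_pM.
  rewrite /far; case: ifPn => [/forallP h|_]; last by lra.
  by rewrite /X big1 ?subrr// => j _; rewrite cutoff_eq1.
rewrite [in leRHS]mulrDl; move: Sb WX PDX; move: (window b eps t) (K / eps * _) (n%:R * _ * _).
clearbody D P2 P3 X S => w k1 k2; lra.
Qed.

(** Uniformity in dl allows dominated convergence when the cutoffs are removed. *)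
Lemma vlasov_test_fun_norm (E : Rn -> Rn) t z : 0 <= t ->
  (forall x j, `|E x ord0 j| <= M) ->
  `|vlasov_operator E (test_fun i sg M lam b eps dl) t z| <=
  2 * M * K + K / eps + n%:R * ((2 + M) * K).
Proof.
move=> t0 EM; rewrite vlasov_test_fun//.
set P2 := step ((b - t) / eps); set P3 := step (sg * _ - _ - _).
set X := \prod_(j < n) _; set S := \sum_(j < n) _.
have P2b : 0 <= P2 <= 1 by rewrite step_ge0 step_le1.
have P3b : 0 <= P3 <= 1 by rewrite step_ge0 step_le1.
have Xb : 0 <= X <= 1 by rewrite cut_prod_ge0 cut_prod_le1.
rewrite (le_trans (ler_normD _ _))// lerD//; last first.
  have /andP[P0 P1] := itv01M P2b P3b.
  apply: (@le_trans _ _ `|S|); first by rewrite normrM ger0_norm// ler_piMl.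
  apply: le_trans (sum_dcut_le z (EM z.1)) _.
  rewrite -[leRHS]mulr1; apply: ler_wpM2l; last by rewrite /far; case: ifP.
  by rewrite mulr_ge0// mulr_ge0// addr_ge0.
move: P2b P3b Xb => /andP[P20 P21] /andP[P30 P31] /andP[X0 X1].
rewrite normrM (ger0_norm X0) -[leRHS]mulr1; apply: ler_pM => //.
rewrite (le_trans (ler_normB _ _))// lerD//.
  rewrite normrM (ger0_norm P20) normrM (ger0_norm (dstep_ge0 _)).
  rewrite -[leRHS]mul1r; apply: ler_pM => //; first by rewrite mulr_ge0 ?dstep_ge0.
  apply: ler_pM; rewrite ?dstep_ge0// (le_trans (ler_normB _ _))// normrM sg1 mul1r.
  by rewrite (ger0_norm M0); have := EM z.1 i; lra.
rewrite normrM (ger0_norm (window_ge0 _)) (ger0_norm P30).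
by rewrite -[leRHS]mulr1; apply: ler_pM => //; [exact: window_ge0|exact: window_le].
Qed.

Lemma test_fun_ge0 z : 0 <= test_fun i sg M lam b eps dl z.
Proof.
apply: mulr_ge0; last exact: (cut_prod_ge0 predT z.2).
by do 2 (apply: mulr_ge0; last exact: step_ge0); exact: step_ge0.
Qed.

Lemma test_fun0_le z :
  test_fun i sg M lam b eps dl (0, z) <= step (sg * z.2 ord0 i - lam).
Proof.
rewrite /test_fun /= mulr0 !subr0 -[leRHS]mulr1.
have /andP[P0 P1] := itv01M (step01 (0 + 2)) (step01 (b / eps)).
apply: ler_pM; [by apply: mulr_ge0 => //; exact: step_ge0|exact: (cut_prod_ge0 predT z)| |].
  by rewrite -[leRHS]mul1r; apply: ler_pM => //; exact: step_ge0.
exact: (cut_prod_le1 predT z).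
Qed.

Lemma test_function_test_fun T : b < T -> test_function T (test_fun i sg M lam b eps dl).
Proof.
move=> bT.
pose B : set Rn := [set x | forall j, `[- (2 / dl), 2 / dl]%classic (x ord0 j)].
have cB : compact B.
  apply: (@rV_compact R n (fun=> `[- (2 / dl), 2 / dl]%classic)) => j.
  exact: segment_compact.
have cV : compact (`[-2, b] `*` (B `*` B)).
  by apply: compact_setX; [exact: segment_compact|exact: compact_setX].
have sub : tsupport (test_fun i sg M lam b eps dl) `<=` `[-2, b] `*` (B `*` B).
  have clV : closed (`[-2, b] `*` (B `*` B)).
    exact: (compact_closed (@norm_hausdorff _ V)).
  rewrite /tsupport [X in _ `<=` X](proj1 (closure_id _) clV).
  apply: closure_subset => -[t [x v]] /=; rewrite /test_fun /=.
  rewrite 3!mulf_eq0 !negb_or -!andbA => /and4P[t1 t2 _].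
  rewrite prodf_seq_neq0 => /allP xv.
  have step_neq0 (s : R) : step s != 0 -> 0 < s.
    by rewrite ltNge; apply: contraNN => s0; rewrite step_le0E.
  have H s : `|dl * s| <= 2 -> `[- (2 / dl), 2 / dl]%classic s.
    rewrite /= in_itv /= -ler_norml normrM (gtr0_norm dl0).
    by rewrite ler_pdivlMr// mulrC.
  split => /=.
    have := step_neq0 _ t1; have := step_neq0 _ t2.
    by rewrite pmulr_lgt0 ?invr_gt0// in_itv /=; lra.
  split=> j; apply: H; rewrite leNgt; have := xv j (mem_index_enum j);
    by apply: contraNN => h; rewrite cutoff_eq0 ?h ?orbT// eqxx.
split; first exact: smooth_test_fun.
  by apply: (subclosed_compact _ cV sub); exact: closed_closure.
by move=> z /sub [/=]; rewrite in_itv /= => /andP[_ zb] _; exact: le_lt_trans bT.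
Qed.

End fixed_dl.
End test_function_bounds.

(** * Uniform bound on the electric field *)

Section lebesgue_rV.
Context {R : realType} {n : nat}.
Local Notation Rn := 'rV[R]_n.
Local Notation leb := (lebesgue_measure_rV R n).

Definition cube (a : Rn) (r : R) : set Rn :=
  [set x | forall i, `[a ord0 i - r, a ord0 i + r]%classic (x ord0 i)].

Lemma cubeP a r x : cube a r x <-> forall i, `|x ord0 i - a ord0 i| <= r.
Proof.
by split=> h i; have := h i; rewrite /= in_itv /= ler_distl.
Qed.

Lemma measurable_cube a r : measurable (cube a r).
Proof.
rewrite (_ : cube a r = \bigcap_(i in [set: 'I_n])
   ((fun x : Rn => x ord0 i) @^-1` `[a ord0 i - r, a ord0 i + r])).
  apply: fin_bigcap_measurable => [|i _]; first exact: finite_finset.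
  by rewrite -[X in measurable X]setTI; apply: measurable_coor => //; exact: measurable_itv.
by apply/seteqP; split => [x Bx i _|x Bx i]; [exact: Bx|exact: (Bx i)].
Qed.

Lemma volume_cube a r : 0 <= r -> leb (cube a r) = ((2 * r) ^+ n)%:E.
Proof.
move=> r0; rewrite /cube (@lebesgue_measure_rV_box R n
  (fun i => `[a ord0 i - r, a ord0 i + r]%classic)); last by move=> i; exact: measurable_itv.
under eq_bigr => i _.
  rewrite lebesgue_measure_itv /= (_ : (if _ then _ else _) = (2 * r)%:E); last first.
    case: ifPn; rewrite lte_fin => h; first by congr EFin; ring.
    by congr EFin; lra.
  over.
by rewrite prodEFin prodr_const card_ord.
Qed.

Lemma measurable_enorm : measurable_fun [set: Rn] enorm.
Proof.
rewrite /enorm; apply: measurableT_comp; last first.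
  apply: measurable_sum => i; apply: measurable_funX; exact: measurable_coor.
exact: (continuous_measurable_fun (@sqrt_continuous R)).
Qed.

Lemma enorm_ge0 (x : Rn) : 0 <= enorm x.
Proof. exact: sqrtr_ge0. Qed.

Lemma coord_le_enorm (x : Rn) i : `|x ord0 i| <= enorm x.
Proof.
rewrite -sqrtr_sqr ler_wsqrtr// (bigD1 i)//= lerDl sumr_ge0// => j _.
exact: sqr_ge0.
Qed.

End lebesgue_rV.

(** No sign is assumed on G: both sides split into positive and negative parts, even
at points where the integral is infinite or undefined. *)
Lemma measurable_integral_section {R : realType} d1 d2 (T1 : measurableType d1)
    (T2 : measurableType d2) (m2 : {sigma_finite_measure set T2 -> \bar R})
    (G : T1 * T2 -> \bar R) : measurable_fun setT G ->
  measurable_fun setT (fun x => \int[m2]_y G (x, y))%E.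
Proof.
move=> mG.
rewrite (_ : (fun _ => _) =
    (fun x => \int[m2]_y (G^\+ (x, y)) - \int[m2]_y (G^\- (x, y)))%E).
  apply: emeasurable_funB.
    apply: (measurable_fun_fubini_tonelli_F (m2 := m2) G^\+%E) => //.
    exact: measurable_funepos.
  apply: (measurable_fun_fubini_tonelli_F (m2 := m2) G^\-%E) => //.
  exact: measurable_funeneg.
apply/funext => x; rewrite integralE.
under eq_integral do rewrite funepos_comp/=.
by under [X in (_ - X)%E = _]eq_integral do rewrite funeneg_comp/=.
Qed.

Lemma measurable_density {R : realType} {n : nat}
    (g : 'rV[R]_n * 'rV[R]_n -> R) :
  measurable_fun setT g -> measurable_fun setT (density g).
Proof.
move=> mg; apply: (measurable_integral_section (lebesgue_measure_rV R n)
  (G := fun z => (g z)%:E)).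
exact/measurable_EFinP.
Qed.

Section density.
Context {R : realType} {n : nat}.
Local Notation Rn := 'rV[R]_n.
Local Notation leb := (lebesgue_measure_rV R n).
Variables (g : Rn * Rn -> R) (F : R).
Hypotheses (mg : measurable_fun setT g) (g0 : forall z, 0 <= g z).
Hypothesis gF : forall z, g z <= F.

Let mgy y : measurable_fun setT (fun v => g (y, v)).
Proof. by apply: (measurableT_comp mg). Qed.

Lemma density_ge0 y : (0 <= density g y)%E.
Proof. by apply: integral_ge0 => v _; rewrite lee_fin. Qed.

(** Velocities in a cube cost the bound on g times the volume of the cube; outside
of it the weight h is at least H. *)
Lemma density_split (h : Rn -> R) (r H : R) y :
  measurable_fun setT h -> (forall v, 0 <= h v) -> 0 <= r -> 0 < H ->
  (forall v : Rn, (exists i, r < `|v ord0 i|) -> H <= h v) ->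
  (density g y <= (F * (2 * r) ^+ n)%:E +
     H^-1%:E * \int[leb]_v (h v * g (y, v))%:E)%E.
Proof.
move=> mh h0 r0 H0 Hh.
have F0 : 0 <= F by exact: le_trans (g0 (y, 0)) (gF _).
have mhg : measurable_fun setT (fun v => (h v * g (y, v))%:E).
  apply/measurable_EFinP; exact: (measurable_funM mh (mgy y)).
have mi : measurable_fun setT (fun v : Rn => (\1_(cube 0 r) v)%:E : \bar R).
  by apply/measurable_EFinP; apply: measurable_indic; exact: measurable_cube.
have mc := measurable_cube (0 : Rn) r.
rewrite EFinM -(volume_cube 0 r0) -[X in leb X]setIT -(integral_indic _ measurableT mc).
have H1 : (0 <= H^-1)%R by rewrite invr_ge0 ltW.
rewrite -(ge0_integralZl_EFin leb measurableT _ mi F0); last first.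
  by move=> x _; rewrite lee_fin.
rewrite -(ge0_integralZl_EFin leb measurableT _ mhg H1); last first.
  by move=> x _; rewrite lee_fin mulr_ge0.
rewrite -ge0_integralD//; last 4 first.
- by move=> x _; rewrite mule_ge0// lee_fin.
- exact: measurable_funeM.
- by move=> x _; rewrite mule_ge0// lee_fin mulr_ge0.
- exact: measurable_funeM.
apply: ge0_le_integral => //.
- by move=> v _; rewrite lee_fin; exact: g0.
- by apply/measurable_EFinP; exact: mgy.
- by apply: emeasurable_funD; exact: measurable_funeM.
move=> v _; rewrite -!EFinM -EFinD lee_fin indicE.
have [vc|vc] := boolP (v \in _).
  rewrite mulr1 (le_trans (gF _))// lerDl mulr_ge0 ?invr_ge0 ?(ltW H0)//.
  by rewrite mulr_ge0.
rewrite mulr0 add0r mulrA -[leLHS]mul1r ler_wpM2r//.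
rewrite ler_pdivlMl// mulr1; apply: Hh; apply: contrapT => /forallNP nv.
move/negP: vc; apply; rewrite inE; apply/cubeP => i.
by rewrite mxE subr0 leNgt; apply/negP/nv.
Qed.

End density.

Section dyadic.
Context {R : realType}.

Lemma dyadic_scale (s : R) : 0 < s -> s <= 1 ->
  exists j : nat, (2 : R) ^- j.+1 < s /\ s <= 2 ^- j.
Proof.
move=> s0 s1.
have exP : exists j, (2 : R) ^- j.+1 < s.
  exists (Num.truncn s^-1); rewrite -[ltRHS]invrK ltf_pV2 ?posrE ?exprn_gt0 ?invr_gt0//.
  by rewrite (lt_trans (truncnS_gt _))// -natrX ltr_nat ltn_expl.
case: (ex_minnP exP) => -[|j] Pj minj; [exists 0%N|exists j.+1]; split => //.
  by rewrite expr0 invr1.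
by rewrite leNgt; apply/negP => /minj; rewrite ltnn.
Qed.

(** The threshold on m comes from here: b = 2^beta works for beta in the interval
](n-1)/m, 1/n[, which is nonempty exactly when n^2 - n < m. *)
Lemma dyadic_base (n : nat) (m : R) : (0 < n)%N -> n%:R ^+ 2 - n%:R < m ->
  exists b : R, [/\ 0 < b, b ^+ n < 2 & 2 ^+ n.-1 < b `^ m].
Proof.
move=> n0 nm; have n1 : 1 <= n%:R :> R by rewrite ler1n.
have m0 : 0 < m by apply: le_lt_trans nm; rewrite subr_ge0 expr2 ler_peMr.
have nn : (n.-1)%:R = n%:R - 1 :> R by rewrite -subn1 natrB.
have lt1 : (n.-1)%:R / m < n%:R^-1.
  rewrite nn ltr_pdivrMr// mulrC ltr_pdivlMr//; last by lra.
  by rewrite mulrBl mul1r -expr2.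
(* The midpoint of the interval of admissible exponents. *)
pose be := ((n.-1)%:R / m + n%:R^-1) / 2.
have be1 : be < n%:R^-1 by rewrite /be; lra.
have be2 : (n.-1)%:R / m < be by rewrite /be; lra.
have mono x y : x < y -> (2 : R) `^ x < 2 `^ y.
  move=> xy; rewrite /powR pnatr_eq0 /= ltr_expR ltr_pM2r// ln_gt0//.
  by rewrite ltr1n.
exists (2 `^ be); split; first exact: powR_gt0.
  rewrite -powR_mulrn ?powR_ge0// -powRrM -[ltRHS]powRr1//.
  by apply: mono; rewrite -ltr_pdivlMr ?div1r//; lra.
by rewrite -powRrM -powR_mulrn//; apply: mono; rewrite -ltr_pdivrMr.
Qed.

Lemma geometric_sum_le (a q : R) N : 0 <= a -> 0 <= q -> q < 1 ->
  \sum_(0 <= j < N) a * q ^+ j <= a / (1 - q).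
Proof.
move=> a0 q0 q1; rewrite -mulr_sumr ler_wpM2l// -[leRHS]mul1r ler_pdivlMr ?subr_gt0//.
elim: N => [|N IH]; first by rewrite big_nil mul0r.
suff -> : (\sum_(0 <= j < N.+1) q ^+ j) * (1 - q) = 1 - q ^+ N.+1.
  by rewrite lerBlDr lerDl exprn_ge0.
elim: N {IH} => [|N IH]; first by rewrite big_nat1 expr0 mul1r expr1.
by rewrite big_nat_recr//= mulrDl IH [in RHS]exprS; ring.
Qed.

End dyadic.

Section kernel.
Context {R : realType} {n : nat}.
Local Notation Rn := 'rV[R]_n.
Hypothesis n_gt0 : (0 < n)%N.

Definition coulomb (i : 'I_n) (d : Rn) : R := d ord0 i / enorm d ^+ n.

(** An upper bound of s^(1-n) for s > 2^-(j+1). *)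
Definition dyadic_weight (j : nat) : R := 2 ^+ (j.+1 * n.-1).

(** If s is the sup norm of d, the kernel is at most s^(1-n): at most 1 when s >= 1,
and at most the weight of the dyadic shell of s otherwise. Once the singular
kernel is replaced by indicators of cubes, only masses over cubes have to be
estimated. *)
Lemma coulomb_le i d : (`|coulomb i d|%:E <= 1 + \sum_(j <oo)
  (dyadic_weight j * \1_(cube 0 (2 ^- j)) d)%:E)%E.
Proof.
have term0 j : (0 <= (dyadic_weight j * \1_(cube 0 (2 ^- j)) d)%:E)%E.
  by rewrite lee_fin mulr_ge0// exprn_ge0.
have series0 : (0 <= \sum_(j <oo) (dyadic_weight j * \1_(cube 0 (2 ^- j)) d)%:E)%E.
  by apply: nneseries_ge0.
have [j0 _ jmax] := @arg_maxP _ _ _ i predT (fun j => `|d ord0 j|) isT.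
set s := `|d ord0 j0| in jmax.
have di : `|d ord0 i| <= s by exact: jmax.
have [s0|s0] := eqVneq s 0.
  have -> : coulomb i d = 0.
    rewrite /coulomb; move: di; rewrite s0 normr_le0 => /eqP ->.
    by rewrite mul0r.
  by rewrite normr0 adde_ge0.
have {}s0 : 0 < s by rewrite lt_def s0 normr_ge0.
have ks : `|coulomb i d| <= s ^- n.-1.
  rewrite /coulomb normrM normfV normrX (ger0_norm (enorm_ge0 _)).
  have es : s <= enorm d by exact: coord_le_enorm.
  have e0 : 0 < enorm d by exact: lt_le_trans es.
  rewrite ler_pdivrMr ?exprn_gt0// mulrC ler_pdivlMr ?exprn_gt0//.
  have -> : enorm d ^+ n = enorm d * enorm d ^+ n.-1 by rewrite -exprS prednK.
  apply: ler_pM; rewrite ?exprn_ge0//; first exact: ltW.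
    exact: le_trans es.
  by rewrite lerXn2r// nnegrE ltW.
have [s1|s1] := leP 1 s.
  apply: (@le_trans _ _ 1%E); last by rewrite leeDl.
  rewrite lee_fin (le_trans ks)// invf_le1 ?exprn_gt0//.
  exact: exprn_ege1.
have [j [js1 js2]] := dyadic_scale s0 (ltW s1).
apply: (@le_trans _ _ (dyadic_weight j * \1_(cube 0 (2 ^- j)) d)%:E); last first.
  apply: (@le_trans _ _ (\sum_(0 <= k < j.+1)
    (dyadic_weight k * \1_(cube 0 (2 ^- k)) d)%:E)%E).
    by rewrite big_nat_recr//= leeDr// sume_ge0.
  by rewrite (le_trans (nneseries_lim_ge _ _))// leeDr.
rewrite indicE mem_set; last first.
  by apply/cubeP => k; rewrite mxE subr0 (le_trans (jmax k _)).
rewrite mulr1 lee_fin (le_trans ks)// /dyadic_weight exprM.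
rewrite -[leRHS]invrK lef_pV2 ?posrE ?invr_gt0 ?exprn_gt0//.
by rewrite -exprVn lerXn2r ?nnegrE ?(ltW s0) ?invr_ge0 ?exprn_ge0// ltW.
Qed.

Lemma measurable_coulomb i : measurable_fun setT (coulomb i).
Proof.
rewrite /coulomb; apply: measurable_funM; first exact: measurable_coor.
have -> : (fun d : Rn => (enorm d ^+ n)^-1) = (fun d => (enorm d ^+ n) `^ (-1)).
  by apply/funext => d; rewrite powR_inv1// exprn_ge0// enorm_ge0.
apply: (measurableT_comp (measurable_powR (-1))).
by apply: measurable_funX; exact: measurable_enorm.
Qed.

End kernel.
Arguments dyadic_weight {R} n j.

Lemma measurable_indic_fst {R : realType} d1 d2 (T1 : measurableType d1)
    (T2 : measurableType d2) (A : set T1) : measurable A ->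
  measurable_fun [set: T1 * T2] (fun z => \1_A z.1 : R).
Proof.
move=> mA.
have mi : measurable_fun [set: T1] (\1_A : T1 -> R) by exact: measurable_indic.
exact: (measurableT_comp mi measurable_fst).
Qed.

Section field_bound.
Context {R : realType} {n : nat}.
Local Notation Rn := 'rV[R]_n.
Local Notation leb := (lebesgue_measure_rV R n).
Local Notation leb2 := (leb \x leb)%E.
Hypothesis n_gt0 : (0 < n)%N.

(** These constants do not depend on the time when g runs over the values of a
solution, hence neither do the bounds derived from them. *)
Definition kinetic_bounds (m F A B : R) (g : Rn * Rn -> R) : Prop :=
  [/\ measurable_fun setT g, forall z, 0 <= g z, forall z, g z <= F,
      (\int[leb2]_z (g z)%:E <= A%:E)%E & (moment m g <= B%:E)%E].

Variables (m F A B : R).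
Hypothesis nm : n%:R ^+ 2 - n%:R < m.

Let m0 : 0 < m.
Proof.
have n1 : 1 <= n%:R :> R by rewrite ler1n.
by apply: le_lt_trans nm; rewrite subr_ge0 expr2 ler_peMr.
Qed.

Lemma measurable_fun_translate (x : Rn) : measurable_fun setT (fun y : Rn => x - y).
Proof.
apply: measurable_fun_rVP => i; rewrite (_ : (fun _ => _) = fun y : Rn => x ord0 i - y ord0 i).
  by apply: measurable_funB => //; exact: measurable_coor.
by apply/funext => y; rewrite !mxE.
Qed.

(** The same splitting of velocities as in [density_split], integrated over a cube of
positions. *)
Lemma integral_dyadic_cell (g : Rn * Rn -> R) (x : Rn) (r s : R) :
  kinetic_bounds m F A B g -> 0 <= r -> 0 < s ->
  (\int[leb2]_z (\1_(cube x r) z.1 * g z)%:E <=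
    (F * ((2 * r) ^+ n * (2 * s) ^+ n) + (s `^ m)^-1 * B)%:E)%E.
Proof.
move=> [mg g0 gF _ gB] r0 s0.
have F0 : 0 <= F by exact: le_trans (g0 (0, 0)) (gF _).
have H0 : 0 < s `^ m by exact: powR_gt0.
have mc := measurable_cube x r; have mc0 := measurable_cube (0 : Rn) s.
have mX : measurable (cube x r `*` cube (0 : Rn) s) by exact: measurableX.
have mh : measurable_fun setT (fun z : Rn * Rn => enorm z.2 `^ m * g z).
  apply: measurable_funM => //; apply: (measurableT_comp (measurable_powR m)).
  exact: (measurableT_comp measurable_enorm measurable_snd).
rewrite EFinD (EFinM F) (EFinM ((2 * r) ^+ n)) -(volume_cube x r0).
rewrite -(volume_cube 0 (ltW s0)) -product_measure1E//.
rewrite -[X in (leb \x leb)%E X]setIT -(integral_indic _ measurableT mX).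
apply: (@le_trans _ _ (F%:E * \int[leb2]_z (\1_(cube x r `*` cube (0 : Rn) s) z)%:E +
  (s `^ m)^-1%:E * moment m g)%E); last first.
  by rewrite leeD2l// EFinM lee_wpmul2l// lee_fin invr_ge0 ltW.
have H1 : 0 <= (s `^ m)^-1 by rewrite invr_ge0 ltW.
have mi : measurable_fun setT
    (fun z : Rn * Rn => (\1_(cube x r `*` cube (0 : Rn) s) z)%:E : \bar R).
  by apply/measurable_EFinP; exact: measurable_indic.
have mhE := proj2 (measurable_EFinP _ _) mh.
rewrite -(ge0_integralZl_EFin leb2 measurableT _ mi F0); last first.
  by move=> z _; rewrite lee_fin.
rewrite -(ge0_integralZl_EFin leb2 measurableT _ mhE H1); last first.
  by move=> z _; rewrite lee_fin mulr_ge0 ?powR_ge0.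
have m1 : measurable_fun setT (fun z : Rn * Rn =>
    (F%:E * (\1_(cube x r `*` cube (0 : Rn) s) z)%:E)%E).
  by apply: measurable_funeM; apply/measurable_EFinP; exact: measurable_indic.
have m2 : measurable_fun setT (fun z : Rn * Rn =>
    ((s `^ m)^-1%:E * (enorm z.2 `^ m * g z)%:E)%E).
  by apply: measurable_funeM; exact/measurable_EFinP.
rewrite -ge0_integralD//; last 2 first.
- by move=> z _; rewrite mule_ge0// lee_fin.
- by move=> z _; rewrite mule_ge0// lee_fin mulr_ge0 ?powR_ge0.
apply: ge0_le_integral => //.
- by move=> z _; rewrite lee_fin mulr_ge0.
- apply/measurable_EFinP; apply: measurable_funM => //.
  exact: measurable_indic_fst.
- exact: emeasurable_funD.
move=> [y v] _ /=; rewrite -!EFinM -EFinD lee_fin !indicE in_setX/=.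
have [yc|yc] := boolP (y \in _); last first.
  by rewrite mul0r mulr0 add0r mulr_ge0// mulr_ge0 ?powR_ge0.
have [vc|vc] := boolP (v \in _).
  by rewrite mul1r mulr1 (le_trans (gF _))// lerDl mulr_ge0// mulr_ge0 ?powR_ge0.
rewrite mul1r mulr0 add0r mulrA -[leLHS]mul1r ler_wpM2r//.
rewrite ler_pdivlMl// mulr1.
have [i vi] : exists i, s < `|v ord0 i|.
  apply: contrapT => /forallNP nv.
  move/negP: vc; apply; rewrite inE; apply/cubeP => i.
  by rewrite mxE subr0 leNgt; apply/negP/nv.
rewrite ge0_ler_powR ?nnegrE ?(ltW s0) ?enorm_ge0 ?(ltW m0)//.
exact: le_trans (ltW vi) (coord_le_enorm _ _).
Qed.

(** On the cube of half-side 2^-j, of weight 2^((j+1)(n-1)), velocities are split at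
b^j. The two parts of [integral_dyadic_cell] become terms of geometric series of
ratios b^n / 2 and 2^(n-1) / b^m, both less than 1 for the b of [dyadic_base]. *)
Lemma integral_coulomb_bounded : exists2 M : R, 0 <= M &
  forall g, kinetic_bounds m F A B g -> forall x i,
  (\int[leb2]_z (`|coulomb i (x - z.1)| * g z)%:E <= M%:E)%E.
Proof.
have [b [b0 bn bm]] := dyadic_base n_gt0 nm.
have bm0 : 0 < b `^ m by exact: powR_gt0.
pose q1 := b ^+ n / 2; pose q2 := 2 ^+ n.-1 / b `^ m.
have q10 : 0 <= q1 by rewrite divr_ge0// exprn_ge0// ltW.
have q20 : 0 <= q2 by rewrite divr_ge0// ?exprn_ge0// ltW.
have q11 : q1 < 1 by rewrite /q1; lra.
have q21 : q2 < 1 by rewrite ltr_pdivrMr// mul1r.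
pose F' := Num.max F 0; pose B' := Num.max B 0; pose A' := Num.max A 0.
have F'0 : 0 <= F' by rewrite le_max lexx orbT.
have B'0 : 0 <= B' by rewrite le_max lexx orbT.
have A'0 : 0 <= A' by rewrite le_max lexx orbT.
pose a1 := F' * (4 ^+ n * 2 ^+ n.-1); pose a2 := B' * 2 ^+ n.-1.
have a10 : 0 <= a1 by rewrite mulr_ge0// mulr_ge0// exprn_ge0.
have a20 : 0 <= a2 by rewrite mulr_ge0// exprn_ge0.
have M10 : 0 <= a1 / (1 - q1) by rewrite divr_ge0// subr_ge0 ltW.
have M20 : 0 <= a2 / (1 - q2) by rewrite divr_ge0// subr_ge0 ltW.
exists (A' + (a1 / (1 - q1) + a2 / (1 - q2))); first by rewrite !addr_ge0.
move=> g kg x i; have [mg g0 gF gA gB] := kg.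
have cell j : ((dyadic_weight n j)%:E *
    \int[leb2]_z (\1_(cube x (2 ^- j)) z.1 * g z)%:E <=
    (a1 * q1 ^+ j + a2 * q2 ^+ j)%:E)%E.
  have r0 : 0 <= 2 ^- j :> R by rewrite invr_ge0 exprn_ge0.
  have bj0 : 0 < b ^+ j by rewrite exprn_gt0.
  have w0 : 0 <= dyadic_weight n j :> R by rewrite exprn_ge0.
  apply: le_trans (lee_wpmul2l _ (integral_dyadic_cell x kg r0 bj0)) _.
    by rewrite lee_fin.
  rewrite -EFinM lee_fin mulrDr lerD//.
    apply: (@le_trans _ _ (dyadic_weight n j *
        (F' * ((2 * 2 ^- j) ^+ n * (2 * b ^+ j) ^+ n)))).
      rewrite ler_wpM2l// ler_wpM2r ?le_max ?lexx//.
      by rewrite mulr_ge0// exprn_ge0// mulr_ge0// ltW.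
    set P : R := 2 ^+ j.
    have P0 : P != 0 by rewrite expf_neq0.
    have e1 : dyadic_weight n j = 2 ^+ n.-1 * P ^+ n.-1 :> R.
      by rewrite /dyadic_weight mulSn exprD exprM.
    have e2 : (2 * P^-1) ^+ n * (2 * b ^+ j) ^+ n =
        4 ^+ n * (b ^+ n) ^+ j / (P * P ^+ n.-1).
      have E : 2 * P^-1 * (2 * b ^+ j) = 4 * b ^+ j * P^-1 by ring.
      by rewrite -exprS prednK// -exprMn E !exprMn exprVn [(b ^+ n) ^+ j]exprAC.
    have PN : P ^+ n.-1 != 0 by rewrite expf_neq0.
    rewrite e1 e2 /a1 /q1 exprMn exprVn -/P le_eqVlt; apply/orP; left; apply/eqP.
    by field; rewrite P0 PN.
  apply: (@le_trans _ _ (dyadic_weight n j * (((b ^+ j) `^ m)^-1 * B'))).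
    by rewrite ler_wpM2l// ler_wpM2l ?invr_ge0 ?powR_ge0// le_max lexx.
  have e1 : dyadic_weight n j = 2 ^+ n.-1 * (2 ^+ n.-1) ^+ j :> R.
    by rewrite /dyadic_weight mulSn exprD mulnC exprM.
  have e2 : (b ^+ j) `^ m = (b `^ m) ^+ j.
    by rewrite -(powR_mulrn _ (ltW b0)) -powRrM mulrC powRrM powR_mulrn// powR_ge0.
  by rewrite e1 e2 /a2 /q2 exprMn exprVn le_eqVlt; apply/orP; left; apply/eqP; ring.
pose T j (z : Rn * Rn) := (dyadic_weight n j * (\1_(cube x (2 ^- j)) z.1 * g z))%:E.
have T0 j z : (0 <= T j z)%E.
  by rewrite lee_fin mulr_ge0// ?exprn_ge0// mulr_ge0.
have mcell j : measurable_fun setT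
    (fun z : Rn * Rn => (\1_(cube x (2 ^- j)) z.1 * g z)%:E : \bar R).
  apply/measurable_EFinP; apply: measurable_funM => //.
  by apply: measurable_indic_fst; exact: measurable_cube.
have mT j : measurable_fun setT (T j).
  rewrite /T; under eq_fun do rewrite EFinM.
  exact: measurable_funeM.
have mg' : measurable_fun setT (fun z => (g z)%:E) by exact/measurable_EFinP.
have mS : measurable_fun setT (fun z => (\sum_(j <oo) T j z)%E).
  exact: ge0_emeasurable_sum.
apply: (@le_trans _ _ (\int[leb2]_z ((g z)%:E + \sum_(j <oo) T j z))%E).
  apply: ge0_le_integral => //.
  - by move=> z _; rewrite lee_fin mulr_ge0.
  - apply/measurable_EFinP; apply: measurable_funM => //.
    apply: measurableT_comp => //.
    apply: (measurableT_comp (f := coulomb i)); first exact: measurable_coulomb.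
    by apply: (measurableT_comp (measurable_fun_translate x)); exact: measurable_fst.
  - exact: emeasurable_funD.
  move=> [y v] _ /=; rewrite EFinM.
  apply: (@le_trans _ _ ((g (y, v))%:E * (1 + \sum_(j <oo)
     (dyadic_weight n j * \1_(cube 0 (2 ^- j)) (x - y))%:E))%E).
    by rewrite muleC lee_wpmul2l ?lee_fin// coulomb_le.
  have term0 j : (0 <= (dyadic_weight n j * \1_(cube 0 (2 ^- j)) (x - y))%:E)%E.
    by rewrite lee_fin mulr_ge0// exprn_ge0.
  rewrite ge0_muleDr//; last by apply: nneseries_ge0.
  rewrite mule1 leeD2l// -nneseriesZl//.
  apply: lee_nneseries => [j _ _|j _]; first by rewrite mule_ge0// lee_fin.
  rewrite /T -EFinM lee_fin mulrCA ler_wpM2l ?exprn_ge0//= mulrC ler_wpM2r//.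
  rewrite !indicE; have [h|_] := boolP (_ \in _) => //.
  suff -> : y \in cube x (2 ^- j) by [].
  rewrite inE; apply/cubeP => k; move: h; rewrite inE => /cubeP /(_ k).
  by rewrite !mxE subr0 distrC.
have g0' z : setT z -> (0 <= (g z)%:E)%E by rewrite lee_fin.
have S0 z : setT z -> (0 <= \sum_(j <oo) T j z)%E.
  by move=> _; apply: nneseries_ge0 => j _ _; exact: T0.
rewrite (ge0_integralD leb2 measurableT g0' mg' S0 mS).
rewrite EFinD leeD//; first by rewrite (le_trans gA)// lee_fin le_max lexx.
rewrite (integral_nneseries leb2 measurableT mT); last by move=> j z _; exact: T0.
apply: lime_le.
  by apply: is_cvg_nneseries => j _ _; apply: integral_ge0 => z _; exact: T0.
apply: nearW => N.
apply: (@le_trans _ _ (\sum_(0 <= j < N) (a1 * q1 ^+ j + a2 * q2 ^+ j)%:E)%E).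
  apply: lee_sum => j _; apply: le_trans (cell j).
  have w0 : 0 <= dyadic_weight n j :> R by rewrite exprn_ge0.
  rewrite -(ge0_integralZl_EFin leb2 measurableT _ (mcell j) w0)//; last first.
    by move=> z _; rewrite lee_fin mulr_ge0.
by rewrite sumEFin lee_fin big_split/= lerD// geometric_sum_le.
Qed.

End field_bound.

Section field.
Context {R : realType} {n : nat}.
Local Notation Rn := 'rV[R]_n.
Local Notation leb := (lebesgue_measure_rV R n).
Local Notation leb2 := (leb \x leb)%E.

(** Tonelli: for g >= 0 the density may be opened under the absolute value of the
kernel. *)
Lemma abse_integral_field_le (g : Rn * Rn -> R) x i :
  measurable_fun setT g -> (forall z, 0 <= g z) ->
  (`| \int[leb]_y ((coulomb i (x - y))%:E * density g y) | <=
   \int[leb2]_z (`|coulomb i (x - z.1)| * g z)%:E)%E.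
Proof.
move=> mg g0.
have mk : measurable_fun setT (fun y : Rn => coulomb i (x - y)).
  apply: (measurableT_comp (f := coulomb i)); first exact: measurable_coulomb.
  exact: measurable_fun_translate.
have mk' := proj2 (measurable_EFinP _ _) mk.
have md := measurable_density mg.
apply: le_trans (le_abse_integral leb measurableT _) _; first exact: emeasurable_funM.
rewrite (fubini_tonelli1 (fun z : Rn * Rn => (`|coulomb i (x - z.1)| * g z)%:E)); last 2 first.
- apply/measurable_EFinP; apply: measurable_funM => //.
  apply: measurableT_comp => //.
  exact: (measurableT_comp mk measurable_fst).
- by move=> z; rewrite lee_fin mulr_ge0.
rewrite le_eqVlt; apply/orP; left; apply/eqP.
apply: eq_integral => y _; rewrite abseM (gee0_abs (density_ge0 g0 y)) /fubini_F/=.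
under eq_integral do rewrite EFinM.
rewrite ge0_integralZl_EFin//.
- by move=> v _; rewrite lee_fin.
- apply/measurable_EFinP; exact: (measurableT_comp mg).
Qed.

Lemma electric_field_norm_le (M gamma : R) (g : Rn * Rn -> R) x i :
  measurable_fun setT g -> (forall z, 0 <= g z) ->
  (\int[leb2]_z (`|coulomb i (x - z.1)| * g z)%:E <= M%:E)%E ->
  `|electric_field gamma g x ord0 i| <= `|gamma| * M.
Proof.
move=> mg g0 gM; rewrite mxE normrM ler_wpM2l//.
have := le_trans (abse_integral_field_le x i mg g0) gM.
rewrite /coulomb; set I := (X in (`|X| <= _)%E).
rewrite -[X in _ -> `|fine X| <= _]/I.
by case: I => [r| |]//=; rewrite lee_fin.
Qed.

Variable f : R -> Rn * Rn -> R.
Hypothesis mf : measurable_fun setT (fun p : R * (Rn * Rn) => f p.1 p.2).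

Lemma measurable_time_density :
  measurable_fun setT (fun p : R * Rn => density (f p.1) p.2).
Proof.
apply: (measurable_integral_section leb
  (G := fun q : (R * Rn) * Rn => (f q.1.1 (q.1.2, q.2))%:E)).
apply/measurable_EFinP.
apply: (measurableT_comp (f := fun p : R * (Rn * Rn) => f p.1 p.2)
  (g := fun q : (R * Rn) * Rn => (q.1.1, (q.1.2, q.2)))) => //.
apply: measurable_fun_pair; first exact: (measurableT_comp measurable_fst measurable_fst).
apply: measurable_fun_pair => //.
exact: (measurableT_comp measurable_snd measurable_fst).
Qed.

Lemma measurable_electric_field gamma i :
  measurable_fun setT (fun p : R * Rn => electric_field gamma (f p.1) p.2 ord0 i).
Proof.
pose K (q : (R * Rn) * Rn) :=
  ((coulomb i (q.1.2 - q.2))%:E * density (f q.1.1) q.2)%E.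
have mK : measurable_fun setT K.
  apply: emeasurable_funM.
    apply/measurable_EFinP.
    apply: (measurableT_comp (f := coulomb i) (g := fun q : (R * Rn) * Rn => q.1.2 - q.2)).
      exact: measurable_coulomb.
    apply: measurable_fun_rVP => j.
    rewrite (_ : (fun _ => _) = fun q : (R * Rn) * Rn => q.1.2 ord0 j - q.2 ord0 j); last first.
      by apply/funext => q; rewrite !mxE.
    apply: measurable_funB.
      apply: (measurableT_comp (measurable_coor j)).
      exact: (measurableT_comp measurable_snd measurable_fst).
    exact: (measurableT_comp (measurable_coor j) measurable_snd).
  apply: (measurableT_comp (g := fun q : (R * Rn) * Rn => (q.1.1, q.2)) measurable_time_density).
  apply: measurable_fun_pair => //.
  exact: (measurableT_comp measurable_fst measurable_fst).
have mI : measurable_fun setT (fun p => \int[leb]_y K (p, y))%E.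
  exact: measurable_integral_section.
under eq_fun do rewrite mxE.
apply: measurable_funM => //.
exact: (measurableT_comp (fine_measurable _) mI).
Qed.

End field.

(** * Measurability of the tested equation *)

Lemma continuous_step {R : realType} : continuous (@step R).
Proof. exact: (smooth_step 0). Qed.

Lemma measurable_step_comp {R : realType} d (T : measurableType d) (h : T -> R) :
  measurable_fun setT h -> measurable_fun setT (fun x => step (h x)).
Proof.
by move=> mh; apply: measurableT_comp mh; exact: (continuous_measurable_fun continuous_step).
Qed.

Lemma measurable_dstep_comp {R : realType} d (T : measurableType d) (h : T -> R) :
  measurable_fun setT h -> measurable_fun setT (fun x => dstep (h x)).
Proof.
by move=> mh; apply: measurableT_comp mh; exact: (continuous_measurable_fun continuous_dstep).
Qed.

Section phase_measure.
Context {R : realType} {n : nat}.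
Local Notation Rn := 'rV[R]_n.
Local Notation leb := (lebesgue_measure_rV R n).
Local Notation leb2 := (leb \x leb)%E.

(** The sigma-finite structure on this product allows Tonelli and Fubini in (t, z). *)
Definition phase_measure : {sigma_finite_measure set (Rn * Rn)%type -> \bar R} :=
  HB.pack leb2
    (Measure_isSigmaFinite.Build _ _ _ leb2 (sigma_finite_product_measure1 leb leb)).

End phase_measure.
Arguments phase_measure : clear implicits.

Section measurable_operator.
Context {R : realType} {n : nat}.
Local Notation Rn := 'rV[R]_n.
Local Notation V := (R * (Rn * Rn))%type.
Variables (i : 'I_n) (sg M lam b eps dl : R) (a : 'I_n -> V -> R).
Hypothesis ma : forall j, measurable_fun setT (a j).

Lemma measurable_position j : measurable_fun setT (fun p : V => p.2.1 ord0 j).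
Proof.
apply: (measurableT_comp (measurable_coor j)).
exact: (measurableT_comp measurable_fst measurable_snd).
Qed.

Lemma measurable_velocity j : measurable_fun setT (fun p : V => p.2.2 ord0 j).
Proof.
apply: (measurableT_comp (measurable_coor j)).
exact: (measurableT_comp measurable_snd measurable_snd).
Qed.

(** The right-hand side of [vlasov_test_fun], with the field as a parameter. Its
measurability in (t, x, v) is visible, contrary to that of the derivatives in the
definition of the operator. *)
Definition explicit_operator (p : V) : R :=
  (step ((b - p.1) / eps) * ((sg * a i p - M) *
     dstep (sg * p.2.2 ord0 i - M * p.1 - lam)) -
   window b eps p.1 * step (sg * p.2.2 ord0 i - M * p.1 - lam)) *
  (\prod_(j < n) cutoff dl (p.2.1 ord0 j) (p.2.2 ord0 j)) +
  step ((b - p.1) / eps) * step (sg * p.2.2 ord0 i - M * p.1 - lam) *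
  \sum_(j < n) dcutoff dl (p.2.1 ord0 j) (p.2.2 ord0 j) (a j p) *
    \prod_(k < n | k != j) cutoff dl (p.2.1 ord0 k) (p.2.2 ord0 k).

Let mx := measurable_position.
Let mv := measurable_velocity.

Let maff (c s : R) (h : V -> R) : measurable_fun setT h ->
  measurable_fun setT (fun p => c + s * h p).
Proof. by move=> mh; apply: measurable_funD => //; exact: measurable_funM. Qed.

Let sub (h : V -> R) : measurable_fun setT h -> measurable_fun setT (fun p => 2 - dl * h p).
Proof. by move=> mh; apply: measurable_funB => //; exact: measurable_funM. Qed.

Let mtime : measurable_fun setT (fun p : V => p.1).
Proof. exact: measurable_fst. Qed.

Lemma measurable_tail_step :
  measurable_fun setT (fun p : V => step (sg * p.2.2 ord0 i - M * p.1 - lam)).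
Proof.
apply: measurable_step_comp; apply: measurable_funB => //.
by apply: measurable_funB; apply: measurable_funM.
Qed.

Lemma measurable_window : measurable_fun setT (window b eps).
Proof.
apply: measurable_funM => //; apply: measurable_dstep_comp.
by apply: measurable_funM => //; exact: measurable_funB.
Qed.

Let mcut j : measurable_fun setT (fun p : V => cutoff dl (p.2.1 ord0 j) (p.2.2 ord0 j)).
Proof.
by apply: measurable_funM; apply: measurable_funM; apply: measurable_step_comp;
  (exact: maff || exact: sub).
Qed.

Lemma measurable_explicit_operator : measurable_fun setT explicit_operator.
Proof.
have mb : measurable_fun setT (fun p : V => step ((b - p.1) / eps)).
  apply: measurable_step_comp; apply: measurable_funM => //.
  exact: measurable_funB.
have mS := measurable_tail_step.
have mD : measurable_fun setT (fun p : V => dstep (sg * p.2.2 ord0 i - M * p.1 - lam)).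
  apply: measurable_dstep_comp; apply: measurable_funB => //.
  by apply: measurable_funB; apply: measurable_funM.
have mW : measurable_fun setT (fun p : V => window b eps p.1).
  exact: (measurableT_comp measurable_window mtime).
have mcutP P : measurable_fun setT (fun p : V =>
    \prod_(k < n | P k) cutoff dl (p.2.1 ord0 k) (p.2.2 ord0 k)).
  under eq_fun do rewrite big_mkcond.
  by apply: measurable_prod => k _; case: (P k).
have mdiff (h : V -> R) : measurable_fun setT h -> measurable_fun setT (fun p =>
    step (2 - dl * h p) * dstep (2 + dl * h p) -
    dstep (2 - dl * h p) * step (2 + dl * h p)).
  move=> mh; apply: measurable_funB; apply: measurable_funM;
    (apply: measurable_step_comp || apply: measurable_dstep_comp);
    (exact: maff || exact: sub).
have mss (h : V -> R) : measurable_fun setT h -> measurable_fun setT (fun p =>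
    step (2 - dl * h p) * step (2 + dl * h p)).
  by move=> mh; apply: measurable_funM; apply: measurable_step_comp;
    (exact: maff || exact: sub).
apply: measurable_funD.
  apply: measurable_funM; last exact: mcutP.
  apply: measurable_funB; last exact: measurable_funM.
  apply: measurable_funM => //; apply: measurable_funM => //.
  by apply: measurable_funB => //; exact: measurable_funM.
apply: measurable_funM; first exact: measurable_funM.
apply: measurable_sum => j; apply: measurable_funM; last exact: mcutP.
apply: measurable_funM => //; apply: measurable_funD.
  by apply: measurable_funM; [apply: measurable_funM => //; exact: mdiff|exact: mss].
by apply: measurable_funM; [apply: measurable_funM => //; exact: mdiff|exact: mss].
Qed.

Lemma measurable_far : measurable_fun setT (fun p : V => far dl p.2).
Proof.
pose I : set R := `[(-1)%R, 1%R]%classic.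
rewrite (_ : (fun _ => _) = fun p : V => 1 - \prod_(j < n)
  (\1_I (dl * p.2.1 ord0 j) * \1_I (dl * p.2.2 ord0 j))).
  have m1 (h : V -> R) : measurable_fun setT h ->
      measurable_fun setT (fun p => \1_I (dl * h p) : R).
    move=> mh; have mi : measurable_fun setT (\1_I : R -> R).
      by apply: measurable_indic; exact: measurable_itv.
    by apply: (measurableT_comp mi); exact: measurable_funM.
  apply: measurable_funB => //; apply: measurable_prod => j _.
  by apply: measurable_funM; apply: m1.
have E (s : R) : (\1_I s : R) = (`|s| <= 1)%R%:R.
  by rewrite indicE mem_setE in_itv /= -ler_norml.
apply/funext => p; rewrite /far; case: ifPn => [/forallP h|/forallPn[j hj]].
  rewrite big1 ?subrr// => j _; rewrite !E.
  by have /andP[-> ->] := h j; rewrite mulr1.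
rewrite (bigD1 j)//= !E; move: hj; rewrite negb_and => /orP[]/negbTE ->.
  by rewrite !mul0r subr0.
by rewrite mulr0 mul0r subr0.
Qed.

End measurable_operator.

(** * Time windows and Lebesgue points *)

Section lebesgue_window.
Context {R : realType}.
Local Notation mu := (@lebesgue_measure R).

Lemma continuous_window (b eps : R) : continuous (window b eps).
Proof.
move=> t; apply: cvgM; last exact: cvg_cst.
apply: (@continuous_comp _ _ _ (fun t => (b - t) / eps) dstep); last exact: continuous_dstep.
by apply: cvgM; [apply: cvgB; [exact: cvg_cst|exact: cvg_id]|exact: cvg_cst].
Qed.

(** For eps < b < T the step goes from 1 to 0 inside [0, T]. *)
Lemma integral_window (b eps T : R) : 0 < eps -> eps < b -> b < T ->
  (\int[mu]_(t in `[0%R, T]) (window b eps t)%:E = 1)%E.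
Proof.
move=> eps0 epsb bT.
pose G t := - step ((b - t) / eps).
have dG (t : R) : is_derive t 1 G (window b eps t).
  have d1 : is_derive t 1 (fun t : R => (b - t) / eps) (- eps^-1).
    have d2 : is_derive t 1 ((cst b - id) * cst eps^-1)
        ((b - t) *: 0 + eps^-1 *: (0 - 1)).
      by apply: (is_deriveM (f := cst b - id) (g := cst eps^-1)).
    by apply: (is_derive_eq d2); rewrite scaler0 add0r sub0r scalerN /GRing.scale /= mulr1.
  have d3 : is_derive t 1 (step \o (fun t : R => (b - t) / eps))
      (dstep ((b - t) / eps) * - eps^-1).
    by apply: (@is_derive1_comp R step); exact: is_derive_step.
  apply: (is_derive_eq (is_deriveN d3)).
  by rewrite mulrN opprK.
have cG : continuous G.
  move=> t; apply/differentiable_continuous/derivable1_diffP.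
  by have [] := dG t.
have T0 : 0 < T by lra.
rewrite (@continuous_FTC2 R (window b eps) G 0 T T0).
- rewrite /G subr0 (@step_ge1E _ (b / eps)); last by rewrite ler_pdivlMr// mul1r ltW.
  rewrite step_le0E; last by rewrite pmulr_lle0 ?invr_gt0// subr_le0 ltW.
  by rewrite oppr0 -EFinB opprK add0r.
- by apply: continuous_subspaceT; exact: continuous_window.
- split.
  + by move=> t _; have [] := dG t.
  + exact/cvg_at_right_filter/cG.
  + exact/cvg_at_left_filter/cG.
- by move=> t _; rewrite derive1E; have [_ ->] := dG t.
Qed.

(** At a Lebesgue point b, averages against kernels bounded by K / eps on [b - eps, b]
converge to U b: the deviation is at most 2 K times the mean oscillation of U on
the ball of radius eps. *)
Lemma lebesgue_pt_window_le (U : R -> R) (T c b : R) :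
  mu.-integrable setT (EFin \o U) -> 0 < b -> b < T -> lebesgue_pt U b ->
  (forall eps, 0 < eps -> \int[mu]_(t in `[0, T]) (window b eps t * U t) <= c) ->
  U b <= c.
Proof.
move=> iU b0 bT lp Hc; rewrite leNgt; apply/negP => cU.
have [K K0 dK] := @dstep_bounded R.
pose eta := U b - c; have eta0 : 0 < eta by rewrite subr_gt0.
(* An oscillation below this value contradicts a deviation of eta; 1 is added
   because K may be 0. *)
pose dlt := eta / (2 * K + 1).
have dlt0 : 0 < dlt by rewrite divr_gt0//; lra.
have [eps [eps0 epsb dav]] : exists eps, [/\ 0 < eps, eps < b & (davg U b eps < dlt%:E)%E].
  have near1 : \forall r \near (0%R:R)^'+, (davg U b r < dlt%:E)%E.
    have z_dlt : (0%E < dlt%:E)%E by rewrite lte_fin.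
    exact: (lp _ (open_ereal_lt' z_dlt)).
  have near2 : \forall r \near (0%R:R)^'+, r < b.
    exact: nbhs_right_lt.
  have near3 : \forall r \near (0%R:R)^'+, 0 < r.
    exact: nbhs_right_gt.
  near ((0%R:R)^'+) => r; exists r.
  by split; near: r; [exact: near3|exact: near2|exact: near1].
have W0 t : 0 <= window b eps t by exact: window_ge0.
have WK t : window b eps t <= K / eps by exact: window_le.
have mW := measurable_window b eps.
have mI : measurable `[0, T] by exact: measurable_itv.
have mU : measurable_fun setT U by apply/measurable_EFinP; exact: measurable_int iU.
have iW : mu.-integrable `[0, T] (EFin \o window b eps).
  apply/integrableP; split.
    by apply/measurable_EFinP; exact: measurable_funTS.
  under eq_integral do rewrite /= ger0_norm//.
  by rewrite integral_window// ltry.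
have iWU : mu.-integrable `[0, T] (EFin \o (fun t => window b eps t * U t)).
  apply: (le_integrable (mu := mu) mI (g := fun t => ((K / eps)%:E * (U t)%:E)%E)).
  - apply/measurable_EFinP; apply: measurable_funTS.
    exact: measurable_funM.
  - move=> t _ /=; rewrite lee_fin (normrM (window b eps t)) (normrM (K / eps)) ler_wpM2r//.
    by rewrite (ger0_norm (W0 t)) (le_trans (WK t))// ler_norm.
  - by apply: integrableZl => //; exact: integrableS iU.
have iWc : mu.-integrable `[0, T] (EFin \o (fun t => U b * window b eps t)).
  rewrite (_ : _ \o _ = fun t => ((U b)%:E * (window b eps t)%:E)%E)//.
  exact: integrableZl.
have e1 : \int[mu]_(t in `[0, T]) (U b * window b eps t - window b eps t * U t) =
    U b - \int[mu]_(t in `[0, T]) (window b eps t * U t).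
  rewrite RintegralB// RintegralZl//.
  by rewrite {1}/Rintegral integral_window//= mulr1.
have ball_int : (\int[mu]_(y in ball b eps) `|(U y - U b)%:E| = (eps *+ 2)%:E * davg U b eps)%E.
  rewrite /davg /iavg lebesgue_measure_ball ?(ltW eps0)// muleA.
  rewrite inver mulrn_eq0 /= gt_eqF//= -EFinM divff ?mul1e//.
  by rewrite mulrn_eq0 /= gt_eqF.
have mbl : measurable (ball b eps) by exact: measurable_ball.
have : (eta%:E <= (K / eps)%:E * ((eps *+ 2)%:E * davg U b eps))%E.
  rewrite -ball_int.
  apply: (@le_trans _ _ (\int[mu]_(t in `[0%R, T])
      `|(U b * window b eps t - window b eps t * U t)%:E|)%E).
    apply: (@le_trans _ _ (`|\int[mu]_(t in `[0%R, T])
      (U b * window b eps t - window b eps t * U t)|%:E)).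
      rewrite lee_fin e1 (le_trans _ (ler_norm _))// lerB//.
      exact: Hc.
    have iB : mu.-integrable `[0, T]
        (EFin \o (fun t => U b * window b eps t - window b eps t * U t)).
      by apply: (integrableB _ iWc iWU); exact: measurable_itv.
    rewrite (EFin_normr_Rintegral _ iB)//.
    apply: le_abse_integral => //; apply/measurable_EFinP; apply: measurable_funTS.
    by apply: measurable_funB; exact: measurable_funM.
  have mUb : measurable_fun setT (fun y => `|(U y - U b)%:E|%E).
    by apply: measurableT_comp => //; apply/measurable_EFinP; exact: measurable_funB.
  have KE0 : 0 <= K / eps by rewrite divr_ge0// ltW.
  rewrite -ge0_integralZl_EFin//; last exact: measurable_funTS.
  rewrite [leLHS]integral_mkcond [leRHS]integral_mkcond.
  apply: ge0_le_integral => //.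
  - by move=> t _; apply: erestrict_ge0.
  - apply/(measurable_restrictT _ mI); apply: measurableT_comp => //.
    apply/measurable_EFinP; apply: measurable_funTS.
    by apply: measurable_funB; exact: measurable_funM.
  - apply/(measurable_restrictT _ mbl); apply: measurable_funeM.
    exact: measurable_funTS.
  move=> t _; rewrite /patch.
  have [tb|tb] := boolP (t \in (ball b eps : set R)).
    case: ifPn => _; last by rewrite mule_ge0 ?lee_fin.
    rewrite /= lee_fin [U b * _]mulrC -mulrBr normrM (ger0_norm (W0 t)) distrC.
    by rewrite ler_wpM2r.
  case: ifPn => // _.
  have -> : window b eps t = 0; last by rewrite mulr0 mul0r subrr /= normr0.
  have : ~ (`|b - t| < eps) by move: tb; rewrite notin_setE.
  move=> /negP; rewrite -leNgt ler_normr => /orP[h|h].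
    by rewrite /window dstep_ge1E ?mul0r// ler_pdivlMr// mul1r.
  rewrite /window dstep_le0E ?mul0r// pmulr_lle0 ?invr_gt0//.
  by lra.
apply/negP; rewrite -ltNge.
rewrite muleA -EFinM.
have -> : K / eps * (eps *+ 2) = 2 * K.
  by rewrite mulr2n; field; rewrite gt_eqF.
apply: (@le_lt_trans _ _ ((2 * K)%:E * dlt%:E)%E).
  by apply: lee_wpmul2l; [rewrite lee_fin mulr_ge0|exact: ltW].
rewrite -EFinM lte_fin /dlt mulrCA gtr_pMr// ltr_pdivrMr ?mul1r; lra.
Unshelve. all: by end_near.
Qed.

End lebesgue_window.

(** * Propagation of velocity tails *)

Section propagation.
Context {R : realType} {n : nat}.
Local Notation Rn := 'rV[R]_n.
Local Notation V := (R * (Rn * Rn))%type.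
Local Notation leb := (lebesgue_measure_rV R n).
Local Notation leb2 := (leb \x leb)%E.
Local Notation phase := (phase_measure R n).
Local Notation time := (@lebesgue_measure R).
Local Notation P := (time \x phase)%E.

Variables (T gamma m F A B M : R) (f : R -> Rn * Rn -> R) (g0 : Rn * Rn -> R).
Hypothesis mf : measurable_fun setT (fun p : V => f p.1 p.2).
Hypothesis kb : forall t, kinetic_bounds m F A B (f t).
Hypothesis foff : forall t z, t \notin `[0, T] -> f t z = 0.
Hypothesis M0 : 0 <= M.
Hypothesis EM : forall t x j, `|electric_field gamma (f t) x ord0 j| <= M.
Hypothesis ig0 : leb2.-integrable setT (EFin \o g0).
Hypothesis wf : forall (i : 'I_n) sg lam b eps dl,
  let psi := test_fun i sg M lam b eps dl in test_function T psi ->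
  (\int[lebesgue_measure]_(t in `[0, T]) \int[leb2]_z
     (f t z * vlasov_operator (electric_field gamma (f t)) psi t z)) +
  (\int[leb2]_z (g0 z * psi (0, z))) = 0.

Let f_ge0 t z : 0 <= f t z.
Proof. by have [] := kb t. Qed.

Let mft t : measurable_fun setT (f t).
Proof. by have [] := kb t. Qed.

Let intf_le t : (\int[phase]_z (f t z)%:E <= A%:E)%E.
Proof. by have [] := kb t. Qed.

Let A0 : 0 <= A.
Proof.
rewrite -lee_fin (le_trans _ (intf_le 0))//.
by apply: integral_ge0 => z _; rewrite lee_fin.
Qed.

Lemma integrable_f : P.-integrable setT (fun p : V => (f p.1 p.2)%:E).
Proof.
apply/integrable12ltyP; first exact/measurable_EFinP.
apply: (@le_lt_trans _ _ (\int[time]_(t in `[0%R, T]) A%:E)%E); last first.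
  by rewrite integral_cst//= lebesgue_measure_itv/=; case: ifP; rewrite ?mule0// ltry.
rewrite [leRHS]integral_mkcond; apply: ge0_le_integral => //.
- by move=> t _; exact: integral_ge0.
- apply: (measurable_fun_fubini_tonelli_F (m2 := phase) (fun p : V => `|(f p.1 p.2)%:E|)%E) => //.
  by apply: measurableT_comp => //; exact/measurable_EFinP.
- by apply: (proj1 (measurable_restrictT _ _)).
move=> t _; rewrite /patch; case: ifPn => [_|]; last first.
  by rewrite mem_setE => tT; rewrite integral0_eq// => z _; rewrite foff// abse0.
under eq_integral do rewrite gee0_abs ?lee_fin//.
exact: intf_le.
Qed.

Section dominated.
Variables (h : V -> R) (C : R).
Hypotheses (mh : measurable_fun setT h).
Hypothesis hC : forall p, `|h p| <= C * f p.1 p.2.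

Lemma dominated_integrable_time : P.-integrable setT (EFin \o h).
Proof.
apply: (le_integrable (mu := P) measurableT (f := EFin \o h)
  (g := fun p : V => (C%:E * (f p.1 p.2)%:E)%E)).
- exact/measurable_EFinP.
- by move=> p _ /=; rewrite lee_fin (le_trans (hC p))// ler_norm.
- by apply: integrableZl => //; exact: integrable_f.
Qed.

Lemma dominated_integrable_phase t : phase.-integrable setT (fun z => (h (t, z))%:E).
Proof.
apply: (le_integrable (mu := phase) measurableT (g := fun z : Rn * Rn => (C%:E * (f t z)%:E)%E)).
- by apply/measurable_EFinP; exact: (measurableT_comp mh).
- by move=> z _ /=; rewrite lee_fin (le_trans (hC (t, z)))// ler_norm.
- apply: integrableZl => //; apply/integrableP; split; first exact/measurable_EFinP.
  under eq_integral do rewrite gee0_abs ?lee_fin//.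
  by apply: le_lt_trans (intf_le t) _; rewrite ltry.
Qed.

(** Domination by f brings integrability on the whole of R x R^n x R^n, since f
vanishes for times outside [0, T]. *)
Lemma Rintegral_time_phase :
  \int[time]_(t in `[0, T]) \int[leb2]_z h (t, z) = \int[P]_p h p.
Proof.
rewrite Rintegral_mkcond /Rintegral; congr fine.
rewrite -(integral12_prod_meas1 dominated_integrable_time).
apply: eq_integral => t _; rewrite /fubini_F /patch; case: ifPn => [_|].
  rewrite fineK//; exact: (integrable_fin_num measurableT (dominated_integrable_phase t)).
rewrite mem_setE => tT; rewrite integral0_eq// => z _ /=.
have := hC (t, z); rewrite /= foff// mulr0 normr_le0.
by move=> /eqP ->.
Qed.

End dominated.

Section fixed_direction.
Variables (i : 'I_n) (sg lam b eps : R).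
Hypotheses (sg1 : `|sg| = 1) (eps0 : 0 < eps) (bT : b < T).

Let S (p : V) : R := step (sg * p.2.2 ord0 i - M * p.1 - lam).

(** The weak formulation is tested at cutoff scales 1 / (N + 1). The errors are carried
by the regions [far], whose intersection is empty, and f is integrable: they
vanish as N grows. *)
Lemma tail_weak :
  (\int[P]_p (f p.1 p.2 * (window b eps p.1 * S p)) <=
   \int[leb2]_z (`|g0 z| * step (sg * z.2 ord0 i - lam)))%R.
Proof.
have [K K0 dK] := @dstep_bounded R.
pose C := K / eps + n%:R * ((2 + M) * K).
have C0 : 0 <= C.
  by rewrite addr_ge0// ?divr_ge0// ?(ltW eps0)// mulr_ge0// mulr_ge0// addr_ge0.
pose d N : R := N.+1%:R^-1.
have d0 N : 0 < d N by rewrite invr_gt0.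
have d1 N : d N <= 1 by rewrite invf_le1// ler1n.
pose a j (p : V) := electric_field gamma (f p.1) p.2.1 ord0 j.
have ma j : measurable_fun setT (a j).
  have mE := measurable_electric_field mf gamma j.
  apply: (measurableT_comp (f := fun p : R * Rn => electric_field gamma (f p.1) p.2 ord0 j)
    (g := fun p : V => (p.1, p.2.1))) => //.
  apply: measurable_fun_pair; first exact: measurable_fst.
  exact: (measurableT_comp measurable_fst measurable_snd).
pose psi N := test_fun i sg M lam b eps (d N).
pose op N := explicit_operator i sg M lam b eps (d N) a.
have opE N t z : 0 <= t ->
    vlasov_operator (electric_field gamma (f t)) (psi N) t z = op N (t, z).
  by move=> t0; rewrite vlasov_test_fun.
pose h N (p : V) := f p.1 p.2 * op N p.
pose D := 2 * M * K + K / eps + n%:R * ((2 + M) * K).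
have mh N : measurable_fun setT (h N).
  by apply: measurable_funM => //; exact: measurable_explicit_operator.
have off p : ~~ (0 <= p.1) -> f p.1 p.2 = 0.
  by move=> p0; rewrite foff// in_itv/= negb_and p0.
have hD N p : `|h N p| <= D * f p.1 p.2.
  have [p0|p0] := boolP (0 <= p.1); last by rewrite /h off// mul0r mulr0 normr0.
  rewrite normrM (ger0_norm (f_ge0 _ _)) mulrC ler_wpM2r//.
  case: p p0 => t z /= t0; rewrite -opE//.
  by apply: vlasov_test_fun_norm => //; exact: EM.
pose hw (p : V) := f p.1 p.2 * (window b eps p.1 * S p).
have mhw : measurable_fun setT hw.
  apply: measurable_funM => //; apply: measurable_funM.
    exact: (measurableT_comp (measurable_window b eps) measurable_fst).
  exact: measurable_tail_step.
have hw0 p : 0 <= hw p.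
  by rewrite mulr_ge0//; apply: mulr_ge0; [exact: window_ge0|exact: step_ge0].
have hwC p : `|hw p| <= K / eps * f p.1 p.2.
  rewrite ger0_norm// /hw mulrC ler_wpM2r// -[leRHS]mulr1.
  apply: ler_pM; [exact: window_ge0|exact: step_ge0|exact: window_le|exact: step_le1].
pose hf N (p : V) := f p.1 p.2 * far (d N) p.2.
have mhf N : measurable_fun setT (hf N).
  by apply: measurable_funM => //; exact: measurable_far.
have hf0 N p : 0 <= hf N p by rewrite mulr_ge0// far_ge0.
have hfC N p : `|hf N p| <= 1 * f p.1 p.2.
  rewrite ger0_norm// /hf mulrC ler_wpM2r//.
  by rewrite /far; case: ifP.
have key N : \int[P]_p hw p <= C * \int[P]_p hf N p +
    \int[leb2]_z (`|g0 z| * step (sg * z.2 ord0 i - lam)).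
  have tf : test_function T (psi N) by exact: test_function_test_fun.
  have := wf tf.
  rewrite (_ : Rintegral _ _ _ = \int[P]_p h N p); last first.
    rewrite -(Rintegral_time_phase (mh N) (hD N)).
    apply: eq_Rintegral => t; rewrite inE /= in_itv /= => /andP[t0 _].
    by apply: eq_Rintegral => z _; rewrite opE.
  have ihw := dominated_integrable_time mhw hwC.
  have ihf := dominated_integrable_time (mhf N) (hfC N).
  have ihh := dominated_integrable_time (mh N) (hD N).
  have iChf : P.-integrable setT (EFin \o (fun p => C * hf N p)).
    rewrite (_ : _ \o _ = fun p => (C%:E * (EFin \o hf N) p)%E)//.
    exact: integrableZl.
  have le1 : \int[P]_p h N p <= C * \int[P]_p hf N p - \int[P]_p hw p.
    rewrite -RintegralZl// -RintegralB//; apply: le_Rintegral => //.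
      exact: (integrableB measurableT iChf ihw).
    move=> p _; have [p0|p0] := boolP (0 <= p.1); last first.
      by rewrite /h /hf /hw off// !mul0r mulr0 subr0.
    rewrite /h /hf /hw mulrCA -mulrBr ler_wpM2l//.
    case: p p0 => t z /= t0; rewrite -opE// addrC.
    by apply: vlasov_test_fun_le => //; exact: EM.
  have mpsi : measurable_fun setT (fun z => psi N (0, z)).
    have mv j : measurable_fun setT (fun z : Rn * Rn => z.2 ord0 j).
      exact: (measurableT_comp (measurable_coor j) measurable_snd).
    have mx j : measurable_fun setT (fun z : Rn * Rn => z.1 ord0 j).
      exact: (measurableT_comp (measurable_coor j) measurable_fst).
    rewrite /psi /test_fun /=; apply: measurable_funM; first apply: measurable_funM.
        exact: (measurable_cst (step (0 + 2) * step ((b - 0) / eps))).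
      apply: measurable_step_comp; apply: measurable_funB => //.
      by apply: measurable_funB => //; apply: measurable_funM.
    have mc (u : Rn * Rn -> R) : measurable_fun setT u ->
        measurable_fun setT (fun z => step (2 - d N * u z) * step (2 + d N * u z)).
      move=> mu; have mdu := measurable_funM (measurable_cst (d N)) mu.
      apply: measurable_funM; apply: measurable_step_comp.
        exact: measurable_funB.
      exact: measurable_funD.
    by apply: measurable_prod => j _; apply: measurable_funM; exact: mc.
  have mS0 : measurable_fun setT (fun z : Rn * Rn => step (sg * z.2 ord0 i - lam)).
    apply: measurable_step_comp; apply: measurable_funB => //.
    apply: measurable_funM => //.
    exact: (measurableT_comp (measurable_coor i) measurable_snd).
  have mg0 : measurable_fun setT g0.
    by apply/measurable_EFinP; exact: measurable_int ig0.
  have ing (u : Rn * Rn -> R) : measurable_fun setT u -> (forall z, `|u z| <= 1) ->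
      leb2.-integrable setT (EFin \o (fun z => g0 z * u z)).
    move=> mu u1; apply: (le_integrable measurableT _ _ ig0).
      by apply/measurable_EFinP; exact: measurable_funM.
    by move=> z _ /=; rewrite lee_fin normrM ler_piMr.
  have ing' (u : Rn * Rn -> R) : measurable_fun setT u -> (forall z, `|u z| <= 1) ->
      leb2.-integrable setT (EFin \o (fun z => `|g0 z| * u z)).
    move=> mu u1; apply: (le_integrable measurableT _ _ ig0).
      by apply/measurable_EFinP; apply: measurable_funM => //; exact: measurableT_comp.
    by move=> z _ /=; rewrite lee_fin normrM normr_id ler_piMr.
  have S01 (z : Rn * Rn) : `|step (sg * z.2 ord0 i - lam)| <= 1.
    by rewrite ger0_norm ?step_ge0 ?step_le1.
  have psile z : psi N (0, z) <= step (sg * z.2 ord0 i - lam) by exact: test_fun0_le.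
  have psi0 z : 0 <= psi N (0, z) by exact: test_fun_ge0.
  have le2 : \int[leb2]_z (g0 z * psi N (0, z)) <=
      \int[leb2]_z (`|g0 z| * step (sg * z.2 ord0 i - lam)).
    apply: le_Rintegral => //.
    - apply: ing => // z; rewrite ger0_norm//.
      by rewrite (le_trans (psile z))// step_le1.
    - exact: (ing' _ mS0 S01).
    move=> z _; apply: (@le_trans _ _ (`|g0 z| * psi N (0, z))).
      by rewrite ler_wpM2r// ler_norm.
    by rewrite ler_wpM2l.
  have arith (x y u w c : R) : x <= u - w -> y <= c -> x + y = 0 -> w <= u + c.
    by move=> *; lra.
  exact: arith le1 le2.
have cvg0 : \int[P]_p hf N p @[N --> \oo] --> 0.
  have cE : (\int[P]_p (hf N p)%:E @[N --> \oo] --> 0)%E.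
    have := @dominated_cvg _ _ _ P setT measurableT (fun N p => (hf N p)%:E)
      (cst 0%E) (fun p => (f p.1 p.2)%:E).
    rewrite integral0; apply => //.
    - by move=> N; apply/measurable_EFinP; exact: mhf.
    - move=> [t z] _; apply: cvg_near_cst.
      pose s := \sum_(j < n) (`|z.1 ord0 j| + `|z.2 ord0 j|).
      have sj j : `|z.1 ord0 j| + `|z.2 ord0 j| <= s.
        by rewrite /s (bigD1 j)//= lerDl sumr_ge0// => k _; rewrite addr_ge0.
      exists (Num.truncn s) => // N /= sN; apply/eqP.
      have sN1 : s <= N.+1%:R.
        by rewrite ltW// (lt_le_trans (truncnS_gt _))// ler_nat ltnS.
      rewrite /hf /far ifT ?mulr0//; apply/forallP => j.
      have sj' := le_trans (sj j) sN1.
      rewrite !normrM !(gtr0_norm (d0 N)) /d !ler_pdivrMl ?ltr0n// !mulr1.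
      by apply/andP; split; apply: le_trans sj'; rewrite ?lerDl ?lerDr.
    - exact: integrable_f.
    - by move=> N p _; rewrite lee_fin -[leRHS]mul1r; exact: hfC.
  exact: fine_cvg cE.
rewrite -[leRHS]add0r -(mulr0 C).
apply: (@cvgr_to_ge _ \oo _ _ (fun N => C * \int[P]_p hf N p +
  \int[leb2]_z (`|g0 z| * step (sg * z.2 ord0 i - lam)))).
  exact: (cvgD (cvgM (cvg_cst C) cvg0) (cvg_cst _)).
by apply: nearW => N; exact: key.
Qed.

End fixed_direction.

Section almost_every_time.

Let S (i : 'I_n) (sg lam : R) (p : V) : R := step (sg * p.2.2 ord0 i - M * p.1 - lam).

Let mfS i sg lam : measurable_fun setT (fun p : V => f p.1 p.2 * S i sg lam p).
Proof. by apply: measurable_funM => //; exact: measurable_tail_step. Qed.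

Let fSC i sg lam (p : V) : `|f p.1 p.2 * S i sg lam p| <= 1 * f p.1 p.2.
Proof.
rewrite normrM (ger0_norm (f_ge0 _ _)) mulrC ler_wpM2r//.
by rewrite ger0_norm ?step_ge0// step_le1.
Qed.

Let U i sg lam (t : R) : R := \int[phase]_z (f t z * S i sg lam (t, z)).

Let UE i sg lam t : (U i sg lam t)%:E = (\int[phase]_z (f t z * S i sg lam (t, z))%:E)%E.
Proof.
rewrite fineK//; apply: (integrable_fin_num measurableT).
exact: (dominated_integrable_phase (mfS i sg lam) (@fSC i sg lam) t).
Qed.

Let iU i sg lam : time.-integrable setT (EFin \o U i sg lam).
Proof.
have iP := dominated_integrable_time (mfS i sg lam) (@fSC i sg lam).
rewrite (_ : _ \o _ = fubini_F phase (EFin \o (fun p : V => f p.1 p.2 * S i sg lam p))).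
  exact: integrable_fubini_F.
by apply/funext => t; exact: UE.
Qed.

Let U_window i sg lam b eps : `|sg| = 1 -> 0 < eps -> b < T ->
  \int[time]_(t in `[0, T]) (window b eps t * U i sg lam t) <=
  \int[leb2]_z (`|g0 z| * step (sg * z.2 ord0 i - lam)).
Proof.
move=> sg1 eps0 bT; apply: le_trans (tail_weak i lam sg1 eps0 bT).
have [K K0 dK] := @dstep_bounded R.
pose hw (p : V) := f p.1 p.2 * (window b eps p.1 * S i sg lam p).
have mhw : measurable_fun setT hw.
  apply: measurable_funM => //; apply: measurable_funM.
    exact: (measurableT_comp (measurable_window b eps) measurable_fst).
  exact: measurable_tail_step.
have hwC p : `|hw p| <= K / eps * f p.1 p.2.
  have W0 : 0 <= window b eps p.1 by exact: window_ge0.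
  rewrite /hw mulrCA normrM (ger0_norm W0).
  apply: ler_pM => //; first exact: window_le.
  by rewrite -[leRHS]mul1r; exact: fSC.
rewrite -[leRHS](Rintegral_time_phase mhw hwC) le_eqVlt; apply/orP; left; apply/eqP.
apply: eq_Rintegral => t _; rewrite -RintegralZl//.
  by apply: eq_Rintegral => z _; rewrite /hw /= mulrCA.
exact: (dominated_integrable_phase (mfS i sg lam) (@fSC i sg lam) t).
Qed.

(** Directions, signs and integer levels are countably many, so a single null set of
times can be excluded for all of the inequalities. *)
Lemma tail_ae : \forall t \ae time, t \in `[0, T] ->
  forall (i : 'I_n) (s : bool) (N : nat),
  (\int[leb2]_z (f t z * step ((-1) ^+ s * z.2 ord0 i - M * t - N%:R))%:E <=
   \int[leb2]_z (`|g0 z| * step ((-1) ^+ s * z.2 ord0 i - N%:R))%:E)%E.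
Proof.
have sg1 (s : bool) : `|(-1) ^+ s : R| = 1 by rewrite normrX normrN1 expr1n.
have : \forall t \ae time, forall (i : 'I_n) (s : bool) (N : nat),
    lebesgue_pt (U i ((-1) ^+ s) N%:R) t.
  apply: filter_forall => i.
  apply: filter_forall => s.
  apply/ae_foralln => N.
  apply: lebesgue_differentiation; apply: open_integrable_locally; first exact: openT.
  exact: iU.
have ne0 : \forall t \ae time, t != 0 :> R.
  exists [set 0]; split => //; first exact: lebesgue_measure_set1.
  by move=> t /= /negP; rewrite negbK => /eqP.
have neT : \forall t \ae time, t != T :> R.
  exists [set T]; split => //; first exact: lebesgue_measure_set1.
  by move=> t /= /negP; rewrite negbK => /eqP.
have FF : Filter (almost_everywhere time) by exact: ae_filter_ringOfSetsType.
move=> lp; apply: (@filterS3 _ (almost_everywhere time) FF _ _ _ _ _ lp ne0 neT).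
move=> t lpt t0 tT' tT i s N.
move: tT; rewrite in_itv /= => /andP[le0t letT].
have lt0t : 0 < t by rewrite lt_def t0.
have ltT : t < T by rewrite lt_neqAle tT'.
have Ule := @lebesgue_pt_window_le R _ T _ t (iU i ((-1) ^+ s) N%:R) lt0t ltT (lpt i s N)
  (fun eps e0 => U_window i N%:R (sg1 s) e0 ltT).
rewrite -[leLHS](UE i ((-1) ^+ s) N%:R t).
apply: (@le_trans _ _ (\int[leb2]_z (`|g0 z| * step ((-1) ^+ s * z.2 ord0 i - N%:R)))%:E).
  by rewrite lee_fin.
rewrite fineK//; apply: (integrable_fin_num measurableT).
apply: (le_integrable measurableT _ _ ig0).
  apply/measurable_EFinP; apply: measurable_funM.
    apply: measurableT_comp => //; apply/measurable_EFinP; exact: measurable_int ig0.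
  apply: measurable_step_comp; apply: measurable_funB => //.
  apply: measurable_funM => //.
  exact: (measurableT_comp (measurable_coor i) measurable_snd).
move=> z _ /=; rewrite lee_fin normrM normr_id ler_piMr//.
by rewrite ger0_norm ?step_ge0// step_le1.
Qed.

End almost_every_time.

End propagation.

(** * From velocity tails to velocity moments *)

Section layer_cake.
Context {R : realType}.
Variables (k c : R).
Hypotheses (k0 : 0 <= k) (c0 : 0 <= c).

Definition level (N : nat) : R := (N%:R + c) `^ k.

Definition jump (N : nat) : R := level N.+1 - level N.

Lemma level_le (x y : R) : 0 <= x -> x <= y -> (x + c) `^ k <= (y + c) `^ k.
Proof.
by move=> x0 xy; apply: ge0_ler_powR; rewrite ?nnegrE ?lerD// addr_ge0// (le_trans x0).
Qed.

Lemma jump_ge0 N : 0 <= jump N.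
Proof. by rewrite subr_ge0; apply: level_le => //; rewrite ler_nat. Qed.

Definition two_steps (a x : R) (N : nat) : R :=
  step (x - a - N%:R) + step (- x - a - N%:R).

Lemma two_steps_ge0 a x N : 0 <= two_steps a x N.
Proof. by apply: addr_ge0; exact: step_ge0. Qed.

(** The increments up to the integer part of |x| - a telescope to at least |x|^k,
the shift by c >= a + 1 making up for a and for the rounding; for those indices
one of the two steps is 1. *)
Lemma powR_le_layers (a x : R) : a + 1 <= c ->
  ((`|x| `^ k)%:E <= (level 0)%:E + \sum_(N <oo) (jump N * two_steps a x N)%:E)%E.
Proof.
move=> ac; pose N := Num.truncn (`|x| - a).
have term0 j : (0 <= (jump j * two_steps a x j)%:E)%E.
  by rewrite lee_fin mulr_ge0 ?jump_ge0 ?two_steps_ge0.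
have xN : `|x| <= N%:R + c.
  have := truncnS_gt (`|x| - a); rewrite -/N -natr1; lra.
apply: (@le_trans _ _ ((level 0)%:E +
  \sum_(0 <= j < N) (jump j * two_steps a x j)%:E)%E); last first.
  by rewrite leeD2l// nneseries_lim_ge.
rewrite sumEFin -EFinD lee_fin.
apply: (@le_trans _ _ (level 0 + \sum_(0 <= j < N) jump j)).
  rewrite telescope_sumr// addrCA subrr addr0 /level.
  by apply: ge0_ler_powR; rewrite ?nnegrE// addr_ge0.
rewrite lerD2l; apply: ler_sum_nat => j /andP[_ jN].
rewrite -[leLHS]mulr1 ler_wpM2l ?jump_ge0//.
have jx : j.+1%:R <= `|x| - a by rewrite -truncn_gt_nat.
rewrite -natr1 in jx; rewrite /two_steps.
have [x0|x0] := leP 0 x.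
  rewrite ger0_norm// in jx; rewrite (@step_ge1E _ (x - a - j%:R)) ?lerDl ?step_ge0//; lra.
rewrite ltr0_norm// in jx; rewrite (@step_ge1E _ (- x - a - j%:R)) ?lerDr ?step_ge0//; lra.
Qed.

(** Conversely a step is at most 1 and vanishes at the levels above its argument, so
the increments telescope to at most (|x| + 1 + c)^k, for each of the two signs. *)
Lemma layers_le_powR (x : R) :
  (\sum_(N <oo) (jump N * two_steps 0 x N)%:E <= (2 * (`|x| + 1 + c) `^ k)%:E)%E.
Proof.
have half (y : R) (N : nat) : y <= `|x| ->
    \sum_(0 <= j < N) jump j * step (y - j%:R) <= level N /\
    \sum_(0 <= j < N) jump j * step (y - j%:R) <= (`|x| + 1 + c) `^ k.
  move=> yx; elim: N => [|N [IH1 IH2]].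
    by rewrite big_nil; split; exact: powR_ge0.
  rewrite big_nat_recr//=; have [yN|Ny] := leP y N%:R.
    rewrite step_le0E ?subr_le0// mulr0 addr0; split => //.
    by rewrite (le_trans IH1)// -subr_ge0 jump_ge0.
  have jN : jump N * step (y - N%:R) <= jump N.
    by rewrite ler_piMr ?jump_ge0 ?step_le1.
  have lN : \sum_(0 <= j < N) jump j * step (y - j%:R) + jump N * step (y - N%:R)
      <= level N.+1.
    by apply: le_trans (lerD IH1 jN) _; rewrite /jump addrCA subrr addr0.
  split => //; apply: (le_trans lN); apply: level_le => //.
  by rewrite -natr1 lerD2r (le_trans (ltW Ny)).
apply: lime_le.
  apply: is_cvg_nneseries => j _ _.
  by rewrite lee_fin mulr_ge0 ?jump_ge0 ?two_steps_ge0.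
apply: nearW => N; rewrite sumEFin lee_fin mulr_natl mulr2n.
under eq_bigr do rewrite /two_steps !subr0 mulrDr.
rewrite big_split/= lerD//.
  by have [] := half x N (ler_norm x).
by have [] := half (- x) N; first by rewrite -normrN ler_norm.
Qed.

End layer_cake.

Section moments.
Context {R : realType} d (T : measurableType d) (mu : {measure set T -> \bar R}).
Variables (x g h : T -> R) (A a c k : R).
Hypotheses (mx : measurable_fun setT x) (mg : measurable_fun setT g)
  (mh : measurable_fun setT h).
Hypotheses (g0 : forall z, 0 <= g z) (h0 : forall z, 0 <= h z).
Hypotheses (k0 : 0 <= k) (a0 : 0 <= a) (ac : a + 1 <= c).
Hypothesis gA : (\int[mu]_z (g z)%:E <= A%:E)%E.
Let c0 : 0 <= c.
Proof. exact: le_trans (addr_ge0 a0 ler01) ac. Qed.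

Let mstep b (s : bool) N : measurable_fun setT (fun z => step ((-1) ^+ s * x z - b - N%:R)).
Proof.
apply: measurable_step_comp; apply: measurable_funB => //.
by apply: measurable_funB => //; exact: measurable_funM.
Qed.

Let int_two_steps (u : T -> R) b N : measurable_fun setT u -> (forall z, 0 <= u z) ->
  (\int[mu]_z (u z * two_steps b (x z) N)%:E =
   \int[mu]_z (u z * step ((-1) ^+ false * x z - b - N%:R))%:E +
   \int[mu]_z (u z * step ((-1) ^+ true * x z - b - N%:R))%:E)%E.
Proof.
move=> mu' u0.
have u_ge0 (s : bool) z : (0 <= (u z * step ((-1) ^+ s * x z - b - N%:R))%:E)%E.
  by rewrite lee_fin mulr_ge0 ?step_ge0.
have mus (s : bool) : measurable_fun setT
    (fun z => (u z * step ((-1) ^+ s * x z - b - N%:R))%:E).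
  by apply/measurable_EFinP; apply: measurable_funM => //; exact: mstep.
rewrite -(ge0_integralD mu measurableT (fun z _ => u_ge0 false z) (mus false)
  (fun z _ => u_ge0 true z) (mus true)).
by apply: eq_integral => z _; rewrite -EFinD /two_steps expr0 expr1 mul1r mulN1r mulrDr.
Qed.

Let mts (u : T -> R) b N : measurable_fun setT u ->
  measurable_fun setT (fun z => (u z * two_steps b (x z) N)%:E).
Proof.
move=> mu'; apply/measurable_EFinP; apply: measurable_funM => //.
rewrite (_ : (fun _ => _) = fun z => step ((-1) ^+ false * x z - b - N%:R) +
  step ((-1) ^+ true * x z - b - N%:R)); last first.
  by apply/funext => z; rewrite expr0 expr1 mul1r mulN1r.
exact: measurable_funD.
Qed.

Let int_layers (u : T -> R) b : measurable_fun setT u -> (forall z, 0 <= u z) ->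
  (\int[mu]_z (\sum_(N <oo) (jump k c N)%:E * (u z * two_steps b (x z) N)%:E) =
   \sum_(N <oo) (jump k c N)%:E * \int[mu]_z (u z * two_steps b (x z) N)%:E)%E.
Proof.
move=> mu' u0; rewrite integral_nneseries//.
- apply: eq_eseriesr => N _; rewrite ge0_integralZl_EFin//.
  + by move=> z _; rewrite lee_fin mulr_ge0 ?two_steps_ge0.
  + exact: mts.
  + exact: jump_ge0.
- by move=> N; apply: measurable_funeM; exact: mts.
- move=> N z _; rewrite mule_ge0// lee_fin ?jump_ge0//.
  by rewrite mulr_ge0 ?two_steps_ge0.
Qed.

(** A moment is a superposition of tails, so comparing the tails at integer levels
compares all moments, up to a shift that does not depend on the exponent. *)
Lemma moment_le_of_tails :
  (forall (s : bool) (N : nat),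
    (\int[mu]_z (g z * step ((-1) ^+ s * x z - a - N%:R))%:E <=
     \int[mu]_z (h z * step ((-1) ^+ s * x z - N%:R))%:E)%E) ->
  (\int[mu]_z (`|x z| `^ k * g z)%:E <=
   (c `^ k * A)%:E + 2%:E * \int[mu]_z ((`|x z| + 1 + c) `^ k * h z)%:E)%E.
Proof.
move=> tails.
have mgE : measurable_fun setT (fun z => (g z)%:E) by exact/measurable_EFinP.
have J0 N : (0 <= (jump k c N)%:E)%E by rewrite lee_fin jump_ge0.
have mS (u : T -> R) b : measurable_fun setT u -> (forall z, 0 <= u z) ->
    measurable_fun setT
      (fun z => (\sum_(N <oo) (jump k c N)%:E * (u z * two_steps b (x z) N)%:E)%E).
  move=> mu' u0; apply: ge0_emeasurable_sum => [N z _ _|N _].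
    by rewrite mule_ge0// lee_fin mulr_ge0 ?two_steps_ge0.
  by apply: measurable_funeM; exact: mts.
have S0 (u : T -> R) b z : (forall z, 0 <= u z) ->
    (0 <= \sum_(N <oo) (jump k c N)%:E * (u z * two_steps b (x z) N)%:E)%E.
  move=> u0; apply: nneseries_ge0 => N _ _.
  by rewrite mule_ge0// lee_fin mulr_ge0 ?two_steps_ge0.
have l0 : 0 <= level k c 0 by exact: powR_ge0.
apply: (@le_trans _ _ (\int[mu]_z ((level k c 0)%:E * (g z)%:E +
    \sum_(N <oo) (jump k c N)%:E * (g z * two_steps a (x z) N)%:E))%E).
  apply: ge0_le_integral => //.
  - by move=> z _; rewrite lee_fin mulr_ge0 ?powR_ge0.
  - apply/measurable_EFinP; apply: measurable_funM => //.
    apply: (measurableT_comp (measurable_powR k)).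
    exact: measurableT_comp.
  - by apply: emeasurable_funD; [exact: measurable_funeM|exact: mS].
  move=> z _; rewrite mulrC EFinM.
  apply: le_trans (lee_wpmul2l _ (powR_le_layers k0 c0 (x z) ac)) _.
    by rewrite lee_fin.
  have term0 N : (0 <= (jump k c N * two_steps a (x z) N)%:E)%E.
    by rewrite lee_fin mulr_ge0 ?jump_ge0 ?two_steps_ge0.
  rewrite ge0_muleDr ?lee_fin//; last by apply: nneseries_ge0.
  rewrite muleC leeD2l// -nneseriesZl//.
  rewrite le_eqVlt; apply/orP; left; apply/eqP.
  by apply: eq_eseriesr => N _; rewrite -!EFinM; congr EFin; rewrite mulrCA.
rewrite ge0_integralD//; last first.
- exact: mS.
- by move=> z _; exact: S0.
- exact: measurable_funeM.
- by move=> z _; rewrite mule_ge0// lee_fin.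
rewrite ge0_integralZl_EFin//; last by move=> z _; rewrite lee_fin.
rewrite leeD//.
  by rewrite EFinM /level add0r lee_wpmul2l// lee_fin powR_ge0.
rewrite int_layers//.
apply: (@le_trans _ _ (\sum_(N <oo) (jump k c N)%:E *
    \int[mu]_z (h z * two_steps 0 (x z) N)%:E)%E).
  apply: lee_nneseries => N _.
    by move=> _; rewrite mule_ge0//; apply: integral_ge0 => z _;
      rewrite lee_fin mulr_ge0 ?two_steps_ge0.
  apply: lee_wpmul2l; first exact: J0.
  rewrite (int_two_steps _ _ mg g0) (int_two_steps _ _ mh h0).
  have t1 := tails false N; have t2 := tails true N.
  under [X in (_ <= X + _)%E]eq_integral do rewrite subr0.
  under [X in (_ <= _ + X)%E]eq_integral do rewrite subr0.
  exact: (leeD t1 t2).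
rewrite -int_layers// -ge0_integralZl_EFin//; last 2 first.
- by move=> z _; rewrite lee_fin mulr_ge0 ?powR_ge0.
- apply/measurable_EFinP; apply: measurable_funM => //.
  apply: (measurableT_comp (measurable_powR k)).
  by apply: measurable_funD => //; apply: measurable_funD => //; exact: measurableT_comp.
apply: ge0_le_integral => //.
- by move=> z _; exact: S0.
- exact: mS.
- apply: measurable_funeM; apply/measurable_EFinP; apply: measurable_funM => //.
  apply: (measurableT_comp (measurable_powR k)).
  by apply: measurable_funD => //; apply: measurable_funD => //; exact: measurableT_comp.
move=> z _.
have -> : (\sum_(N <oo) (jump k c N)%:E * (h z * two_steps 0 (x z) N)%:E =
    (h z)%:E * \sum_(N <oo) (jump k c N * two_steps 0 (x z) N)%:E)%E.
  rewrite -nneseriesZl; last first.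
    by move=> N _; rewrite lee_fin mulr_ge0 ?jump_ge0 ?two_steps_ge0.
  by apply: eq_eseriesr => N _; rewrite -!EFinM; congr EFin; rewrite mulrCA.
apply: le_trans (lee_wpmul2l _ (layers_le_powR k0 c0 (x z))) _; first by rewrite lee_fin.
by rewrite -!EFinM lee_fin mulrC -mulrA.
Qed.

End moments.

(** * From velocity moments to norms of the density *)

Section interpolation.
Context {R : realType} {n : nat}.
Local Notation Rn := 'rV[R]_n.
Local Notation leb := (lebesgue_measure_rV R n).
Local Notation leb2 := (leb \x leb)%E.
Hypothesis n_gt0 : (0 < n)%N.
Variables (g : Rn * Rn -> R) (F p : R).
Hypotheses (mg : measurable_fun setT g) (g0 : forall z, 0 <= g z).
Hypotheses (F0 : 0 < F) (gF : forall z, g z <= F) (p1 : 1 <= p).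

Let k : R := n%:R * (p - 1).
Let G : R := 2 ^+ n.+1 * F.

(** Comparable to the k-th power of the norm of v, and a sum of powers of
coordinates, for which the moments are controlled. *)
Definition coord_weight (k : R) (v : Rn) : R := \sum_(i < n) `|v ord0 i| `^ k.

Lemma coord_weight_ge0 l v : 0 <= coord_weight l v.
Proof. by apply: sumr_ge0 => i _; exact: powR_ge0. Qed.

Lemma measurable_coord_weight l : measurable_fun setT (coord_weight l).
Proof.
apply: measurable_sum => i; apply: (measurableT_comp (measurable_powR l)).
by apply: measurableT_comp => //; exact: measurable_coor.
Qed.

Let G0 : 0 < G. Proof. by rewrite mulr_gt0// exprn_gt0. Qed.
Let k0 : 0 <= k. Proof. by rewrite mulr_ge0// subr_ge0. Qed.

(** [density_split] is used with the radius r such that F (2 r)^n is half of the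
density. The other half is then at most r^-k times the weighted integral, and
k = n (p - 1) is the exponent for which r^k = (rho / G)^(p-1). *)
Lemma density_powR_le y : (`|density g y| `^ p <=
  (2 * G `^ (p - 1))%:E * \int[leb]_v (coord_weight k v * g (y, v))%:E)%E.
Proof.
have mw := measurable_coord_weight k.
have w0 := coord_weight_ge0 k.
have G1 : 0 < 2 * G `^ (p - 1) by rewrite mulr_gt0// powR_gt0.
have p0 : p != 0 by rewrite gt_eqF// (lt_le_trans _ p1).
have n0 : n%:R != 0 :> R by rewrite pnatr_eq0 -lt0n.
have far_weight r (v : Rn) : 0 < r -> (exists i, r < `|v ord0 i|) ->
    r `^ k <= coord_weight k v.
  move=> r0 [i ri]; apply: (@le_trans _ _ (`|v ord0 i| `^ k)).
    by apply: ge0_ler_powR => //; rewrite ?nnegrE//; exact: ltW.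
  by rewrite /coord_weight (bigD1 i)//= lerDl sumr_ge0// => j _; exact: powR_ge0.
rewrite gee0_abs ?density_ge0//.
set m := (\int[leb]_v _)%E.
have m0 : (0 <= m)%E by apply: integral_ge0 => v _; rewrite lee_fin mulr_ge0.
have split r : 0 < r -> (density g y <= (F * (2 * r) ^+ n)%:E + ((r `^ k)^-1)%:E * m)%E.
  move=> r0; apply: density_split => //; first exact: ltW.
    exact: powR_gt0.
  by move=> v; exact: (far_weight _ _ r0).
have := density_ge0 g0 y; move: split.
case: (density g y) => [rho| |//] split; last first.
  have := split 1 ltr01; rewrite powR1 invr1 mul1e.
  case: m m0 {split} => [m| |//] m0.
    by rewrite -EFinD leye_eq.
  by move=> _ _; rewrite gt0_muley ?lte_fin// leey.
rewrite lee_fin => rho0; have [->|rhoN0] := eqVneq rho 0.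
  by rewrite poweR_EFin powR0// mule_ge0// lee_fin ltW.
have {}rho0 : 0 < rho by rewrite lt_def rhoN0.
(* This radius solves F (2 r)^n = rho / 2. *)
pose r := (rho / G) `^ n%:R^-1.
have rG0 : 0 < rho / G by rewrite divr_gt0.
have r0 : 0 < r by exact: powR_gt0.
have rn : r ^+ n = rho / G.
  by rewrite -powR_mulrn ?ltW// -powRrM mulVf// powRr1// ltW.
have rk : r `^ k = (rho / G) `^ (p - 1) by rewrite -powRrM mulrA mulVf// mul1r.
have half : F * (2 * r) ^+ n = rho / 2.
  by rewrite exprMn rn /G exprS; field; rewrite gt_eqF// expf_neq0.
have := split r r0; rewrite half rk.
case: m m0 {split} => [m| |//] m0; last first.
  by move=> _; rewrite gt0_muley ?lte_fin// leey.
rewrite -EFinM -EFinD lee_fin poweR_EFin -EFinM lee_fin => h.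
have H0 : 0 < (rho / G) `^ (p - 1) by exact: powR_gt0.
have {}h : rho / 2 * (rho / G) `^ (p - 1) <= m.
  rewrite -ler_pdivlMr// [leRHS]mulrC; lra.
have -> : rho `^ p = 2 * G `^ (p - 1) * (rho / 2 * (rho / G) `^ (p - 1)).
  rewrite powRM ?invr_ge0 ?(ltW G0) ?(ltW rho0)//.
  rewrite -(powR_inv1 (ltW G0)) -powRrM mulN1r powRN.
  rewrite -(mulr_powRB1 (ltW rho0) (lt_le_trans ltr01 p1)).
  by field; rewrite gt_eqF// powR_gt0.
by rewrite ler_wpM2l// ltW.
Qed.

Lemma integral_density_powR_le : (\int[leb]_y (`|density g y| `^ p) <=
  (2 * G `^ (p - 1))%:E * \int[leb2]_z (coord_weight k z.2 * g z)%:E)%E.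
Proof.
have mw : measurable_fun setT (fun z : Rn * Rn => coord_weight k z.2 * g z).
  apply: measurable_funM => //.
  exact: (measurableT_comp (measurable_coord_weight k) measurable_snd).
have mwE := proj2 (measurable_EFinP _ _) mw.
have w0 (z : Rn * Rn) : (0 <= (coord_weight k z.2 * g z)%:E)%E.
  by rewrite lee_fin mulr_ge0// coord_weight_ge0.
have mF := measurable_fun_fubini_tonelli_F (m2 := leb) _ mwE w0.
have G1 : 0 <= 2 * G `^ (p - 1) by rewrite mulr_ge0// powR_ge0.
rewrite (fubini_tonelli1 _ mwE w0) -(ge0_integralZl_EFin _ _ _ mF G1)//; last first.
  by move=> y _; apply: integral_ge0 => v _; exact: (w0 (y, v)).
apply: ge0_le_integral => //.
- by move=> y _; exact: poweR_ge0.
- apply: (measurableT_comp (measurable_poweR p)).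
  apply: measurableT_comp => //; exact: measurable_density.
- exact: measurable_funeM.
by move=> y _; exact: density_powR_le.
Qed.

End interpolation.

Section moment_growth.
Context {R : realType} {n : nat}.
Local Notation Rn := 'rV[R]_n.
Local Notation leb := (lebesgue_measure_rV R n).
Local Notation leb2 := (leb \x leb)%E.
Hypothesis n_gt0 : (0 < n)%N.

(** The exponent k + 1 on the right makes bounds on moments of order at least 1
sufficient for every k >= 0. *)
Lemma shifted_power_le (x e c k : R) : 0 <= x -> x <= e -> 1 <= c -> 0 <= k ->
  (x + c) `^ k <= (2 * c) `^ k * (1 + e `^ (k + 1)).
Proof.
move=> x0 xe c1 k0; have c0 : 0 <= c by rewrite (le_trans _ c1).
have e1 : 0 <= e `^ (k + 1) by exact: powR_ge0.
have C0 : 0 <= (2 * c) `^ k by exact: powR_ge0.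
have [xc|cx] := leP x c.
  apply: (@le_trans _ _ ((2 * c) `^ k)).
    by apply: ge0_ler_powR => //; rewrite ?nnegrE ?mulr_ge0 ?addr_ge0//; lra.
  by rewrite ler_peMr// lerDl.
have e1' : 1 <= e by rewrite (le_trans c1)// (le_trans (ltW cx)).
have e0 : 0 <= e by rewrite (le_trans _ e1').
apply: (@le_trans _ _ ((2 * c * e) `^ k)).
  apply: ge0_ler_powR => //; rewrite ?nnegrE ?mulr_ge0 ?addr_ge0//.
  have : e <= c * e by rewrite ler_peMl.
  by rewrite -mulrA; lra.
rewrite powRM ?mulr_ge0// ler_wpM2l//.
apply: (@le_trans _ _ (e `^ (k + 1))); last by rewrite lerDr.
by apply: ler_powR => //; rewrite lerDl.
Qed.

Variables (h : Rn * Rn -> R) (A A0 F C0 c : R).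
Hypotheses (mh : measurable_fun setT h) (h0 : forall z, 0 <= h z).
Hypothesis hA : (\int[leb2]_z (h z)%:E <= A0%:E)%E.
Hypothesis C0_ge0 : 0 <= C0.
Hypothesis c_ge0 : 0 <= c.
Hypothesis hmom : forall k, 1 <= k -> (moment k h <= ((C0 * k) `^ (k / n%:R))%:E)%E.

Lemma shifted_moment_le (i : 'I_n) k : 0 <= k ->
  (\int[leb2]_z ((`|z.2 ord0 i| + 1 + c) `^ k * h z)%:E <=
   ((2 * (1 + c)) `^ k * (A0 + (C0 * (k + 1)) `^ ((k + 1) / n%:R)))%:E)%E.
Proof.
move=> k0.
have P0 : 0 <= (2 * (1 + c)) `^ k by exact: powR_ge0.
have mhE : measurable_fun setT (fun z => (h z)%:E) by exact/measurable_EFinP.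
have mk : measurable_fun setT (fun z : Rn * Rn => (enorm z.2 `^ (k + 1) * h z)%:E).
  apply/measurable_EFinP; apply: measurable_funM => //.
  apply: (measurableT_comp (measurable_powR (k + 1))).
  exact: (measurableT_comp measurable_enorm measurable_snd).
have h0' (z : Rn * Rn) : setT z -> (0 <= (h z)%:E)%E by rewrite lee_fin.
have k0' (z : Rn * Rn) : setT z -> (0 <= (enorm z.2 `^ (k + 1) * h z)%:E)%E.
  by rewrite lee_fin mulr_ge0// powR_ge0.
apply: (@le_trans _ _ (((2 * (1 + c)) `^ k)%:E *
    (\int[leb2]_z (h z)%:E + moment (k + 1) h))%E); last first.
  rewrite EFinM EFinD; apply: lee_wpmul2l; first by rewrite lee_fin.
  by apply: leeD => //; apply: hmom; rewrite lerDr.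
rewrite -(ge0_integralD leb2 measurableT h0' mhE k0' mk).
rewrite -(ge0_integralZl_EFin leb2 measurableT _ _ P0); last 2 first.
- by move=> z _; rewrite adde_ge0// ?h0' ?k0'.
- exact: emeasurable_funD.
apply: ge0_le_integral => //.
- by move=> z _; rewrite lee_fin mulr_ge0// powR_ge0.
- apply/measurable_EFinP; apply: measurable_funM => //.
  apply: (measurableT_comp (measurable_powR k)); apply: measurable_funD => //.
  apply: measurable_funD => //; apply: measurableT_comp => //.
  exact: (measurableT_comp (measurable_coor i) measurable_snd).
- by apply: measurable_funeM; exact: emeasurable_funD.
move=> z _; rewrite -EFinD -EFinM lee_fin.
have c1 : 1 <= 1 + c by rewrite lerDl.
have := shifted_power_le (normr_ge0 _) (coord_le_enorm z.2 i) c1 k0.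
rewrite addrA => /(ler_wpM2r (h0 z)) le1; apply: (le_trans le1).
by rewrite le_eqVlt; apply/orP; left; apply/eqP; ring.
Qed.

(** With k = n (p - 1), all factors of the interpolation bound are p-th powers of
constants, except the moment of order k + 1 <= n p, which is at most
(D n p)^p: the p-th root is linear in p. The constant depends on g only through
its sup bound and the comparison of moments, so that it is the same at almost all
times of a solution. *)
Lemma Lnorm_density_linear : exists D : R, forall g : Rn * Rn -> R,
  measurable_fun setT g ->
  (forall z, 0 <= g z) -> (forall z, g z <= F) ->
  (forall (i : 'I_n) k, 0 <= k -> (\int[leb2]_z (`|z.2 ord0 i| `^ k * g z)%:E <=
    (c `^ k * A)%:E + 2%:E * \int[leb2]_z ((`|z.2 ord0 i| + 1 + c) `^ k * h z)%:E)%E) ->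
  forall p, 1 <= p -> ('N[leb]_(p%:E) [density g] * (p^-1)%:E <= D%:E)%E.
Proof.
pose F1 := Num.max F 1.
have F1_gt0 : 0 < F1 by rewrite lt_max ltr01 orbT.
have [q qE] : exists q, q = 2 ^+ n.+1 * F1 by eexists.
have G0 : 0 < q by rewrite qE mulr_gt0// exprn_gt0.
pose D0 := 1 + `|A| + `|A0| + 2 * (1 + c) + C0 + q.
have nA := normr_ge0 A; have nA0 := normr_ge0 A0.
have c0 := c_ge0; have C00 := C0_ge0.
have [D1 DA DA0] : [/\ 1 <= D0, A <= D0 & A0 <= D0].
  by have := ler_norm A; have := ler_norm A0; rewrite /D0; split; lra.
have [Dc DC DG] : [/\ 2 * (1 + c) <= D0, C0 <= D0 & q <= D0].
  by rewrite /D0; split; lra.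
have D_ge0 : 0 <= D0 by lra.
have Dc' : c <= D0 by lra.
have nR1 : 1 <= n%:R :> R by rewrite ler1n.
have nR0 : n%:R != 0 :> R by rewrite pnatr_eq0 -lt0n.
exists (10 * n%:R * D0 * D0 `^ n%:R * (D0 * n%:R)) => g mg g0 gF gmom p p1.
have p0 : 0 < p by lra.
pose k := n%:R * (p - 1).
have k0 : 0 <= k by rewrite mulr_ge0// subr_ge0.
pose X := (D0 * (k + 1)) `^ ((k + 1) / n%:R).
have K1 : 1 <= k + 1 by rewrite lerDr.
have X1 : 1 <= X.
  rewrite -[leLHS](powRr0 (D0 * (k + 1))); apply: ler_powR.
    by rewrite mulr_ege1.
  by rewrite divr_ge0// (le_trans _ K1).
have DK : D0 `^ k * D0 = D0 `^ (k + 1).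
  by rewrite powRD ?powRr1//; apply/implyP => _; rewrite gt_eqF// (lt_le_trans ltr01).
have Y0 : 0 <= D0 `^ (k + 1) by exact: powR_ge0.
have mom_i (i : 'I_n) : (\int[leb2]_z (`|z.2 ord0 i| `^ k * g z)%:E <=
    (5 * (D0 `^ (k + 1) * X))%:E)%E.
  apply: le_trans (gmom i k k0) _.
  apply: (@le_trans _ _ ((c `^ k * A)%:E + 2%:E * ((2 * (1 + c)) `^ k *
      (A0 + (C0 * (k + 1)) `^ ((k + 1) / n%:R)))%:E)%E).
    by rewrite leeD2l//; apply: lee_wpmul2l => //; exact: shifted_moment_le.
  rewrite -EFinM -EFinD lee_fin.
  have t1 : c `^ k * A <= D0 `^ (k + 1).
    rewrite -DK; apply: (@le_trans _ _ (c `^ k * D0)).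
      by rewrite ler_wpM2l// powR_ge0.
    by rewrite ler_wpM2r// ge0_ler_powR// ?nnegrE.
  have cc : (2 * (1 + c)) `^ k <= D0 `^ k.
    by apply: ge0_ler_powR => //; rewrite nnegrE; lra.
  have XX : (C0 * (k + 1)) `^ ((k + 1) / n%:R) <= X.
    have k10 : 0 <= k + 1 by lra.
    apply: ge0_ler_powR; rewrite ?nnegrE; [exact: divr_ge0|exact: mulr_ge0..|].
    exact: ler_wpM2r.
  have t2 : (2 * (1 + c)) `^ k * (A0 + (C0 * (k + 1)) `^ ((k + 1) / n%:R)) <=
      2 * (D0 `^ (k + 1) * X).
    apply: (@le_trans _ _ ((2 * (1 + c)) `^ k * (D0 + D0 * X))).
      rewrite ler_wpM2l ?powR_ge0// lerD//; apply: (le_trans XX).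
      by rewrite ler_peMl// (le_trans _ X1).
    apply: (@le_trans _ _ (D0 `^ k * (D0 + D0 * X))).
      rewrite ler_wpM2r// addr_ge0// mulr_ge0//; lra.
    have -> : D0 `^ k * (D0 + D0 * X) = D0 `^ k * D0 + D0 `^ k * D0 * X by ring.
    by rewrite DK [leRHS]mulr_natl mulr2n lerD2r ler_peMr.
  have t3 : D0 `^ (k + 1) <= D0 `^ (k + 1) * X by rewrite ler_peMr.
  have arith (u v w y : R) : u <= w -> w <= y -> v <= 2 * y -> u + 2 * v <= 5 * y.
    by move=> *; lra.
  exact: arith t1 t3 t2.
have wk : (\int[leb2]_z (coord_weight k z.2 * g z)%:E <=
    (n%:R * (5 * (D0 `^ (k + 1) * X)))%:E)%E.
  rewrite (_ : (fun z => (coord_weight k z.2 * g z)%:E) =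
    (fun z : Rn * Rn => \sum_(i < n) (`|z.2 ord0 i| `^ k * g z)%:E)%E); last first.
    by apply/funext => z; rewrite sumEFin mulr_suml.
  rewrite ge0_integral_sum//.
  - rewrite mulr_natl -[X in (_ *+ X)%:E]card_ord -sumr_const -sumEFin.
    by apply: lee_sum => i _; exact: mom_i.
  - move=> i; apply/measurable_EFinP; apply: measurable_funM => //.
    apply: (measurableT_comp (measurable_powR k)); apply: measurableT_comp => //.
    exact: (measurableT_comp (measurable_coor i) measurable_snd).
  - by move=> i z _; rewrite lee_fin mulr_ge0// powR_ge0.
have gF1 z : g z <= F1 by rewrite le_max gF.
pose E := 10 * n%:R * D0 * D0 `^ n%:R * (D0 * n%:R) * p.
(* This is where n >= 1 bounds the exponent by n p. *)
have np : k + 1 <= n%:R * p by rewrite /k mulrBr mulr1; lra.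
have int_le : (\int[leb]_y (`|density g y| `^ p) <= (E `^ p)%:E)%E.
  apply: le_trans (integral_density_powR_le n_gt0 mg g0 F1_gt0 gF1 p1) _; rewrite -qE.
  have c1 : 0 <= 2 * q `^ (p - 1) by rewrite mulr_ge0// powR_ge0.
  apply: le_trans (lee_wpmul2l _ wk) _; first by rewrite lee_fin.
  rewrite -EFinM lee_fin.
  have s1 : q `^ (p - 1) <= D0 `^ p.
    apply: (@le_trans _ _ (D0 `^ (p - 1))).
      by apply: ge0_ler_powR; rewrite ?nnegrE ?(ltW G0)// subr_ge0.
    by apply: ler_powR => //; lra.
  have s2 : D0 `^ (k + 1) <= (D0 `^ n%:R) `^ p by rewrite -powRrM; exact: ler_powR.
  have s3 : X <= (D0 * n%:R * p) `^ p.
    apply: (@le_trans _ _ ((D0 * n%:R * p) `^ ((k + 1) / n%:R))).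
      have k10 : 0 <= k + 1 by lra.
      apply: ge0_ler_powR; rewrite ?nnegrE -?mulrA; [exact: divr_ge0|exact: mulr_ge0| |].
        by rewrite !mulr_ge0// ltW.
      exact: ler_wpM2l.
    apply: ler_powR; last by rewrite ler_pdivrMr ?(lt_le_trans ltr01)// mulrC.
    by rewrite -mulrA mulr_ege1// mulr_ege1.
  have s4 : 10 * n%:R <= (10 * n%:R) `^ p by apply: le1r_powR => //; lra.
  have -> : E `^ p = (10 * n%:R) `^ p * D0 `^ p * (D0 `^ n%:R) `^ p * (D0 * n%:R * p) `^ p.
    rewrite /E -!powRM ?mulr_ge0 ?powR_ge0//; try (by lra).
    by congr (_ `^ _); ring.
  rewrite (_ : 2 * _ * _ = 10 * n%:R * q `^ (p - 1) * D0 `^ (k + 1) * X);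
    last by ring.
  have n10 : 0 <= 10 * n%:R :> R by rewrite mulr_ge0.
  by rewrite !ler_pM// ?mulr_ge0 ?powR_ge0//; lra.
rewrite unlock /Lnorm.
have E0 : 0 <= E by rewrite !mulr_ge0 ?powR_ge0// ltW.
apply: (@le_trans _ _ (E%:E * (p^-1)%:E)%E); last first.
  by rewrite -EFinM lee_fin /E mulfK// gt_eqF.
apply: lee_wpmul2r; first by rewrite lee_fin invr_ge0 ltW.
rewrite -[X in (_ <= X)%E](_ : ((E `^ p)%:E `^ p^-1)%E = _); last first.
  by rewrite poweR_EFin -powRrM divff ?gt_eqF// powRr1.
apply: gt0_ler_poweR => //; rewrite ?invr_ge0 ?ltW//.
- by rewrite in_itv /= leey andbT; apply: integral_ge0 => y _; exact: poweR_ge0.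
- by rewrite in_itv /= leey andbT lee_fin powR_ge0.
Qed.

End moment_growth.

(** * A representative with bounds at every time and point *)

Section essential_bounds.
Context {R : realType}.
Local Notation time := (@lebesgue_measure R).

Lemma time_ess_sup_ltP (T : R) (u : R -> \bar R) : (time_ess_sup T u < +oo)%E ->
  exists2 C : R, 0 <= C & \forall t \ae time, t \in `[0, T] -> (u t <= C%:E)%E.
Proof.
rewrite /time_ess_sup; set r := mrestr _ _ => ltoo.
have [N [mN N0 sN]] := ess_sup_ge r u.
pose C := Num.max 0 (fine (ess_sup r u)).
exists C; first by rewrite le_max lexx.
exists (N `&` `[0, T]%classic); split => //.
  by apply: measurableI => //; exact: measurable_itv.
move=> t /= /not_implyP[tT ut]; split => //; apply: sN => /= ut'; apply: ut.
apply: (le_trans ut'); move: ltoo; rewrite /C.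
case: (ess_sup r u) => [s| |]//= _; last by rewrite leNye.
by rewrite lee_fin le_max lexx orbT.
Qed.

Lemma time_ess_sup_lty (T C : R) (u : R -> \bar R) :
  (\forall t \ae time, t \in `[0, T] -> (u t <= C%:E)%E) ->
  (time_ess_sup T u < +oo)%E.
Proof.
move=> [N [mN N0 sN]]; apply: (@le_lt_trans _ _ C%:E); last by rewrite ltry.
apply/ess_supP; exists (N `|` ~` `[0, T]%classic); split.
- by apply: measurableU => //; apply: measurableC; exact: measurable_itv.
- rewrite -[LHS]/(time ((N `|` ~` `[0%R, T]%classic) `&` `[0%R, T]%classic)).
  rewrite setIUl setICl setU0; apply: (subset_measure0 _ mN) => //.
  by apply: measurableI => //; exact: measurable_itv.
- move=> t /= ut; have [tT|tT] := boolP (t \in `[0, T]); last by right => /=; exact/negP.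
  by left; apply: sN => /= h; apply: ut; exact: h.
Qed.

Lemma Lnormy_ae d (X : measurableType d) (mu : {measure set X -> \bar R}) (g : X -> R) F :
  ('N[mu]_+oo [EFin \o g] <= F%:E)%E -> \forall z \ae mu, `|g z| <= F.
Proof.
rewrite unlock /Lnorm; case: ifPn => [_ le|].
  have := ess_sup_ge mu (abse \o (EFin \o g)); apply: filterS => z /= h.
  by rewrite -lee_fin (le_trans h).
rewrite -leNgt => mu0 _; exists setT; split => //.
by apply/eqP; rewrite eq_le mu0 measure_ge0.
Qed.

End essential_bounds.

Section almost_everywhere_density.
Context {R : realType} {n : nat}.
Local Notation Rn := 'rV[R]_n.
Local Notation leb := (lebesgue_measure_rV R n).
Local Notation leb2 := (leb \x leb)%E.

(** Almost every section of a null set is null. *)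
Lemma ae_density_eq (g1 g2 : Rn * Rn -> R) : measurable_fun setT g1 ->
  measurable_fun setT g2 -> (\forall z \ae leb2, g1 z = g2 z) ->
  \forall y \ae leb, density g1 y = density g2 y.
Proof.
move=> mg1 mg2 [N [mN N0 sN]].
have : ae_eq leb setT (leb \o xsection N) (cst 0%E).
  have mx : measurable_fun setT (leb \o xsection N) by exact: measurable_fun_xsection.
  apply/(ae_eq_integral_abs leb measurableT mx).
  rewrite -[RHS]N0; apply: eq_integral => y _.
  by rewrite gee0_abs.
apply: filterS => y /(_ I) /= Ny.
apply: ae_eq_integral => //.
- by apply/measurable_EFinP; exact: (measurableT_comp mg1).
- by apply/measurable_EFinP; exact: (measurableT_comp mg2).
exists (xsection N y); split => //; first exact: measurable_xsection.
move=> v /= h; rewrite /xsection /= inE; apply: sN => /= e; apply: h => _.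
by rewrite e.
Qed.

Lemma electric_field_ae_eq gamma (g1 g2 : Rn * Rn -> R) : measurable_fun setT g1 ->
  measurable_fun setT g2 -> (\forall z \ae leb2, g1 z = g2 z) ->
  electric_field gamma g1 = electric_field gamma g2.
Proof.
move=> mg1 mg2 e12; have de := ae_density_eq mg1 mg2 e12.
apply/funext => x; apply/rowP => i; rewrite !mxE; congr (_ * fine _).
have mk : measurable_fun setT (fun y : Rn => coulomb i (x - y)).
  apply: (measurableT_comp (f := coulomb i)); first exact: measurable_coulomb.
  exact: measurable_fun_translate.
have mkE := proj2 (measurable_EFinP _ _) mk.
apply: ae_eq_integral => //.
- exact: (emeasurable_funM mkE (measurable_density mg1)).
- exact: (emeasurable_funM mkE (measurable_density mg2)).
by apply: filterS de => y -> _.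
Qed.

Lemma Lnorm_density_ae_eq (p : R) (g1 g2 : Rn * Rn -> R) : measurable_fun setT g1 ->
  measurable_fun setT g2 -> (\forall z \ae leb2, g1 z = g2 z) ->
  ('N[leb]_(p%:E) [density g1] = 'N[leb]_(p%:E) [density g2])%E.
Proof.
move=> mg1 mg2 e12; have de := ae_density_eq mg1 mg2 e12.
rewrite unlock /Lnorm; congr (_ `^ _)%E.
have mp g : measurable_fun setT g ->
    measurable_fun setT (fun y => `|density g y| `^ p)%E.
  move=> mg; apply: (measurableT_comp (measurable_poweR p)).
  by apply: measurableT_comp => //; exact: measurable_density.
apply: ae_eq_integral => //; [exact: mp|exact: mp|].
by apply: filterS de => y -> _.
Qed.

End almost_everywhere_density.

Lemma ae_eq_Rintegral d (X : measurableType d) {R : realType}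
    (mu : {measure set X -> \bar R}) (D : set X) (u1 u2 : X -> R) :
  measurable D -> measurable_fun D u1 -> measurable_fun D u2 ->
  (\forall x \ae mu, D x -> u1 x = u2 x) ->
  \int[mu]_(x in D) u1 x = \int[mu]_(x in D) u2 x.
Proof.
move=> mD mu1 mu2 e12; rewrite /Rintegral; congr fine; apply: ae_eq_integral => //.
- exact/measurable_EFinP.
- exact/measurable_EFinP.
by apply: filterS e12 => x + Dx => ->.
Qed.

Section regularization.
Context {R : realType} {n : nat}.
Local Notation Rn := 'rV[R]_n.
Local Notation V := (R * (Rn * Rn))%type.
Local Notation leb := (lebesgue_measure_rV R n).
Local Notation leb2 := (leb \x leb)%E.
Local Notation phase := (phase_measure R n).
Local Notation time := (@lebesgue_measure R).

(** Enforces bounds that are only known almost everywhere. *)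
Definition clamp (F y : R) : R := Num.max 0 (Num.min y F).

Lemma clamp_ge0 F y : 0 <= clamp F y.
Proof. by rewrite le_max lexx. Qed.

Lemma clamp_le F y : 0 <= F -> clamp F y <= F.
Proof. by move=> F0; rewrite ge_max F0 ge_min lexx orbT. Qed.

Lemma clamp_le_norm F y : clamp F y <= `|y|.
Proof. by rewrite ge_max normr_ge0 ge_min ler_norm. Qed.

Lemma clamp_id F y : 0 <= y -> `|y| <= F -> clamp F y = y.
Proof.
move=> y0; rewrite ger0_norm// => yF.
by rewrite /clamp min_l// max_r.
Qed.

Lemma measurable_section_time (h : V -> R) t :
  measurable_fun setT h -> measurable_fun setT (fun z => h (t, z)).
Proof. by move=> mh; exact: (measurableT_comp mh). Qed.

Lemma measurable_Rintegral_section (h : V -> R) : measurable_fun setT h ->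
  measurable_fun setT (fun t => \int[leb2]_z h (t, z)).
Proof.
move=> mh; have mhE := proj2 (measurable_EFinP _ _) mh.
have mI := measurable_integral_section phase mhE.
exact: (measurableT_comp (fine_measurable _) mI).
Qed.

Lemma measurable_field_position gamma (h : V -> R) (j : 'I_n) : measurable_fun setT h ->
  measurable_fun setT
    (fun p : V => electric_field gamma (fun z => h (p.1, z)) p.2.1 ord0 j).
Proof.
move=> mh.
have mh' : measurable_fun setT (fun p : V => (fun t z => h (t, z)) p.1 p.2).
  by rewrite (_ : (fun _ => _) = h)//; apply/funext => -[].
have mE := measurable_electric_field (f := fun t z => h (t, z)) mh' gamma j.
apply: (measurableT_comp (f := fun p : R * Rn =>
    electric_field gamma (fun z => h (p.1, z)) p.2 ord0 j)
  (g := fun p : V => (p.1, p.2.1))) => //.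
apply: measurable_fun_pair; first exact: measurable_fst.
exact: (measurableT_comp measurable_fst measurable_snd).
Qed.

Variables (T gamma : R).

(** The field depends on the solution through integrals of the density, hence it does
not see null sets; neither do the integrals of the weak formulation. *)
Lemma weak_form_ae_eq (h1 h2 : V -> R) (N : set R) (i : 'I_n) sg M lam b eps dl :
  let psi := test_fun i sg M lam b eps dl in
  measurable_fun setT h1 -> measurable_fun setT h2 -> measurable N -> time N = 0%E ->
  (forall t, t \in `[0, T] -> ~ N t -> \forall z \ae leb2, h1 (t, z) = h2 (t, z)) ->
  \int[time]_(t in `[0, T]) \int[leb2]_z (h1 (t, z) *
     vlasov_operator (electric_field gamma (fun z => h1 (t, z))) psi t z) =
  \int[time]_(t in `[0, T]) \int[leb2]_z (h2 (t, z) *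
     vlasov_operator (electric_field gamma (fun z => h2 (t, z))) psi t z).
Proof.
move=> psi mh1 mh2 mN N0 h12.
pose op (h : V -> R) := explicit_operator i sg M lam b eps dl
  (fun j p => electric_field gamma (fun z => h (p.1, z)) p.2.1 ord0 j).
have mop (h : V -> R) : measurable_fun setT h -> measurable_fun setT (fun p => h p * op h p).
  move=> mh; apply: measurable_funM => //.
  by apply: measurable_explicit_operator => j; exact: measurable_field_position.
have E (h : V -> R) : \int[time]_(t in `[0, T]) \int[leb2]_z (h (t, z) *
     vlasov_operator (electric_field gamma (fun z => h (t, z))) psi t z) =
   \int[time]_(t in `[0, T]) \int[leb2]_z (h (t, z) * op h (t, z)).
  apply: eq_Rintegral => t; rewrite inE /= in_itv /= => /andP[t0 _].
  by apply: eq_Rintegral => z _; rewrite vlasov_test_fun.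
have mI (h : V -> R) : measurable_fun setT h -> measurable_fun `[0, T]
    (fun t => \int[leb2]_z (h (t, z) * op h (t, z))).
  by move=> mh; apply: measurable_funTS; exact: (measurable_Rintegral_section (mop h mh)).
apply: (eq_trans (E h1)); apply: esym; apply: (eq_trans (E h2)); apply: esym.
apply: ae_eq_Rintegral; [exact: measurable_itv|exact: mI|exact: mI|].
exists N; split => //; move=> t /= /not_implyP[tT ne]; apply: contrapT => Nt; apply: ne.
have e12 := h12 t tT Nt.
have ms1 := measurable_section_time t mh1; have ms2 := measurable_section_time t mh2.
have EE := electric_field_ae_eq gamma ms1 ms2 e12.
apply: ae_eq_Rintegral => //.
- exact: (measurable_section_time t (mop _ mh1)).
- exact: (measurable_section_time t (mop _ mh2)).
by apply: filterS e12 => z hz _; rewrite hz /op /explicit_operator /= EE.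
Qed.

Variables (m : R) (f0 : Rn * Rn -> R) (f : R -> Rn * Rn -> R).

(** The bounds of f hold for almost all times, and almost everywhere in phase space.
Clamping the values to [0, F] and putting 0 at the exceptional times and outside
[0, T] makes them hold everywhere, and [weak_form_ae_eq] keeps the weak
formulation. *)
Lemma regular_representative : m != 0 -> lions_perthame_solution gamma m T f0 f ->
  exists (ft : R -> Rn * Rn -> R) (A F B : R) (N : set R),
  [/\ measurable_fun setT (fun p : V => ft p.1 p.2),
      forall t, kinetic_bounds m F A B (ft t),
      forall t z, t \notin `[0, T] -> ft t z = 0,
      [/\ measurable N, time N = 0%E & forall t, t \in `[0, T] -> ~ N t ->
         measurable_fun setT (f t) /\ \forall z \ae leb2, f t z = ft t z] &
      forall (i : 'I_n) sg M lam b eps dl,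
        let psi := test_fun i sg M lam b eps dl in test_function T psi ->
        (\int[time]_(t in `[0, T]) \int[leb2]_z
           (ft t z * vlasov_operator (electric_field gamma (ft t)) psi t z)) +
        (\int[leb2]_z (f0 z * psi (0, z))) = 0].
Proof.
move=> m0 [[[mf /time_ess_sup_ltP[A A0 fA] /time_ess_sup_ltP[F F0 fF]] f_ge0 wf]
  /time_ess_sup_ltP[B B0 fB]].
have FF : Filter (almost_everywhere time) by exact: ae_filter_ringOfSetsType.
pose good t := [/\ ('N[leb2]_1 [EFin \o f t] <= A%:E)%E,
  ('N[leb2]_+oo [EFin \o f t] <= F%:E)%E, (moment m (f t) <= B%:E)%E &
  \forall z \ae leb2, 0 <= f t z].
have [N [mN N0 sN]] : \forall t \ae time, t \in `[0, T] -> good t.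
  have fAF := @filterI _ (almost_everywhere time) FF _ _ fA fF.
  have fBp := @filterI _ (almost_everywhere time) FF _ _ fB f_ge0.
  apply: (@filterS2 _ (almost_everywhere time) FF _ _ _ _ fAF fBp).
  move=> t [h1 h2] [h3 h4] tT.
  by split; [exact: h1|exact: h2|exact: h3|exact: h4].
have goodN t : t \in `[0, T] -> ~ N t -> good t.
  by move=> tT tN; apply: contrapT => ng; apply: tN; apply: sN => /(_ tT).
have mI : measurable (`[0, T]%classic : set R) by exact: measurable_itv.
pose DI : set V := `[0, T]%classic `*` setT.
have mDI : measurable DI by exact: measurableX.
pose D : set V := (`[0, T]%classic `\` N) `*` setT.
have mD : measurable D by apply: measurableX => //; exact: measurableD.
pose fx : V -> R := (fun p => f p.1 p.2) \_ DI.
have mfx : measurable_fun setT fx by apply/(measurable_restrictT _ mDI).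
(* fx extends f measurably by 0, and h also vanishes at the exceptional times. *)
pose h : V -> R := (fun p => clamp F (fx p)) \_ D.
have mh : measurable_fun setT h.
  apply/(measurable_restrictT _ mD); apply: measurable_funTS.
  by apply: measurable_maxr => //; exact: measurable_minr.
have fxE t z : t \in `[0, T] -> fx (t, z) = f t z.
  by move=> tT; rewrite /fx /patch ifT// inE; split.
have hE t z : t \in `[0, T] -> ~ N t -> h (t, z) = clamp F (f t z).
  by move=> tT tN; rewrite /h /patch ifT ?fxE// inE; split.
have hE0 t z : ~ (t \in `[0, T] /\ ~ N t) -> h (t, z) = 0.
  by move=> tN; rewrite /h /patch ifF//; apply/negbTE; rewrite notin_setE => -[/= ? _].
have mft t : t \in `[0, T] -> measurable_fun setT (f t).
  move=> tT; rewrite (_ : f t = fun z => fx (t, z)).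
    exact: measurable_section_time.
  by apply/funext => z; rewrite fxE.
have fh t : t \in `[0, T] -> ~ N t -> \forall z \ae leb2, f t z = h (t, z).
  move=> tT tN.
  have [_ gF _ gp] := goodN t tT tN.
  have := Lnormy_ae gF; have := gp; apply: filterS2 => z z0 zF.
  by rewrite hE// clamp_id.
exists (fun t z => h (t, z)), A, F, B, N; split.
- by rewrite (_ : (fun _ => _) = h)//; apply/funext => -[].
- move=> t; have [[tT tN]|tN] := pselect (t \in `[0, T] /\ ~ N t); last first.
    have -> : (fun z => h (t, z)) = cst 0 by apply/funext => z; rewrite hE0.
    split => //; first by rewrite integral0.
    by rewrite /moment; under eq_integral do rewrite mulr0; rewrite integral0 lee_fin.
  have ms := measurable_section_time t mh.
  split => //.
  + by move=> z; rewrite hE// clamp_ge0.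
  + by move=> z; rewrite hE// clamp_le.
  + have [gA _ _ _] := goodN t tT tN.
    apply: le_trans gA; rewrite Lnorm1; apply: ge0_le_integral => //.
    * by move=> z _; rewrite lee_fin hE// clamp_ge0.
    * exact/measurable_EFinP.
    * by apply: measurableT_comp => //; apply/measurable_EFinP; exact: mft.
    * by move=> z _ /=; rewrite lee_fin hE// clamp_le_norm.
  + have [_ _ gB _] := goodN t tT tN.
    apply: le_trans gB; rewrite le_eqVlt; apply/orP; left; apply/eqP.
    have me : measurable_fun setT (fun z : Rn * Rn => enorm z.2 `^ m).
      apply: (measurableT_comp (measurable_powR m)).
      exact: (measurableT_comp measurable_enorm measurable_snd).
    apply: ae_eq_integral => //.
    * by apply/measurable_EFinP; exact: measurable_funM.
    * by apply/measurable_EFinP; apply: measurable_funM => //; exact: mft.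
    * by apply: filterS (fh t tT tN) => z -> _.
- by move=> t z tT; rewrite hE0// => -[tT' _]; move: tT; rewrite tT'.
- by split => // t tT tN; split; [exact: mft|exact: fh].
move=> i sg M lam b eps dl psi tpsi.
apply: (eq_trans _ (wf _ tpsi)); apply: (congr1 (fun x => x + _)).
have fxh t : t \in `[0, T] -> ~ N t -> \forall z \ae leb2, fx (t, z) = h (t, z).
  by move=> tT tN; apply: filterS (fh t tT tN) => z <-; rewrite fxE.
apply: (eq_trans (esym (@weak_form_ae_eq fx h N i sg M lam b eps dl mfx mh mN N0 fxh))).
apply: eq_Rintegral => t; rewrite inE /= => tT.
have -> : (fun z => fx (t, z)) = f t by apply/funext => z; rewrite fxE.
by apply: eq_Rintegral => z _; rewrite fxE.
Qed.

End regularization.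

(** * Linear growth of the norms of the density *)

Theorem theorem1p2 (R : realType) (n : nat) (gamma m T : R)
    (f0 : 'rV[R]_n * 'rV[R]_n -> R) (f : R -> 'rV[R]_n * 'rV[R]_n -> R) :
  n = 2%N \/ n = 3%N ->
  gamma = 1 \/ gamma = -1 ->
  f0 \in Lfun (lebesgue_measure_rV R n \x lebesgue_measure_rV R n)%E 1%E ->
  f0 \in Lfun (lebesgue_measure_rV R n \x lebesgue_measure_rV R n)%E +oo%E ->
  (\forall z \ae (lebesgue_measure_rV R n \x lebesgue_measure_rV R n)%E,
     0 <= f0 z) ->
  n%:R ^+ 2 - n%:R < m ->
  (moment m f0 < +oo)%E ->
  0 < T ->
  lions_perthame_solution gamma m T f0 f ->
  (exists2 C0 : R, 0 <= C0 &
     forall k : R, 1 <= k -> (moment k f0 <= ((C0 * k) `^ (k / n%:R))%:E)%E) ->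
  (time_ess_sup T (fun t =>
     ereal_sup [set ('N[lebesgue_measure_rV R n]_(p%:E) [density (f t)]
                       * (p^-1)%:E)%E | p in [set p : R | (1 <= p)%R]])
   < +oo)%E.
Proof.
move=> n23 _ /Lfun1_integrable f0I _ f0_ge0 nm _ T0 sol [C0 C0_ge0 f0mom].
have n_gt0 : (0 < n)%N by case: n23 => ->.
have m_neq0 : m != 0.
  rewrite gt_eqF// (le_lt_trans _ nm)// subr_ge0 expr2 ler_peMr//.
  by rewrite ler1n.
have [ft [A [F [B [N [mft kb foff [mN N0 fft] wf]]]]]] := regular_representative m_neq0 sol.
have [M0 M0_ge0 hM0] := integral_coulomb_bounded n_gt0 F A B nm.
pose M := `|gamma| * M0.
have M_ge0 : 0 <= M by rewrite mulr_ge0.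
have EM t x j : `|electric_field gamma (ft t) x ord0 j| <= M.
  have [mg g0 _ _ _] := kb t; apply: electric_field_norm_le => //.
  exact: hM0 (kb t) x j.
have mf0 : measurable_fun setT f0 by apply/measurable_EFinP; exact: measurable_int f0I.
pose h z := `|f0 z|.
have mh : measurable_fun setT h by exact: measurableT_comp.
have [A0 hA0] : exists A0 : R, (\int[(lebesgue_measure_rV R n \x lebesgue_measure_rV R n)%E]_z
    (h z)%:E <= A0%:E)%E.
  have /integrableP[_ If0] := f0I; move: If0.
  have -> : (\int[(lebesgue_measure_rV R n \x lebesgue_measure_rV R n)%E]_z
     `|(EFin \o f0) z| = \int[(lebesgue_measure_rV R n \x lebesgue_measure_rV R n)%E]_z
     (h z)%:E)%E by exact: eq_integral.
  have : (0 <= \int[(lebesgue_measure_rV R n \x lebesgue_measure_rV R n)%E]_z (h z)%:E)%E.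
    by apply: integral_ge0 => z _; rewrite lee_fin normr_ge0.
  case: (integral _ _ _) => [r _ _|_|]; first by exists r.
  - by rewrite ltxx.
  - by rewrite leNgt ltNyr.
have hmom k : 1 <= k -> (moment k h <= ((C0 * k) `^ (k / n%:R))%:E)%E.
  move=> k1; apply: le_trans (f0mom k k1).
  rewrite le_eqVlt; apply/orP; left; apply/eqP.
  have me : measurable_fun setT (fun z : 'rV[R]_n * 'rV[R]_n => enorm z.2 `^ k).
    apply: (measurableT_comp (measurable_powR k)).
    exact: (measurableT_comp measurable_enorm measurable_snd).
  apply: ae_eq_integral => //.
  - by apply/measurable_EFinP; exact: measurable_funM.
  - by apply/measurable_EFinP; exact: measurable_funM.
  by apply: filterS f0_ge0 => z z0 _; rewrite /h ger0_norm.
(* M * T bounds the displacement of velocities, and 1 the rounding of levels. *)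
pose c := M * T + 1.
have c_ge0 : 0 <= c by rewrite addr_ge0// mulr_ge0// ltW.
have [D hD] := Lnorm_density_linear n_gt0 A F mh (fun z => normr_ge0 _) hA0 C0_ge0 c_ge0 hmom.
have tails := tail_ae mft kb foff M_ge0 EM f0I (fun i sg => wf i sg M).
have Nae : \forall t \ae (@lebesgue_measure R), ~ N t.
  by exists N; split => // t /= /contrapT.
have FF : Filter (almost_everywhere (@lebesgue_measure R)) by exact: ae_filter_ringOfSetsType.
apply: (@time_ess_sup_lty _ _ D).
apply: (@filterS2 _ (almost_everywhere (@lebesgue_measure R)) FF _ _ _ _ tails Nae).
move=> t tail Nt tT; have [mftt fae] := fft t tT Nt.
have [mg g0 gF gA _] := kb t.
apply: ge_ereal_sup => _ /= [p p1 <-].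
rewrite (Lnorm_density_ae_eq p mftt mg fae).
apply: (hD (ft t) mg g0 gF _ p p1) => i k k0.
have /andP[t0 tleT] : (0 <= t) && (t <= T) by move: tT; rewrite in_itv.
have mx : measurable_fun setT (fun z : 'rV[R]_n * 'rV[R]_n => z.2 ord0 i).
  exact: (measurableT_comp (measurable_coor i) measurable_snd).
have Mt_ge0 : 0 <= M * t by exact: mulr_ge0.
have Mt_le : M * t + 1 <= c by rewrite lerD2r ler_wpM2l.
exact: (moment_le_of_tails mx mg mh g0 (fun z => normr_ge0 _) k0 Mt_ge0 Mt_le gA
  (tail tT i)).
Qed.
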